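(* Let $M$ be a Riemann surface and let $V(z)$, $z\in M$, be a family of closed, shift-invariant subspaces of $L^2(S^1,\mathbb C^n)$ such that: (i) $S|V(z)$ is a pure shift for all $z\in M$; (ii) the subspaces $V(z)\ominus SV(z)=V(z)\cap(SV(z))^\perp$ form a smooth subbundle of rank $n$ of $M\times C^\infty(S^1,\mathbb C^n)$. Then there exists a smooth $\mathrm U(n)$-valued function $\psi$ on $S^1\times M$ with $\psi(1,z)=I$ such that $V(z)=\psi(\cdot,z)\mathcal H_+$ for all $z\in M$. If, in addition, (iii) $\partial_{\bar z}V\subseteq V$, then locally at every point of $M$, $V(z)=u(\cdot,z)\mathcal H_+$ with $u$ $\mathrm{GL}(n,\mathbb C)$-valued, smooth in $(\lambda,z)$ ($\lambda \in S^1$), and holomorphic in $z$. In particular, $V$ is a holomorphic subbundle of the trivial bundle $M\times L^2(S^1,\mathbb C^n)$.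
   Context: $S$ is the forward shift $(Sf)(\lambda)=\lambda f(\lambda)$ on $L^2(S^1,\mathbb C^n)$; shift-invariant means $SV(z)\subseteq V(z)$. $\mathcal H_+$ is the Hardy space of functions in $L^2(S^1,\mathbb C^n)$ whose negative Fourier coefficients vanish. $S|V(z)$ is a pure shift if $\bigcap_{k\in\mathbb N}S^kV(z)=\{0\}$. Smooth subbundle of rank $n$ of $M\times C^\infty(S^1,\mathbb C^n)$: near each point of $M$ the subspaces have a basis of $n$ elements depending smoothly on $(\lambda,z)$. $z$ also denotes a local complex coordinate on $M$. The condition $\partial_{\bar z}V\subseteq V$ means: for every (local) differentiable section $f$, i.e. $f(\cdot,z)\in V(z)$ for all $z$, one has $\partial_{\bar z}f(\cdot,z)\in V(z)$ for all $z$. *)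

(* Defs.v *)
From HB Require Import structures.
From mathcomp Require Import all_boot all_order all_algebra.
From mathcomp Require Import all_classical all_reals all_analysis.
From mathcomp Require Import complex.
Import Order.TTheory GRing.Theory Num.Theory.
Import numFieldNormedType.Exports.
Set Implicit Arguments.
Unset Strict Implicit.
Unset Printing Implicit Defensive.
Local Open Scope classical_set_scope.
Local Open Scope ring_scope.

Local Notation normc := ComplexField.Normc.normc.

(** * The circle and L^2(S^1, C^n) *)

Definition circle (R : realType) := {l : R[i] | `|l| == 1}.

Lemma expi_subproof (R : realType) (t : R) :
  `|Complex (cos t) (sin t)| == 1 :> R[i].
Proof. by rewrite normc_def /= cos2Dsin2 sqrtr1. Qed.

Definition expi (R : realType) (t : R) : circle R :=
  exist _ (Complex (cos t) (sin t)) (expi_subproof t).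

Lemma circle1_subproof (R : realType) : `|1 : R[i]| == 1.
Proof. by rewrite normr1. Qed.

Definition circle1 (R : realType) : circle R := exist _ 1 (circle1_subproof R).

Definition arc_measure (R : realType) :=
  mrestr (@lebesgue_measure R) (measurable_itv `[0, 2 * pi]).

(* Elements of L^2(S^1, C^n) are handled through representatives: [vfun] is the
   type of all C^n-valued functions on the circle, [L2] the (Borel)
   square-integrable ones, [aeq] equality almost everywhere.  A subspace of L^2
   is given by the set of all representatives in [L2] of its elements. *)
Definition vfun (R : realType) (n : nat) := circle R -> 'cV[R[i]]_n.

Definition L2 (R : realType) (n : nat) : set (vfun R n) :=
  [set f | forall i : 'I_n,
     (fun t => complex.Re (f (expi t) i 0)) \in Lfun (@arc_measure R) 2%:E /\
     (fun t => complex.Im (f (expi t) i 0)) \in Lfun (@arc_measure R) 2%:E].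

Definition aeq (R : realType) (n : nat) (f g : vfun R n) : Prop :=
  {ae @arc_measure R, forall t, f (expi t) = g (expi t)}.

Definition circle_mean (R : realType) (h : circle R -> R[i]) : R[i] :=
  Complex
    ((2 * pi)^-1 * Rintegral (@arc_measure R) setT
                     (fun t => complex.Re (h (expi t))))
    ((2 * pi)^-1 * Rintegral (@arc_measure R) setT
                     (fun t => complex.Im (h (expi t)))).

Definition inner (R : realType) (n : nat) (f g : vfun R n) : R[i] :=
  \sum_(i < n) circle_mean (fun l => f l i 0 * (g l i 0)^*).

Definition l2norm (R : realType) (n : nat) (f : vfun R n) : R :=
  Num.sqrt (complex.Re (inner f f)).

Definition fourier (R : realType) (n : nat) (f : vfun R n) (m : int)
    (i : 'I_n) : R[i] :=
  circle_mean (fun l => (val l) ^ (- m) * f l i 0).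

Definition hardy (R : realType) (n : nat) : set (vfun R n) :=
  [set f | L2 f /\ forall (m : int) (i : 'I_n), m < 0 -> fourier f m i = 0].

Definition fwd_shift (R : realType) (n : nat) (f : vfun R n) : vfun R n :=
  fun l => val l *: f l.

Definition mulM (R : realType) (n : nat) (A : circle R -> 'M[R[i]]_n)
    (f : vfun R n) : vfun R n :=
  fun l => A l *m f l.

(* Approximation in [l2norm] includes almost everywhere equality, so such a set
   is saturated under [aeq] within [L2]. *)
Definition closed_subspace (R : realType) (n : nat) (W : set (vfun R n)) :=
  [/\ W `<=` @L2 R n,
      W (fun=> 0),
      forall (a : R[i]) (f g : vfun R n), W f -> W g ->
        W (fun l => a *: f l + g l) &
      forall f : vfun R n, L2 f ->
        (forall e : R, 0 < e ->
           exists2 g : vfun R n, W g & l2norm (fun l => f l - g l) < e) ->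
        W f].

Definition shift_invariant (R : realType) (n : nat) (W : set (vfun R n)) :=
  @fwd_shift R n @` W `<=` W.

Definition pure_shift (R : realType) (n : nat) (W : set (vfun R n)) :=
  forall f : vfun R n,
    (forall k : nat, (iter k (@fwd_shift R n) @` W) f) -> aeq f (fun=> 0).

Definition wandering (R : realType) (n : nat) (W : set (vfun R n)) :
    set (vfun R n) :=
  [set f | W f /\ forall g, (@fwd_shift R n @` W) g -> inner f g = 0].

Definition l2_basis (R : realType) (n r : nat) (s : 'I_r -> vfun R n)
    (W : set (vfun R n)) :=
  (forall f : vfun R n, W f <->
     L2 f /\ exists c : 'I_r -> R[i], aeq f (fun l => \sum_j c j *: s j l)) /\
  (forall c : 'I_r -> R[i],
     aeq (fun l => \sum_j c j *: s j l) (fun=> 0) -> forall j, c j = 0).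

(** * Riemann surfaces *)

Definition holomorphic_at (R : realType) (f : R[i] -> R[i]) (w : R[i]) :=
  derivable (f : R[i]^o -> R[i]^o) w 1.

(* [chart_coord] is only meaningful on [chart_dom], [chart_param] only on the
   image [chart_codom] of [chart_coord]. *)
Record chart (R : realType) (M : topologicalType) := Chart {
  chart_dom : set M;
  chart_coord : M -> R[i];
  chart_param : R[i] -> M }.

Definition chart_codom (R : realType) (M : topologicalType) (c : chart R M) :
    set (R[i]^o) :=
  chart_coord c @` chart_dom c.

Definition is_chart (R : realType) (M : topologicalType) (c : chart R M) :=
  [/\ open (chart_dom c), open (chart_codom c),
      {in chart_dom c, forall p, chart_param c (chart_coord c p) = p},
      {in chart_dom c, continuous (chart_coord c : M -> R[i]^o)} &
      {in chart_codom c, continuous (chart_param c : R[i]^o -> M)}].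

Record riemannSurface (R : realType) := RiemannSurface {
  carrier :> topologicalType;
  atlas : set (chart R carrier);
  surface_hausdorff : hausdorff_space carrier;
  surface_connected : connected [set: carrier];
  atlas_chart : forall c, atlas c -> is_chart c;
  atlas_cover : forall p : carrier, exists2 c, atlas c & chart_dom c p;
  atlas_holomorphic : forall c d, atlas c -> atlas d ->
    forall p, chart_dom c p -> chart_dom d p ->
      holomorphic_at (chart_coord d \o chart_param c) (chart_coord c p) }.

(** * Smooth and holomorphic dependence on parameters *)

Fixpoint Ck_on (R : realType) (E : normedModType R) (D : set E) (k : nat)
    (f : E -> R) : Prop :=
  (forall x, D x -> {for x, continuous f}) /\
  (if k is k'.+1 then
     forall v : E,
       (forall x, D x -> derivable f x v) /\ Ck_on D k' (fun x => 'D_v f x)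
   else True).

Definition smooth_on (R : realType) (E : normedModType R) (D : set E)
    (f : E -> R) :=
  forall k, Ck_on D k f.

(* Smoothness of F on S^1 x N (N open), read in the real coordinates
   (t, x, y) |-> (e^{it}, z), where x + iy is a local coordinate of z. *)
Definition smooth_circle (R : realType) (M : riemannSurface R) (N : set M)
    (F : circle R -> M -> R[i]) :=
  forall c : chart R M, atlas c ->
    let point (q : R * R * R) : R[i] := Complex q.1.2 q.2 in
    let D := [set q : R * R * R |
                chart_codom c (point q) /\ N (chart_param c (point q))] in
    smooth_on D (fun q => complex.Re (F (expi q.1.1) (chart_param c (point q)))) /\
    smooth_on D (fun q => complex.Im (F (expi q.1.1) (chart_param c (point q)))).

Definition holomorphic_on (R : realType) (M : riemannSurface R) (N : set M)
    (g : M -> R[i]) :=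
  forall c : chart R M, atlas c -> forall p, N p -> chart_dom c p ->
    holomorphic_at (g \o chart_param c) (chart_coord c p).

Definition smooth_wandering_subbundle (R : realType) (M : riemannSurface R)
    (n : nat) (V : M -> set (vfun R n)) (r : nat) :=
  forall p0 : M, exists (N : set M) (s : 'I_r -> M -> vfun R n),
    [/\ open N, N p0,
        forall j i, smooth_circle N (fun l p => s j p l i 0) &
        forall p, N p -> l2_basis (fun j => s j p) (wandering (V p))].

(** * The condition dbar V <= V *)

(* Total (Frechet) real differentiability at p, in the norm of L^2, with
   partial derivatives fx and fy in the coordinate x + iy given by c. *)
Definition has_partials (R : realType) (M : riemannSurface R) (n : nat)
    (c : chart R M) (f : M -> vfun R n) (p : M) (fx fy : vfun R n) :=
  [/\ L2 fx, L2 fy &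
      forall e : R, 0 < e -> exists2 d : R, 0 < d &
        forall h : R[i], normc h < d ->
          l2norm (fun l => f (chart_param c (chart_coord c p + h)) l - f p l
                           - (complex.Re h)%:C%C *: fx l
                           - (complex.Im h)%:C%C *: fy l) <= e * normc h].

Definition dbar_closed (R : realType) (M : riemannSurface R) (n : nat)
    (V : M -> set (vfun R n)) :=
  forall (N : set M) (f : M -> vfun R n), open N ->
    (forall p, N p -> V p (f p)) ->
    (forall p c, N p -> atlas c -> chart_dom c p ->
       exists fx fy, has_partials c f p fx fy) ->
    forall p c fx fy, N p -> atlas c -> chart_dom c p -> has_partials c f p fx fy ->
      V p (fun l => 2^-1 *: (fx l + Complex 0 1 *: fy l)).

(** * Holomorphic subbundles of M x L^2(S^1, C^n) *)

Definition l2_operator (R : realType) (n : nat) (T : vfun R n -> vfun R n) :=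
  [/\ forall f, L2 f -> L2 (T f),
      forall (a : R[i]) f g, L2 f -> L2 g ->
        aeq (T (fun l => a *: f l + g l)) (fun l => a *: T f l + T g l) &
      exists K : R, forall f, L2 f -> l2norm (T f) <= K * l2norm f].

Definition l2_invertible (R : realType) (n : nat) (T : vfun R n -> vfun R n) :=
  l2_operator T /\
  exists2 T' : vfun R n -> vfun R n, l2_operator T' &
    forall f, L2 f -> aeq (T (T' f)) f /\ aeq (T' (T f)) f.

Definition operator_holomorphic_on (R : realType) (M : riemannSurface R)
    (n : nat) (N : set M) (T : M -> vfun R n -> vfun R n) :=
  forall c : chart R M, atlas c -> forall p, N p -> chart_dom c p ->
    exists2 T' : vfun R n -> vfun R n, l2_operator T' &
      forall e : R, 0 < e -> exists2 d : R, 0 < d &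
        forall h : R[i], normc h < d -> forall f, L2 f ->
          l2norm (fun l => T (chart_param c (chart_coord c p + h)) f l - T p f l
                           - h *: T' f l) <= e * normc h * l2norm f.

(* Near each point, some holomorphic automorphism of the trivial bundle (in the
   operator norm) carries a constant closed subspace H0 onto V. *)
Definition holomorphic_subbundle (R : realType) (M : riemannSurface R)
    (n : nat) (V : M -> set (vfun R n)) :=
  forall p0 : M, exists (N : set M) (T : M -> vfun R n -> vfun R n)
      (H0 : set (vfun R n)),
    [/\ open N /\ N p0,
        closed_subspace H0,
        forall p, N p -> l2_invertible (T p),
        operator_holomorphic_on N T &
        forall p, N p -> forall g, V p g <->
          L2 g /\ exists2 f, H0 f & aeq g (T p f)].

(* Main.v *)
From HB Require Import structures.
Require Import Defs.
From mathcomp Require Import all_boot all_order all_algebra.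
From mathcomp Require Import all_classical all_reals all_analysis.
From mathcomp Require Import measurable_realfun lebesgue_measure.
From mathcomp Require Import complex ring lra zify.
Import Order.TTheory GRing.Theory Num.Theory.
Import numFieldNormedType.Exports.

(** The wandering space of [V z] has a local basis [s_1, .., s_n] that is smooth in
    the circle variable and in [z]; let [S] be the matrix with these columns. For
    [k > 0] the function [val l ^ k s_j] lies in the image of the shift, so it is
    orthogonal to all [s_i]: the Fourier coefficients of [S^* S], except the
    constant one, vanish, and [S^* S] does not depend on the point [l] of the
    circle. Hence [psi l z = S l z * (S 1 z)^-1] is unitary. Another basis
    multiplies [S] on the right by a matrix that is constant on the circle, so
    [psi] does not depend on the basis and is globally defined ([unitary_frame]);
    and [V z] is the image of the Hardy space under [psi] ([framepsi_hardy]).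

    For the second part, fix [z0] and write [psi(z0)^* psi(z) = 1 - B(z)], so that
    [B(z0) = 0]. The aim is a smooth [h], analytic on the circle and close to [1],
    such that [(1 - B) h] is [1] plus negative frequencies. Let
    [b_m = l^m a_m(z)] be the terms of the Fourier series of [B]. The sum [h] of
    all products [b_(m_1) .. b_(m_k)] all of whose tails have nonnegative
    frequency [m_i + .. + m_k] has this property, because multiplication by [B]
    puts one more letter in front of each word ([letter_sum_factor]). Near [z0]
    the modes are absolutely summable with a small sum, by integration by parts
    and continuity ([small_modes]), so the sum over words converges. It is smooth
    because the derivative of a word is an entry of the same word in dual
    numbers, and the dual letters still contract for suitable weights
    ([dual_contracting], [wsum_Ck]).

    Put [u = psi h]. As [h] is close to [1], the Neumann series shows that [h] maps
    the Hardy space onto itself ([near1_hardy]), and [V = u H_+]. If [V] is closed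
    under dbar, then the dbar-derivative of a column of [u] is [psi g] with [g] in
    the Hardy space. But the nonnegative Fourier coefficients of [psi(z0)^* u] do
    not depend on [z], so [(1 - B) g] has only negative frequencies and is
    orthogonal to [g]. Thus [<g, g> = <B g, g>] with [B] small, and [g = 0]
    ([near1_kernel], [frame_dbar]): the frame [u] is holomorphic. Its first-order
    expansions are uniform on the circle, so multiplication by [u] is holomorphic
    in the operator norm and carries the Hardy space onto [V], which makes [V] a
    holomorphic subbundle. *)

Set Implicit Arguments.
Unset Strict Implicit.
Unset Printing Implicit Defensive.
Local Open Scope classical_set_scope.
Local Open Scope ring_scope.
Local Notation normc := ComplexField.Normc.normc.

(** * Integration over the circle *)

Section Restriction.
Local Open Scope ereal_scope.
Context d (T : measurableType d) (R : realType).
Variables (mu : {measure set T -> \bar R}) (D : set T) (mD : measurable D).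
Import HBNNSimple.

Let nnsfun_mrestr (h : {nnsfun T >-> R}) :
  \int[mrestr mu mD]_x (h x)%:E = \int[mu]_(x in D) (h x)%:E.
Proof.
have S (m : {measure set T -> \bar R}) (E : set T) : measurable E ->
    \int[m]_(x in E) (h x)%:E =
    \sum_(r \in range h) (r%:E * m (h @^-1` [set r] `&` E)).
  move=> mE; under eq_integral do rewrite fimfunE -fsumEFin//.
  rewrite ge0_integral_fsum//; last 2 first.
  - by move=> n; exact/measurable_EFinP/measurable_funM.
  - by move=> n x _; rewrite EFinM nnfun_muleindic_ge0.
  apply: eq_fsbigr => r rh.
  by rewrite integralZl_indic_nnsfun// integral_indic.
rewrite S// S//; apply: eq_fsbigr => r _.
by rewrite /= /mrestr setIT.
Qed.

(** Both sides agree on simple functions, and monotone convergence extends this to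
    nonnegative functions. *)
Lemma ge0_integral_mrestr (f : T -> \bar R) : measurable_fun [set: T] f ->
  (forall x, 0 <= f x) -> \int[mrestr mu mD]_x f x = \int[mu]_(x in D) f x.
Proof.
move=> mf f0.
pose g := nnsfun_approx measurableT mf.
have L (m : {measure set T -> \bar R}) (E : set T) : measurable E ->
    \int[m]_(x in E) f x = lim (\int[m]_(x in E) (g n x)%:E @[n --> \oo]).
  move=> mE; rewrite -monotone_convergence//.
  - by apply: eq_integral => x _; apply/esym/cvg_lim => //;
      exact: cvg_nnsfun_approx.
  - by move=> n; exact/measurable_EFinP/measurable_funTS.
  - by move=> n x _; rewrite lee_fin.
  - by move=> x _ a b ab; rewrite lee_fin; exact/lefP/nd_nnsfun_approx.
rewrite (L (mrestr mu mD) setT)// (L mu D)//.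
by under eq_fun do rewrite nnsfun_mrestr.
Qed.

Lemma integral_mrestr (f : T -> \bar R) : measurable_fun [set: T] f ->
  \int[mrestr mu mD]_x f x = \int[mu]_(x in D) f x.
Proof.
move=> mf; rewrite (integralE (mrestr mu mD)) (integralE mu).
rewrite !ge0_integral_mrestr//.
- exact: measurable_funeneg.
- exact: measurable_funepos.
Qed.

End Restriction.

Section ComplexParts.
Variable R : realType.
Implicit Types (x y : R[i]) (a : R).
Local Notation Re := complex.Re.
Local Notation Im := complex.Im.

Lemma cReD x y : Re (x + y) = Re x + Re y. Proof. by case: x; case: y. Qed.
Lemma cImD x y : Im (x + y) = Im x + Im y. Proof. by case: x; case: y. Qed.
Lemma cReN x : Re (- x) = - Re x. Proof. by case: x. Qed.
Lemma cImN x : Im (- x) = - Im x. Proof. by case: x. Qed.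
Lemma cReM x y : Re (x * y) = Re x * Re y - Im x * Im y.
Proof. by case: x; case: y. Qed.
Lemma cImM x y : Im (x * y) = Re x * Im y + Im x * Re y.
Proof. by case: x; case: y. Qed.
Lemma cReJ x : Re x^* = Re x. Proof. by case: x. Qed.
Lemma cImJ x : Im x^* = - Im x. Proof. by case: x. Qed.
Lemma cRe0 : Re (0 : R[i]) = 0. Proof. by []. Qed.
Lemma cIm0 : Im (0 : R[i]) = 0. Proof. by []. Qed.
Lemma cRe_sum I (r : seq I) P (F : I -> R[i]) :
  Re (\sum_(i <- r | P i) F i) = \sum_(i <- r | P i) Re (F i).
Proof. by rewrite (big_morph (@complex.Re R) cReD cRe0). Qed.
Lemma cIm_sum I (r : seq I) P (F : I -> R[i]) :
  Im (\sum_(i <- r | P i) F i) = \sum_(i <- r | P i) Im (F i).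
Proof. by rewrite (big_morph (@complex.Im R) cImD cIm0). Qed.
Lemma complexP x y : Re x = Re y -> Im x = Im y -> x = y.
Proof. by case: x; case: y => ? ? ? ? /= -> ->. Qed.

Lemma normcE2 x : normc x ^+ 2 = Re x ^+ 2 + Im x ^+ 2.
Proof. by case: x => a b /=; rewrite sqr_sqrtr// addr_ge0 ?sqr_ge0. Qed.
Lemma normc_ge0 x : 0 <= normc x. Proof. by case: x => a b; exact: sqrtr_ge0. Qed.
Lemma normcE1 x : `|x| = (normc x)%:C%C. Proof. by case: x. Qed.
Lemma normc_le x a : 0 <= a -> Re x ^+ 2 + Im x ^+ 2 <= a ^+ 2 -> normc x <= a.
Proof.
by move=> a0; rewrite -normcE2 ler_sqr// nnegrE normc_ge0.
Qed.
Lemma ler_Re_normc x : `|Re x| <= normc x.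
Proof.
rewrite -ler_sqr ?nnegrE ?normc_ge0// normcE2 real_normK ?num_real//.
by rewrite lerDl sqr_ge0.
Qed.
Lemma ler_Im_normc x : `|Im x| <= normc x.
Proof.
rewrite -ler_sqr ?nnegrE ?normc_ge0// normcE2 real_normK ?num_real//.
by rewrite lerDr sqr_ge0.
Qed.
Lemma normcD x y : normc (x + y) <= normc x + normc y.
Proof. by have := ler_normD x y; rewrite !normcE1 -rmorphD lecR. Qed.
Lemma normc_ler_ReIm x : normc x <= `|Re x| + `|Im x|.
Proof.
apply: normc_le; first by rewrite addr_ge0.
rewrite sqrrD !real_normK ?num_real// -subr_ge0.
suff -> : forall a b c : R, a + b + c - (a + c) = b by rewrite mulrn_wge0// mulr_ge0.
by move=> a b c; ring.
Qed.
Lemma normcM x y : normc (x * y) = normc x * normc y.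
Proof. exact: ComplexField.Normc.normcM. Qed.
Lemma normcN x : normc (- x) = normc x.
Proof. by case: x => a b /=; rewrite !sqrrN. Qed.
Lemma normcR a : normc a%:C%C = `|a|.
Proof. by rewrite /= expr0n/= addr0 sqrtr_sqr. Qed.
Lemma normc0 : normc (0 : R[i]) = 0. Proof. exact: ComplexField.Normc.normc0. Qed.
Lemma normc_eq0 x : normc x = 0 -> x = 0.
Proof. exact: ComplexField.Normc.eq0_normc. Qed.
Lemma normc_small x : (forall e, 0 < e -> normc x <= e) -> x = 0.
Proof.
move=> h; apply: normc_eq0; apply/eqP; rewrite eq_le normc_ge0 andbT.
by apply/ler_addgt0Pr => e e0; rewrite add0r; exact: h.
Qed.
Lemma normc1 : normc (1 : R[i]) = 1. Proof. exact: ComplexField.Normc.normc1. Qed.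
Lemma normc_sum I (r : seq I) P (F : I -> R[i]) :
  normc (\sum_(i <- r | P i) F i) <= \sum_(i <- r | P i) normc (F i).
Proof.
elim/big_rec2 : _ => [|i a b _ h]; first by rewrite normc0.
by rewrite (le_trans (normcD _ _))// lerD2l.
Qed.
Lemma mulJ x : x * x^* = (normc x ^+ 2)%:C%C.
Proof. by apply: complexP; rewrite ?cReM ?cImM cReJ cImJ ?normcE2 /=; ring. Qed.

Lemma circle_normc (l : circle R) : normc (val l) = 1.
Proof.
by case: l => l /= /eqP; rewrite normcE1 => /(congr1 (@complex.Re R)).
Qed.
Lemma circle_neq0 (l : circle R) : val l != 0.
Proof.
by apply/eqP => l0; have := circle_normc l; rewrite l0 normc0 => /eqP; rewrite eq_sym oner_eq0.
Qed.
Lemma circle_mulJ (l : circle R) : val l * (val l)^* = 1.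
Proof. by rewrite mulJ circle_normc expr1n. Qed.
Lemma circle_inv (l : circle R) : (val l)^-1 = (val l)^*.
Proof.
apply: (mulfI (circle_neq0 l)); rewrite circle_mulJ divff//; exact: circle_neq0.
Qed.
End ComplexParts.

Section CircleIntegral.
Variable R : realType.
Local Notation Re := complex.Re.
Local Notation Im := complex.Im.
Local Notation mu := (@arc_measure R).
Implicit Types (f g : R -> R) (h k w : circle R -> R[i]).

Lemma arc_measureT : mu [set: R] = (2 * pi)%:E.
Proof.
rewrite /mu /mrestr setTI lebesgue_measure_itv/= lte_fin mulr_gt0 ?pi_gt0//.
by rewrite -EFinB subr0.
Qed.

Lemma twopi_gt0 : 0 < 2 * pi :> R. Proof. by rewrite mulr_gt0 ?pi_gt0. Qed.

Lemma arc_integral f : measurable_fun [set: R] f ->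
  Rintegral mu setT f = Rintegral (@lebesgue_measure R) `[0, 2 * pi] f.
Proof.
by move=> mf; congr fine; apply: integral_mrestr; exact/measurable_EFinP.
Qed.

Lemma arc_integrable_bounded f (C : R) : measurable_fun [set: R] f ->
  (forall t, `|f t| <= C) -> mu.-integrable setT (EFin \o f).
Proof.
move=> mf fC; apply: measurable_bounded_integrable => //.
  by have := ltry (2 * pi : R); rewrite -arc_measureT.
exists C; split; first by rewrite num_real.
by move=> M CM t _; rewrite /= (le_trans (fC t))// ltW.
Qed.

Local Notation rint f := (mu.-integrable setT (EFin \o f)).

Lemma rintD f g : rint f -> rint g -> rint (fun t => f t + g t).
Proof. by move=> fi gi; exact: (integrableD measurableT fi gi). Qed.

Lemma rintB f g : rint f -> rint g -> rint (fun t => f t - g t).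
Proof. by move=> fi gi; exact: (integrableB measurableT fi gi). Qed.

Lemma rintZ (a : R) f : rint f -> rint (fun t => a * f t).
Proof. by move=> fi; exact: (integrableZl measurableT a fi). Qed.

Lemma Lfun2P f : f \in Lfun mu 2%:E <->
  measurable_fun [set: R] f /\ mu.-integrable setT (EFin \o (fun t => f t ^+ 2)).
Proof.
split=> [h|[mf intf]].
  split; last exact: Lfun2_integrable_sqr.
  by move: h; rewrite inE => /andP[+ _]; rewrite inE.
rewrite inE; apply/andP; split; first by rewrite inE.
rewrite inE/= /finite_norm unlock poweR_lty//.
under eq_integral => t _ do rewrite /= powR_mulrn// -normrX.
by case/integrableP : intf.
Qed.

Lemma Lfun2D f g : f \in Lfun mu 2%:E -> g \in Lfun mu 2%:E ->
  (fun t => f t + g t) \in Lfun mu 2%:E.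
Proof.
move=> /Lfun2P[mf f2] /Lfun2P[mg g2]; apply/Lfun2P; split.
  exact: measurable_funD.
have i2 : rint (fun t => 2 * f t ^+ 2 + 2 * g t ^+ 2).
  by apply: rintD; exact: rintZ.
apply: le_integrable i2 => //.
  by apply/measurable_EFinP/measurable_funX; exact: measurable_funD.
move=> t _; rewrite /= lee_fin !ger0_norm ?sqr_ge0//; last first.
  by rewrite addr_ge0// mulr_ge0// sqr_ge0.
rewrite -subr_ge0 (_ : _ - _ = (f t - g t) ^+ 2) ?sqr_ge0//; ring.
Qed.

Lemma Lfun2_bounded f g (C : R) : measurable_fun [set: R] g ->
  (forall t, `|g t| <= C) -> f \in Lfun mu 2%:E ->
  (fun t => g t * f t) \in Lfun mu 2%:E.
Proof.
move=> mg gC /Lfun2P[mf f2]; apply/Lfun2P; split; first exact: measurable_funM.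
have i2 : rint (fun t => C ^+ 2 * f t ^+ 2) by exact: rintZ.
apply: le_integrable i2 => //.
  by apply/measurable_EFinP/measurable_funX; exact: measurable_funM.
move=> t _; rewrite /= lee_fin !ger0_norm ?sqr_ge0//; last first.
  by rewrite mulr_ge0// sqr_ge0.
rewrite exprMn ler_wpM2r ?sqr_ge0//.
by rewrite -real_normK ?num_real// ler_sqr ?nnegrE// (le_trans _ (gC t)).
Qed.

Definition csquare h :=
  (fun t => Re (h (expi t))) \in Lfun mu 2%:E /\
  (fun t => Im (h (expi t))) \in Lfun mu 2%:E.
Definition cintegrable h :=
  mu.-integrable setT (EFin \o (fun t => Re (h (expi t)))) /\
  mu.-integrable setT (EFin \o (fun t => Im (h (expi t)))).
Definition cmeas h :=
  measurable_fun [set: R] (fun t => Re (h (expi t))) /\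
  measurable_fun [set: R] (fun t => Im (h (expi t))).

Lemma csquare0 : csquare (fun=> 0).
Proof.
by split; apply/Lfun2P; split=> //; apply: (@arc_integrable_bounded _ 0) => // t;
  rewrite ?expr0n ?normr0.
Qed.

Lemma csquareD h k : csquare h -> csquare k -> csquare (fun l => h l + k l).
Proof.
case=> h1 h2 [k1 k2]; split.
- by under eq_fun do rewrite cReD; exact: Lfun2D.
- by under eq_fun do rewrite cImD; exact: Lfun2D.
Qed.

Lemma csquare_bounded w h (C : R) : cmeas w -> (forall l, normc (w l) <= C) ->
  csquare h -> csquare (fun l => w l * h l).
Proof.
case=> w1 w2 wC [h1 h2].
have a t : `|Re (w (expi t))| <= C by rewrite (le_trans (ler_Re_normc _)).
have b t : `|Im (w (expi t))| <= C by rewrite (le_trans (ler_Im_normc _)).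
have b' t : `|- Im (w (expi t))| <= C by rewrite normrN.
split.
- under eq_fun do rewrite cReM -mulNr.
  by apply: Lfun2D; apply: (Lfun2_bounded _ _ (C := C)) => //; exact: measurableT_comp.
- under eq_fun do rewrite cImM.
  by apply: Lfun2D; apply: (Lfun2_bounded _ _ (C := C)).
Qed.

Lemma csquareZ (a : R[i]) h : csquare h -> csquare (fun l => a * h l).
Proof. by apply: csquare_bounded => //; split. Qed.

Lemma csquareN h : csquare h -> csquare (fun l => - h l).
Proof.
by move=> h2; under eq_fun do rewrite -mulN1r; exact: csquareZ.
Qed.

Lemma csquareJ h : csquare h -> csquare (fun l => (h l)^*).
Proof.
case=> h1 h2; split; first by under eq_fun do rewrite cReJ.
under eq_fun do rewrite cImJ -mulN1r.
by apply: (Lfun2_bounded _ _ (C := 1)) => //= _; rewrite normrN1.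
Qed.

Lemma csquare_sum (I : Type) (r : seq I) (P : pred I) (F : I -> circle R -> R[i]) :
  (forall i, P i -> csquare (F i)) -> csquare (fun l => \sum_(i <- r | P i) F i l).
Proof.
move=> FI; elim: r => [|i r IH].
  by under eq_fun do rewrite big_nil; exact: csquare0.
under eq_fun do rewrite big_cons.
have [Pi|Pi] := boolP (P i); rewrite ?Pi ?(negbTE Pi)//.
by apply: csquareD => //; exact: FI.
Qed.

Lemma csquare_cbounded h (C : R) : cmeas h -> (forall l, normc (h l) <= C) -> csquare h.
Proof.
move=> mh hC; have one : csquare (fun=> 1).
  split; apply/Lfun2P; split=> //; apply: (@arc_integrable_bounded _ 1) => // t /=;
  by rewrite ?expr1n ?expr0n ?normr1 ?normr0.
by have := csquare_bounded mh hC one; under eq_fun do rewrite mulr1.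
Qed.

Lemma cintegrableM h k : csquare h -> csquare k -> cintegrable (fun l => h l * k l).
Proof.
case=> h1 h2 [k1 k2].
have M f g : f \in Lfun mu 2%:E -> g \in Lfun mu 2%:E ->
    mu.-integrable setT (EFin \o (fun t => f t * g t)).
  by move=> f2 g2; apply/Lfun1_integrable; exact: Lfun2_mul_Lfun1.
split.
- under [X in EFin \o X]eq_fun do rewrite cReM.
  by apply: rintB; exact: M.
- under [X in EFin \o X]eq_fun do rewrite cImM.
  by apply: rintD; exact: M.
Qed.

Lemma cintegrable_square h : csquare h -> cintegrable h.
Proof.
have one : csquare (fun=> 1).
  by apply: (@csquare_cbounded _ 1) => [|l]; [split|rewrite normc1].
move=> h2; have := cintegrableM h2 one.
by under eq_fun do rewrite mulr1.
Qed.

Lemma cmeanD h k : cintegrable h -> cintegrable k ->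
  circle_mean (fun l => h l + k l) = circle_mean h + circle_mean k.
Proof.
case=> h1 h2 [k1 k2]; apply: complexP; rewrite ?cReD ?cImD /=.
- under eq_Rintegral do rewrite cReD.
  by rewrite RintegralD// mulrDr.
- under eq_Rintegral do rewrite cImD.
  by rewrite RintegralD// mulrDr.
Qed.

Lemma cintegrableD h k : cintegrable h -> cintegrable k ->
  cintegrable (fun l => h l + k l).
Proof.
case=> h1 h2 [k1 k2]; split.
- by under [X in EFin \o X]eq_fun do rewrite cReD; exact: rintD.
- by under [X in EFin \o X]eq_fun do rewrite cImD; exact: rintD.
Qed.

Lemma cintegrableZ a h : cintegrable h -> cintegrable (fun l => a * h l).
Proof.
case=> h1 h2; split.
- under [X in EFin \o X]eq_fun do rewrite cReM.
  by apply: rintB; exact: rintZ.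
- under [X in EFin \o X]eq_fun do rewrite cImM.
  by apply: rintD; exact: rintZ.
Qed.

Lemma cmeanZ a h : cintegrable h ->
  circle_mean (fun l => a * h l) = a * circle_mean h.
Proof.
case=> h1 h2.
apply: complexP; rewrite ?cReM ?cImM /=.
- under eq_Rintegral do rewrite cReM.
  rewrite RintegralB//; [|exact: rintZ|exact: rintZ].
  by rewrite !RintegralZl//; ring.
- under eq_Rintegral do rewrite cImM.
  rewrite RintegralD//; [|exact: rintZ|exact: rintZ].
  by rewrite !RintegralZl//; ring.
Qed.

Lemma cmeanJ h : cintegrable h ->
  circle_mean (fun l => (h l)^*) = (circle_mean h)^*.
Proof.
case=> h1 h2; apply: complexP; rewrite ?cReJ ?cImJ /=.
- by congr (_ * _); apply: eq_Rintegral => t _; rewrite cReJ.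
- under eq_Rintegral do rewrite cImJ -mulN1r.
  by rewrite RintegralZl//; ring.
Qed.

Lemma cmean_sum (I : Type) (r : seq I) (P : pred I) (F : I -> circle R -> R[i]) :
  (forall i, P i -> cintegrable (F i)) ->
  cintegrable (fun l => \sum_(i <- r | P i) F i l) /\
  circle_mean (fun l => \sum_(i <- r | P i) F i l) =
    \sum_(i <- r | P i) circle_mean (F i).
Proof.
move=> FI; elim: r => [|i r [IH1 IH2]].
  under eq_fun do rewrite big_nil.
  split; first exact/cintegrable_square/csquare0.
  rewrite big_nil; apply: complexP => /=; rewrite (_ : Rintegral _ _ _ = 0) ?mulr0//.
    by rewrite Rintegral_cst// mul0r.
  by rewrite Rintegral_cst// mul0r.
under eq_fun do rewrite big_cons.
rewrite big_cons; have [Pi|Pi] := boolP (P i); rewrite ?Pi ?(negbTE Pi)//.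
have Fi := FI i Pi.
by split; [exact: cintegrableD|rewrite cmeanD// IH2].
Qed.

End CircleIntegral.

(** * The inner product *)

Section AlmostEverywhere.
Variable R : realType.
Local Notation mu := (@arc_measure R).

Lemma arc_aeS (P Q : R -> Prop) : (forall t, P t -> Q t) ->
  {ae mu, forall t, P t} -> {ae mu, forall t, Q t}.
Proof. by move=> PQ; apply: (@filterS _ _ (ae_filter_ringOfSetsType _)). Qed.

Lemma arc_aeS2 (P Q S : R -> Prop) : (forall t, P t -> Q t -> S t) ->
  {ae mu, forall t, P t} -> {ae mu, forall t, Q t} -> {ae mu, forall t, S t}.
Proof. by move=> PQ; apply: (@filterS2 _ _ (ae_filter_ringOfSetsType _)). Qed.

End AlmostEverywhere.

Section Inner.
Variables (R : realType) (n : nat).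
Local Notation Re := complex.Re.
Local Notation Im := complex.Im.
Local Notation mu := (@arc_measure R).
Implicit Types (f g h : vfun R n) (a : R[i]).

Lemma L2_csquare f : L2 f <-> forall i, csquare (fun l => f l i 0).
Proof. by []. Qed.

Lemma L2_0 : L2 (fun=> 0 : 'cV[R[i]]_n).
Proof. by apply/L2_csquare => i; under eq_fun do rewrite mxE; exact: csquare0. Qed.

Lemma L2D f g : L2 f -> L2 g -> L2 (fun l => f l + g l).
Proof.
move=> /L2_csquare f2 /L2_csquare g2; apply/L2_csquare => i.
by under eq_fun do rewrite mxE; exact: csquareD.
Qed.

Lemma L2Z a f : L2 f -> L2 (fun l => a *: f l).
Proof.
move=> /L2_csquare f2; apply/L2_csquare => i.
by under eq_fun do rewrite mxE; exact: csquareZ.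
Qed.

Lemma L2N f : L2 f -> L2 (fun l => - f l).
Proof. by move=> f2; under eq_fun do rewrite -scaleN1r; exact: L2Z. Qed.

Lemma L2B f g : L2 f -> L2 g -> L2 (fun l => f l - g l).
Proof. by move=> f2 g2; apply: L2D => //; exact: L2N. Qed.

Lemma L2_sum (I : Type) (r : seq I) (P : pred I) (F : I -> vfun R n) :
  (forall i, P i -> L2 (F i)) -> L2 (fun l => \sum_(i <- r | P i) F i l).
Proof.
move=> FI; apply/L2_csquare => i; under eq_fun do rewrite summxE.
by apply: csquare_sum => j Pj; have /L2_csquare := FI j Pj.
Qed.

Let cint_inner f g i : L2 f -> L2 g ->
  cintegrable (fun l => f l i 0 * (g l i 0)^*).
Proof.
move=> /L2_csquare f2 /L2_csquare g2.
by apply: cintegrableM => //; exact: csquareJ.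
Qed.

Lemma innerDl f g h : L2 f -> L2 g -> L2 h ->
  inner (fun l => f l + g l) h = inner f h + inner g h.
Proof.
move=> f2 g2 h2; rewrite /inner -big_split; apply: eq_bigr => i _ /=.
rewrite -cmeanD; [|exact: cint_inner|exact: cint_inner].
by congr circle_mean; apply/funext => l; rewrite mxE mulrDl.
Qed.

Lemma innerZl a f h : L2 f -> L2 h -> inner (fun l => a *: f l) h = a * inner f h.
Proof.
move=> f2 h2; rewrite /inner mulr_sumr; apply: eq_bigr => i _ /=.
rewrite -cmeanZ; last exact: cint_inner.
by congr circle_mean; apply/funext => l; rewrite mxE mulrA.
Qed.

Lemma innerC f g : L2 f -> L2 g -> inner g f = (inner f g)^*.
Proof.
move=> f2 g2; rewrite /inner rmorph_sum; apply: eq_bigr => i _ /=.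
rewrite -cmeanJ; last exact: cint_inner.
by congr circle_mean; apply/funext => l; rewrite rmorphM /= conjCK mulrC.
Qed.

Lemma innerDr f g h : L2 f -> L2 g -> L2 h ->
  inner h (fun l => f l + g l) = inner h f + inner h g.
Proof.
move=> f2 g2 h2; rewrite innerC//; last exact: L2D.
by rewrite innerDl// rmorphD /= -!innerC.
Qed.

Lemma innerZr a f h : L2 f -> L2 h ->
  inner h (fun l => a *: f l) = a^* * inner h f.
Proof.
move=> f2 h2; rewrite innerC//; last exact: L2Z.
by rewrite innerZl// rmorphM /= -!innerC.
Qed.

Definition sqn f (t : R) : R := \sum_(i < n) normc (f (expi t) i 0) ^+ 2.

Lemma sqn_ge0 f t : 0 <= sqn f t.
Proof. by apply: sumr_ge0 => i _; exact: sqr_ge0. Qed.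

Lemma sqn_integrable f : L2 f -> mu.-integrable setT (EFin \o sqn f).
Proof.
move=> f2; rewrite /sqn.
have -> : EFin \o (fun t => \sum_(i < n) normc (f (expi t) i 0) ^+ 2) =
   fun t => (\sum_(i < n) (normc (f (expi t) i 0) ^+ 2)%:E)%E.
  by apply/funext => t; rewrite /= sumEFin.
apply: integrable_sum => // i _.
have [f1 f1'] := f2 i.
rewrite (_ : (fun x => _) = EFin \o (fun t => Re (f (expi t) i 0) ^+ 2 +
  Im (f (expi t) i 0) ^+ 2)); last by apply/funext => t; rewrite normcE2.
apply: rintD; first by case/Lfun2P : f1.
by case/Lfun2P : f1'.
Qed.

Lemma innerE f : L2 f -> inner f f = ((2 * pi)^-1 * Rintegral mu setT (sqn f))%:C%C.
Proof.
move=> f2; rewrite /inner.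
have [] := @cmean_sum R _ (index_enum 'I_n) xpredT (fun i l => f l i 0 * (f l i 0)^*).
  by move=> i _; exact: cint_inner.
move=> _ <-; apply: complexP => /=.
  congr (_ * _); apply: eq_Rintegral => t _; rewrite cRe_sum.
  by apply: eq_bigr => i _; rewrite mulJ.
rewrite (_ : Rintegral _ _ _ = 0) ?mulr0//.
under eq_Rintegral.
  move=> t _; rewrite cIm_sum; under eq_bigr do rewrite mulJ /=.
  rewrite big1//; over.
by rewrite Rintegral_cst// mul0r.
Qed.

Lemma inner_ge0 f : L2 f -> 0 <= Re (inner f f).
Proof.
move=> f2; rewrite innerE//= mulr_ge0 ?invr_ge0 ?(ltW (twopi_gt0 _))//.
by apply: Rintegral_ge0 => t _; exact: sqn_ge0.
Qed.

Lemma l2norm_ge0 f : 0 <= l2norm f. Proof. exact: sqrtr_ge0. Qed.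

Lemma l2norm_sq f : L2 f -> l2norm f ^+ 2 = Re (inner f f).
Proof. by move=> f2; rewrite sqr_sqrtr// inner_ge0. Qed.

Lemma innerff f : L2 f -> inner f f = (l2norm f ^+ 2)%:C%C.
Proof. by move=> f2; rewrite l2norm_sq// innerE. Qed.

(** Expand the square norm of [f + a g], which is nonnegative, at the minimizing
    multiple [a]. *)
Lemma CauchySchwarz f g : L2 f -> L2 g -> normc (inner f g) <= l2norm f * l2norm g.
Proof.
move=> f2 g2.
have [g0|g0] := eqVneq (l2norm g) 0.
  (* There is no minimizing multiple of g here: the inner product vanishes because
     arbitrarily large multiples of it are allowed. *)
  have key (s : R) : 0 <= l2norm f ^+ 2 - 2 * s * normc (inner f g) ^+ 2.
    pose a := - (s%:C%C * inner f g).
    have ag2 : L2 (fun l => a *: g l) by exact: L2Z.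
    have h2 : L2 (fun l => f l + a *: g l) by exact: L2D.
    have := inner_ge0 h2.
    rewrite innerDl// !innerDr// innerZl// innerZr// innerZl// (innerC f2 g2) ?innerZr//.
    rewrite !innerff// g0 expr0n/= !mulr0 addr0.
    have -> : a^* = - (s%:C%C * (inner f g)^*).
      by rewrite /a rmorphN rmorphM; congr (- (_ * _)); exact: conjc_real.
    rewrite /a (_ : _ + _ = (l2norm f ^+ 2)%:C%C - 2 * s%:C%C * (inner f g * (inner f g)^* )).
      by rewrite mulJ -(rmorph_nat (real_complex R) 2) -!rmorphM -rmorphB.
    by ring.
  rewrite g0 mulr0 leNgt; apply/negP => c0.
  have := key ((l2norm f ^+ 2 + 1) / (2 * normc (inner f g) ^+ 2)).
  have cn0 : normc (inner f g) != 0 by rewrite gt_eqF.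
  have -> : 2 * ((l2norm f ^+ 2 + 1) / (2 * normc (inner f g) ^+ 2)) * normc (inner f g) ^+ 2
     = l2norm f ^+ 2 + 1 by field.
  by lra.
pose a := - (inner f g / (l2norm g ^+ 2)%:C%C).
have ag2 : L2 (fun l => a *: g l) by exact: L2Z.
have h2 : L2 (fun l => f l + a *: g l) by exact: L2D.
have := inner_ge0 h2.
rewrite innerDl// !innerDr// innerZl// innerZr// innerZl// (innerC f2 g2) ?innerZr//.
rewrite !innerff//.
set c := inner f g; set x := l2norm f; set y := l2norm g.
have y0 : (y ^+ 2)%:C%C != 0 :> R[i].
  by rewrite -(rmorph0 (real_complex R)) (inj_eq (@complexI R)) sqrf_eq0.
have -> : (x ^+ 2)%:C%C + a^* * c + (a * c^* + a * (a^* * (y ^+ 2)%:C%C)) =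
   (x ^+ 2)%:C%C - c * c^* / (y ^+ 2)%:C%C.
  have -> : a^* = - (c^* / (y ^+ 2)%:C%C).
    rewrite /a rmorphN rmorphM fmorphV; congr (- (_ / _)).
    exact: conjc_real.
  have -> : a = - (c / (y ^+ 2)%:C%C) by [].
  by move: ((x ^+ 2)%:C%C) ((y ^+ 2)%:C%C) y0 (c^*) => X Y Y0 cb; field.
rewrite mulJ -fmorphV -rmorphM -rmorphB /= subr_ge0 ler_pdivrMr ?exprn_gt0//; last first.
  by rewrite lt_def g0 l2norm_ge0.
by rewrite -exprMn ler_sqr// nnegrE ?normc_ge0// mulr_ge0 ?l2norm_ge0.
Qed.

Lemma aeq_refl f : aeq f f.
Proof. by apply: aeW. Qed.

(** The square of the norm is the integral of a nonnegative function, which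
    vanishes only if the function does almost everywhere. *)
Lemma l2norm_aeq f g : L2 f -> L2 g -> (l2norm (fun l => f l - g l) = 0 <-> aeq f g).
Proof.
move=> f2 g2; have h2 := L2B f2 g2.
have sq0 t : sqn (fun l => f l - g l) t = 0 <-> f (expi t) = g (expi t).
  split=> [/eqP|e]; last first.
    by rewrite /sqn big1// => i _; rewrite e subrr mxE normc0 expr0n.
  rewrite psumr_eq0; last by move=> i _; exact: sqr_ge0.
  move=> /allP e; apply/matrixP => i j; rewrite ord1.
  have := e i (mem_index_enum i); rewrite sqrf_eq0 => /eqP /normc_eq0.
  by rewrite !mxE => /eqP; rewrite subr_eq0 => /eqP.
have int := sqn_integrable h2.
have mS : measurable_fun setT (EFin \o sqn (fun l => f l - g l)) by case/integrableP : int.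
have -> : l2norm (fun l => f l - g l) = 0 <->
    (\int[mu]_t (sqn (fun l => f l - g l) t)%:E = 0)%E.
  have E : (l2norm (fun l => f l - g l) == 0) =
      (\int[mu]_t (sqn (fun l => f l - g l) t)%:E == 0)%E.
    rewrite -sqrf_eq0 l2norm_sq// innerE//= mulf_eq0 invr_eq0 gt_eqF ?twopi_gt0//=.
    by rewrite -[in RHS](fineK (integrable_fin_num _ int))//= eqe.
  by split=> /eqP; [rewrite E|rewrite -E] => /eqP.
have -> : (\int[mu]_t (sqn (fun l => f l - g l) t)%:E = \int[mu]_t `|(sqn (fun l => f l - g l) t)%:E|)%E.
  by apply: eq_integral => t _; rewrite gee0_abs// lee_fin sqn_ge0.
rewrite ae_eq_integral_abs//; split; apply: arc_aeS => t /=.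
- by move=> /(_ I) [] /sq0.
- by move=> /sq0 -> _.
Qed.

End Inner.

(** * Continuous functions on the circle *)

Section Circle.
Variable R : realType.
Local Notation Re := complex.Re.
Local Notation Im := complex.Im.
Local Notation mu := (@arc_measure R).
Implicit Types (h k : circle R -> R[i]) (l : circle R).

Lemma circle_inj l l' : val l = val l' -> l = l'.
Proof. exact: val_inj. Qed.

Lemma expiD2pi (t : R) : expi (t + 2 * pi) = expi t.
Proof.
apply: circle_inj; rewrite /= mulr_natl.
by rewrite (@cosD2pi R) (@sinD2pi R).
Qed.

Lemma expi_surj l : exists2 t : R, 0 <= t <= 2 * pi & l = expi t.
Proof.
have := circle_normc l; case: l => -[a b] hl /= n1.
have ab : a ^+ 2 + b ^+ 2 = 1.
  by have := normcE2 (Complex a b); rewrite /= n1 expr1n.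
have a1 : -1 <= a <= 1.
  by rewrite -ler_norml -(@ler_pXn2r _ 2) ?nnegrE// expr1n real_normK ?num_real// -ab lerDl sqr_ge0.
have [b0|b0] := leP 0 b.
  exists (acos a).
    rewrite acos_ge0//= (le_trans (acos_lepi a1))// ler_peMl ?pi_ge0//.
    by rewrite ler1n.
  apply: circle_inj => /=; rewrite acosK ?in_itv//= sin_acos//.
  by rewrite -ab addrC addKr sqrtr_sqr ger0_norm.
exists (- acos a + 2 * pi).
  have := acos_lepi a1; have := acos_ge0 a1; have := pi_gt0 R; lra.
rewrite expiD2pi; apply: circle_inj => /=.
rewrite cosN sinN acosK ?in_itv//= sin_acos//.
by rewrite -ab addrC addKr sqrtr_sqr ltr0_norm// opprK.
Qed.

Lemma expiDE (s t : R) : val (expi (s + t)) = val (expi s) * val (expi t).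
Proof. by apply: complexP; rewrite /= ?cosD ?sinD; ring. Qed.

Lemma expi0 : expi (0 : R) = circle1 R.
Proof. by apply: circle_inj => /=; rewrite cos0 sin0. Qed.

(** Continuity on the circle, read in the angle. *)
Definition ccont h :=
  continuous (fun t => Re (h (expi t))) /\ continuous (fun t => Im (h (expi t))).

Lemma ccontD h k : ccont h -> ccont k -> ccont (fun l => h l + k l).
Proof.
case=> h1 h2 [k1 k2]; split=> t.
- by under eq_fun do rewrite cReD; apply: cvgD; [exact: h1|exact: k1].
- by under eq_fun do rewrite cImD; apply: cvgD; [exact: h2|exact: k2].
Qed.

Lemma ccontM h k : ccont h -> ccont k -> ccont (fun l => h l * k l).
Proof.
case=> h1 h2 [k1 k2]; split=> t.
- under eq_fun do rewrite cReM.
  by apply: cvgB; apply: cvgM; [exact: h1|exact: k1|exact: h2|exact: k2].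
- under eq_fun do rewrite cImM.
  by apply: cvgD; apply: cvgM; [exact: h1|exact: k2|exact: h2|exact: k1].
Qed.

Lemma ccont_cst (a : R[i]) : ccont (fun=> a).
Proof. by split=> t; exact: cvg_cst. Qed.

Lemma ccontN h : ccont h -> ccont (fun l => - h l).
Proof.
by move=> hc; under eq_fun do rewrite -mulN1r; apply: ccontM => //; exact: ccont_cst.
Qed.

Lemma ccontJ h : ccont h -> ccont (fun l => (h l)^*).
Proof.
case=> h1 h2; split=> t.
- by under eq_fun do rewrite cReJ; exact: h1.
- by under eq_fun do rewrite cImJ; apply: cvgN; exact: h2.
Qed.

Lemma ccont_sum (I : Type) (r : seq I) (P : pred I) (F : I -> circle R -> R[i]) :
  (forall i, P i -> ccont (F i)) -> ccont (fun l => \sum_(i <- r | P i) F i l).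
Proof.
move=> FI; elim: r => [|i r IH].
  by under eq_fun do rewrite big_nil; exact: ccont_cst.
under eq_fun do rewrite big_cons.
have [Pi|Pi] := boolP (P i); rewrite ?Pi ?(negbTE Pi)//.
by apply: ccontD => //; exact: FI.
Qed.

Lemma ccont_val : ccont (fun l => val l).
Proof. by split; [exact: continuous_cos|exact: continuous_sin]. Qed.

Lemma ccontX h m : ccont h -> ccont (fun l => h l ^+ m).
Proof.
move=> hc; elim: m => [|m IH].
  by under eq_fun do rewrite expr0; exact: ccont_cst.
by under eq_fun do rewrite exprS; exact: ccontM.
Qed.

Lemma circle_expzJ l (m : int) : val l ^ (- m) = (val l ^ m)^*.
Proof.
case: m => m; first by rewrite -exprnN -exprVn circle_inv -rmorphXn.
by rewrite NegzE opprK -exprnN -exprVn circle_inv -rmorphXn /= conjCK.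
Qed.

Lemma ccont_expz (m : int) : ccont (fun l => val l ^ m).
Proof.
case: m => m; first by apply: ccontX; exact: ccont_val.
under eq_fun do rewrite NegzE circle_expzJ.
by apply: ccontJ; apply: ccontX; exact: ccont_val.
Qed.

Lemma ccont_meas h : ccont h -> cmeas h.
Proof. by case=> h1 h2; split; exact: continuous_measurable_fun. Qed.

Lemma ccont_bounded h : ccont h -> exists2 C, 0 < C & forall l, normc (h l) <= C.
Proof.
case=> h1 h2.
have B (f : R -> R) : continuous f -> exists C, forall t, 0 <= t <= 2 * pi -> `|f t| <= C.
  move=> cf; have ab : 0 <= 2 * pi :> R by rewrite ltW// twopi_gt0.
  have cn : {within `[0, 2 * pi], continuous (fun t => `|f t|)}.
    by apply: continuous_subspaceT => t; apply: cvg_norm; exact: cf.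
  have [c _ hc] := EVT_max ab cn.
  by exists `|f c| => t t01; apply: hc; rewrite in_itv.
have [C1 hC1] := B _ h1; have [C2 hC2] := B _ h2.
exists (`|C1| + `|C2| + 1); first by rewrite ltr_wpDl// addr_ge0.
move=> l; have [t t01 ->] := expi_surj l.
apply: (le_trans (normc_ler_ReIm _)); rewrite -addrA lerD//.
  by apply: (le_trans (hC1 _ t01)); exact: ler_norm.
rewrite ler_wpDr//; apply: (le_trans (hC2 _ t01)); exact: ler_norm.
Qed.

Lemma ccont_csquare h : ccont h -> csquare h.
Proof.
move=> hc; have [C _ hC] := ccont_bounded hc.
by apply: csquare_cbounded hC; exact: ccont_meas.
Qed.

Lemma csquareM_ccont h k : ccont h -> csquare k -> csquare (fun l => h l * k l).
Proof.
move=> hc; have [C _ hC] := ccont_bounded hc.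
by apply: csquare_bounded hC; exact: ccont_meas.
Qed.

(** A null set has empty interior. *)
Lemma continuous_ae0 (f : R -> R) : continuous f ->
  {ae mu, forall t, f t = 0} -> forall t, 0 <= t <= 2 * pi -> f t = 0.
Proof.
move=> cf [N [mN N0 fN]] t t01; apply/eqP/negPn/negP => ft0.
have : \forall s \near t, f s != 0.
  exact: (cvgr_neq0 _ (cf t)).
move=> /nbhs_ballP[e /= e0 he].
pose a := Order.max 0 (t - e); pose b := Order.min (2 * pi) (t + e).
have ab : a < b.
  rewrite /a /b gt_max !lt_min; have := twopi_gt0 R; move: t01 e0 => /andP[].
  by move=> h1 h2 h3 h4; apply/andP; split; apply/andP; split; lra.
have sub : `]a, b[ `<=` N `&` `[0, 2 * pi].
  move=> s /=; rewrite in_itv/= => /andP[].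
  rewrite /a /b gt_max lt_min => /andP[s0 s1] /andP[s2 s3]; split; last first.
    by rewrite in_itv/= !ltW.
  apply: fN => /= fs; have /eqP : f s != 0; last by [].
  by apply: he; rewrite /ball/= ltr_norml; apply/andP; split; lra.
have : (lebesgue_measure `]a, b[%classic <= 0 :> \bar R)%E.
  rewrite -N0; apply: le_measure => //.
  - by rewrite inE.
  - by rewrite inE; apply: measurableI.
rewrite lebesgue_measure_itv/= lte_fin ab -EFinB lee_fin subr_le0.
by rewrite leNgt ab.
Qed.

Lemma ccont_ae_eq h k : ccont h -> ccont k ->
  {ae mu, forall t, h (expi t) = k (expi t)} -> h =1 k.
Proof.
move=> hc kc hk l; have [t t01 ->] := expi_surj l.
have [d1 d2] : ccont (fun l => h l - k l) by apply: ccontD => //; exact: ccontN.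
apply/eqP; rewrite -subr_eq0; apply/eqP; apply: complexP.
- apply: (continuous_ae0 d1) => //; apply: arc_aeS hk => s ->.
  by rewrite subrr.
- apply: (continuous_ae0 d2) => //; apply: arc_aeS hk => s ->.
  by rewrite subrr.
Qed.

Lemma expi_expz (m : int) (t : R) : val (expi t) ^ m = val (expi (m%:~R * t)).
Proof.
have P (k : nat) : val (expi t) ^+ k = val (expi (k%:R * t)).
  elim: k => [|k IH]; first by rewrite mul0r expi0 expr0.
  by rewrite exprSr IH -expiDE -natr1 mulrDl mul1r.
case: m => m; first exact: P.
have -> : val (expi t) ^ Negz m = (val (expi t) ^+ m.+1)^* by rewrite NegzE circle_expzJ.
rewrite P NegzE.
by apply: complexP; rewrite ?cReJ ?cImJ /= rmorphN /= mulNr ?cosN ?sinN.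
Qed.

Lemma arc_FTC (F f : R -> R) : (forall t : R, is_derive t (1 : R) F (f t)) -> continuous f ->
  Rintegral mu setT f = F (2 * pi) - F 0.
Proof.
move=> dF cf; rewrite arc_integral; last exact: continuous_measurable_fun.
have cF : continuous F.
  by move=> t; apply: differentiable_continuous; apply/derivable1_diffP; have [] := dF t.
rewrite /Rintegral (@continuous_FTC2 R f F) //.
- exact: twopi_gt0.
- exact: continuous_subspaceT.
- split=> [t _||]; first by have [] := dF t.
  + exact/cvg_at_right_filter/cF.
  + exact/cvg_at_left_filter/cF.
- by move=> t _; rewrite derive1E; have [_ ->] := dF t.
Qed.

Lemma cmean_cst (a : R[i]) : circle_mean (fun=> a) = a.
Proof.
have E (x : R) : (2 * pi)^-1 * Rintegral mu setT (fun=> x) = x.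
  have -> : Rintegral mu setT (fun=> x) = x * (2 * pi).
    by rewrite Rintegral_cst//; congr (_ * _); exact: (congr1 fine (@arc_measureT R)).
  by rewrite mulrC mulfK// gt_eqF// twopi_gt0.
by apply: complexP; rewrite /= E.
Qed.

Lemma cmean_expz (m : int) : circle_mean (fun l : circle R => val l ^ m) = (m == 0)%:R.
Proof.
have [->|m0] := eqVneq m 0; first by under eq_fun do rewrite expr0z; exact: cmean_cst.
have mR0 : (m%:~R : R) != 0 by rewrite intr_eq0.
have s2 : sin (m%:~R * (2 * pi) : R) = 0 /\ cos (m%:~R * (2 * pi) : R) = 1.
  have := expi_expz m (2 * pi); rewrite -[2 * pi]add0r expiD2pi expi0 /= exp1rz add0r.
  by case.
have dm (t : R) : is_derive t (1 : R) (fun t : R => m%:~R * t) (m%:~R : R).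
  by apply: is_derive_eq; rewrite /GRing.scale/= mulr1.
have ds (t : R) : is_derive t (1 : R) (fun t : R => m%:~R^-1 * sin (m%:~R * t)) (cos (m%:~R * t)).
  have := is_derive1_comp (is_derive_sin (m%:~R * t)) (dm t).
  by move=> /(is_deriveZ (m%:~R^-1)) h; apply: (is_derive_eq h); rewrite /GRing.scale/= mulrCA mulVf ?mulr1.
have dc (t : R) : is_derive t (1 : R) (fun t : R => - m%:~R^-1 * cos (m%:~R * t)) (sin (m%:~R * t)).
  have := is_derive1_comp (is_derive_cos (m%:~R * t)) (dm t).
  move=> /(is_deriveZ (- m%:~R^-1)) h; apply: (is_derive_eq h); rewrite /GRing.scale/=.
  by field.
have cm : continuous (fun t : R => m%:~R * t) by move=> t; exact: mulrl_continuous.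
have cc : continuous (fun t : R => cos (m%:~R * t)).
  by move=> t; apply: (continuous_comp (cm t)); exact: continuous_cos.
have cs : continuous (fun t : R => sin (m%:~R * t)).
  by move=> t; apply: (continuous_comp (cm t)); exact: continuous_sin.
rewrite (_ : circle_mean _ = Complex
    ((2 * pi)^-1 * Rintegral mu setT (fun t => cos (m%:~R * t)))
    ((2 * pi)^-1 * Rintegral mu setT (fun t => sin (m%:~R * t)))); last first.
  by rewrite /circle_mean; congr (Complex (_ * _) (_ * _)); apply: eq_Rintegral => t _;
    rewrite expi_expz.
rewrite (arc_FTC ds cc) (arc_FTC dc cs) s2.1 s2.2 !mulr0 sin0 cos0.
by rewrite !mulr0 !subrr !mulr0.
Qed.

End Circle.

(** * Density of trigonometric polynomials *)

Section TrigPoly.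
Variable R : realType.
Local Notation mu := (@arc_measure R).

(** Trigonometric polynomials, as lists of pairs (frequency, coefficient). The lists
    may have repetitions, so that sums are concatenations. *)
Definition tp (c : seq (int * R[i])) (l : circle R) : R[i] :=
  \sum_(x <- c) x.2 * val l ^ x.1.

Lemma ccont_tp c : ccont (tp c).
Proof.
by apply: ccont_sum => x _; apply: ccontM; [exact: ccont_cst|exact: ccont_expz].
Qed.

Definition tpZ a (c : seq (int * R[i])) : seq (int * R[i]) :=
  [seq (x.1, a * x.2) | x <- c].

Lemma tpZE a c l : tp (tpZ a c) l = a * tp c l.
Proof. by rewrite /tp big_map mulr_sumr; apply: eq_bigr => x _; rewrite mulrA. Qed.

Lemma tpDE c d l : tp (c ++ d) l = tp c l + tp d l.
Proof. by rewrite /tp big_cat. Qed.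

Definition tpM (c d : seq (int * R[i])) : seq (int * R[i]) :=
  [seq (x.1 + y.1, x.2 * y.2) | x <- c, y <- d].

Lemma tpME c d l : tp (tpM c d) l = tp c l * tp d l.
Proof.
rewrite /tp big_allpairs_dep mulr_suml; apply: eq_bigr => x _.
rewrite mulr_sumr; apply: eq_bigr => y _ /=.
by rewrite expfzDr ?circle_neq0// mulrACA.
Qed.

Definition rtrig (f : R -> R) := exists c, forall t, tp c (expi t) = (f t)%:C%C.

Lemma rtrig_cst a : rtrig (fun=> a).
Proof.
by exists [:: (0, a%:C%C)] => t; rewrite /tp big_seq1 expr0z mulr1.
Qed.

Lemma rtrigD f g : rtrig f -> rtrig g -> rtrig (fun t => f t + g t).
Proof.
by case=> c hc [d hd]; exists (c ++ d) => t; rewrite tpDE hc hd rmorphD.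
Qed.

Lemma rtrigM f g : rtrig f -> rtrig g -> rtrig (fun t => f t * g t).
Proof.
by case=> c hc [d hd]; exists (tpM c d) => t; rewrite tpME hc hd rmorphM.
Qed.

Lemma rtrigX f n : rtrig f -> rtrig (fun t => f t ^+ n).
Proof.
move=> rf; elim: n => [|n IH].
  by under eq_fun do rewrite expr0; exact: rtrig_cst.
by under eq_fun do rewrite exprS; exact: rtrigM.
Qed.

Lemma rtrig_cos : rtrig (@cos R).
Proof.
exists [:: (1, 2^-1); (-1, 2^-1)] => t.
have := circle_inv (expi t); rewrite /tp big_cons big_seq1 /= expr1z exprN1 => ->.
rewrite -mulrDr; have -> : forall z : R[i], z + z^* = 2%:R * (complex.Re z)%:C%C by exact: addcJ.
by rewrite mulKf// pnatr_eq0.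
Qed.

Lemma rtrig_sin : rtrig (@sin R).
Proof.
pose i : R[i] := Complex 0 1; exists [:: (1, - i / 2); (-1, i / 2)] => t.
have := circle_inv (expi t); rewrite /tp big_cons big_seq1 /= expr1z exprN1 => ->.
have J (z : R[i]) : z - z^* = 2%:R * (complex.Im z)%:C%C * i by exact: subcJ.
have -> (z : R[i]) : - i / 2 * z + i / 2 * z^* = - i / 2 * (z - z^* ) by ring.
have i2 : i * i = -1 by have := sqr_i R; rewrite expr2.
rewrite J /=; move: ((sin t)%:C%C) => s.
have -> : - i / 2 * (2%:R * s * i) = - (i * i) * s by field.
by rewrite i2 opprK mul1r.
Qed.

Definition tpdist (F : R -> R) c (t : R) : R := normc ((F t)%:C%C - tp c (expi t)) ^+ 2.

(** Approximability in the mean square by trigonometric polynomials. It is obtained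
    for indicators of rays, extended to Borel sets by Dynkin induction, and to
    all square-integrable functions by simple functions. *)
Definition trig_approx (F : R -> R) := F \in Lfun mu 2%:E /\
  forall e, 0 < e -> exists c, Rintegral mu setT (tpdist F c) < e.

Lemma tpdist_integrable F c : F \in Lfun mu 2%:E ->
  mu.-integrable setT (EFin \o tpdist F c).
Proof.
move=> F2; have [r2 i2] := ccont_csquare (ccont_tp c).
have neg g : g \in Lfun mu 2%:E -> (fun t => - g t) \in Lfun mu 2%:E.
  move=> g2; under eq_fun do rewrite -mulN1r.
  by apply: (Lfun2_bounded _ _ (C := 1)) => // _; rewrite normrN1.
have -> : EFin \o tpdist F c = EFin \o (fun t => (F t + - complex.Re (tp c (expi t))) ^+ 2 +
    (- complex.Im (tp c (expi t))) ^+ 2).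
  by apply/funext => t; rewrite /= /tpdist normcE2 cReD cImD cReN cImN /= add0r.
have /Lfun2P[_ a] := Lfun2D F2 (neg _ r2).
by have /Lfun2P[_ b] := neg _ i2; exact: rintD.
Qed.

Lemma trig_approxL a F G : trig_approx F -> trig_approx G ->
  trig_approx (fun t => a * F t + G t).
Proof.
move=> [F2 hF] [G2 hG].
have FG2 : (fun t => a * F t + G t) \in Lfun mu 2%:E.
  by apply: Lfun2D => //; apply: (Lfun2_bounded _ _ (C := `|a|)).
split=> // e e0.
have e1 : 0 < e / (4 * (a ^+ 2 + 1)).
  by rewrite divr_gt0// mulr_gt0// ltr_wpDl// sqr_ge0.
have [c hc] := hF _ e1; have [d hd] := hG _ (divr_gt0 e0 (ltr0n _ 4)).
exists (tpZ a%:C%C c ++ d).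
have ic := tpdist_integrable c F2; have id := tpdist_integrable d G2.
apply: (@le_lt_trans _ _ (Rintegral mu setT (fun t => 2 * a ^+ 2 * tpdist F c t + 2 * tpdist G d t))).
  apply: le_Rintegral => //; first exact: tpdist_integrable.
    by apply: rintD; exact: rintZ.
  move=> t _; rewrite /tpdist tpDE tpZE.
  set u := (F t)%:C%C - _; set v := (G t)%:C%C - _.
  have -> : ((a * F t + G t)%:C)%C - (a%:C%C * tp c (expi t) + tp d (expi t)) = a%:C%C * u + v.
    by rewrite /u /v rmorphD rmorphM; ring.
  rewrite !normcE2 cReD cImD cReM cImM /= !mul0r subr0 addr0.
  move: (complex.Re u) (complex.Im u) (complex.Re v) (complex.Im v) => p q r s.
  rewrite -subr_ge0.
  suff -> : 2 * a ^+ 2 * (p ^+ 2 + q ^+ 2) + 2 * (r ^+ 2 + s ^+ 2) -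
     ((a * p + r) ^+ 2 + (a * q + s) ^+ 2) = (a * p - r) ^+ 2 + (a * q - s) ^+ 2.
    by rewrite addr_ge0 ?sqr_ge0.
  by ring.
rewrite RintegralD//; [|exact: rintZ|exact: rintZ].
rewrite !RintegralZl//.
have a1 : 0 < a ^+ 2 + 1 by rewrite ltr_wpDl// sqr_ge0.
have : 2 * a ^+ 2 * Rintegral mu setT (tpdist F c) <= e / 2.
  have : 2 * a ^+ 2 * Rintegral mu setT (tpdist F c) <= 2 * a ^+ 2 * (e / (4 * (a ^+ 2 + 1))).
    by apply: ler_wpM2l; [rewrite mulr_ge0// sqr_ge0|exact: ltW].
  move/le_trans; apply.
  have -> : 2 * a ^+ 2 * (e / (4 * (a ^+ 2 + 1))) = e / 2 * (a ^+ 2 / (a ^+ 2 + 1)).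
    by field; rewrite gt_eqF.
  by apply: ler_piMr; [rewrite divr_ge0// ltW|rewrite ler_pdivrMr// mul1r; lra].
by lra.
Qed.

Lemma trig_approx_rtrig f : rtrig f -> trig_approx f.
Proof.
case=> c hc; split.
  have [+ _] := ccont_csquare (ccont_tp c).
  by under eq_fun do rewrite hc.
move=> e e0; exists c; rewrite (_ : Rintegral _ _ _ = 0)//.
under eq_Rintegral do rewrite /tpdist hc subrr normc0 expr0n.
by rewrite Rintegral_cst// mul0r.
Qed.

(** By dominated convergence some [Fn n] is close to [F] in the mean square, and a
    trigonometric polynomial close to [Fn n] will do. *)
Lemma trig_approx_lim (Fn : nat -> R -> R) (F G : R -> R) : (forall n, trig_approx (Fn n)) ->
  measurable_fun [set: R] F -> G \in Lfun mu 2%:E ->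
  {ae mu, forall t, Fn n t @[n --> \oo] --> F t} ->
  (forall n t, `|Fn n t| <= G t) -> trig_approx F.
Proof.
move=> Fnap mF /[dup] G2 /Lfun2P[mG iG] cvF FnG.
have mFn n : measurable_fun [set: R] (Fn n) by have [/Lfun2P[]] := Fnap n.
have [iF _ _] : [/\ mu.-integrable setT (EFin \o (fun t => F t ^+ 2)),
    [sequence \int[mu]_(x in setT) (`|((Fn n x) ^+ 2)%:E - (F x ^+ 2)%:E|)]_n%E @ \oo --> 0%E &
    [sequence \int[mu]_(x in setT) ((Fn n x ^+ 2)%:E)]_n%E @ \oo --> (\int[mu]_(x in setT) (F x ^+ 2)%:E)%E].
  apply: (@dominated_convergence _ _ _ mu setT _ (fun n => EFin \o (fun t => Fn n t ^+ 2)) _ (EFin \o (fun t => G t ^+ 2))) => //.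
  - by move=> n; apply/measurable_EFinP; apply: measurable_funX; exact: mFn.
  - by apply/measurable_EFinP; exact: measurable_funX.
  - apply: arc_aeS cvF => t h _; apply/fine_cvgP; split; first by near=> n.
    under eq_fun do rewrite /= expr2.
    by rewrite expr2; apply: cvgM.
  - apply: aeW => t n _ /=; rewrite lee_fin ger0_norm ?sqr_ge0//.
    by rewrite -[leLHS]real_normK ?num_real// ler_sqr ?nnegrE ?(le_trans _ (FnG n t)).
have F2 : F \in Lfun mu 2%:E by apply/Lfun2P.
split=> // e e0.
(* (Fn n - F)^2 is dominated by 2 G^2 + 2 F^2. *)
have [_ cv _] : [/\ mu.-integrable setT (cst 0%E),
    [sequence \int[mu]_(x in setT) (`|((Fn n x - F x) ^+ 2)%:E - 0|)]_n%E @ \oo --> 0%E &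
    [sequence \int[mu]_(x in setT) (((Fn n x - F x) ^+ 2)%:E)]_n%E @ \oo --> (\int[mu]_(x in setT) 0)%E].
  apply: (@dominated_convergence _ _ _ mu setT _ (fun n => EFin \o (fun t => (Fn n t - F t) ^+ 2)) _ (EFin \o (fun t => 2 * G t ^+ 2 + 2 * F t ^+ 2))) => //.
  - by move=> n; apply/measurable_EFinP; apply: measurable_funX; apply: measurable_funB => //; exact: mFn.
  - apply: arc_aeS cvF => t h _; apply/fine_cvgP; split; first by near=> n.
    have d0 : (fun n => Fn n t - F t) @ \oo --> (0 : R).
      by rewrite -(subrr (F t)); apply: cvgB => //; exact: cvg_cst.
    have := cvgM d0 d0; rewrite mulr0 => d1.
    by under eq_fun do rewrite /= expr2; exact: d1.
  - by apply: rintD; exact: rintZ.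
  - apply: aeW => t n _ /=; rewrite lee_fin ger0_norm ?sqr_ge0//.
    have : Fn n t ^+ 2 <= G t ^+ 2.
      by rewrite -[leLHS]real_normK ?num_real// ler_sqr ?nnegrE ?(le_trans _ (FnG n t)).
    have := sqr_ge0 (Fn n t + F t); nra.
have e8 : (0 < (e / 4)%:E)%E by rewrite lte_fin divr_gt0.
have [n hn] : exists n, Rintegral mu setT (fun x => (Fn n x - F x) ^+ 2) < e / 4.
  move/fine_cvgP : cv => [fn].
  move/cvgr0Pnorm_lt => /(_ (e / 4) (divr_gt0 e0 (ltr0n _ 4))) => lt.
  near \oo => n; exists n.
  have : `|(fine \o (fun n => \int[mu]_x `|((Fn n x - F x) ^+ 2)%:E - 0|)%E) n| < e / 4.
    by near: n.
  have -> : Rintegral mu setT (fun x => (Fn n x - F x) ^+ 2) =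
      (fine \o (fun n => \int[mu]_x `|((Fn n x - F x) ^+ 2)%:E - 0|)%E) n.
    by congr fine; apply: eq_integral => x _; rewrite sube0 gee0_abs// lee_fin sqr_ge0.
  by apply: le_lt_trans; exact: ler_norm.
have [FL hF] := Fnap n; have [c hc] := hF _ (divr_gt0 e0 (ltr0n _ 4)).
exists c.
have ic := tpdist_integrable c FL.
have id : mu.-integrable setT (EFin \o (fun t => (Fn n t - F t) ^+ 2)).
  have neg : (fun t => - F t) \in Lfun mu 2%:E.
    under eq_fun do rewrite -mulN1r.
    by apply: (Lfun2_bounded _ _ (C := 1)) => // _; rewrite normrN1.
  by have /Lfun2P[] := Lfun2D FL neg.
apply: (@le_lt_trans _ _ (Rintegral mu setT (fun t => 2 * tpdist (Fn n) c t + 2 * (Fn n t - F t) ^+ 2))).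
  apply: le_Rintegral => //; first exact: tpdist_integrable.
    by apply: rintD; exact: rintZ.
  move=> t _; rewrite /tpdist !normcE2 !cReD !cImD !cReN !cImN /= !add0r.
  move: (complex.Re _) (complex.Im _) (Fn n t) (F t) => p q r s.
  rewrite -subr_ge0.
  suff -> : 2 * ((r - p) ^+ 2 + (- q) ^+ 2) + 2 * (r - s) ^+ 2 - ((s - p) ^+ 2 + (- q) ^+ 2) =
     (2 * r - p - s) ^+ 2 + q ^+ 2 by rewrite addr_ge0 ?sqr_ge0.
  by ring.
rewrite RintegralD//; [|exact: rintZ|exact: rintZ].
rewrite !RintegralZl//; move: hc hn.
move: (Rintegral _ _ _) (Rintegral _ _ _) => x y; clear -R; lra.
Unshelve. all: by end_near.
Qed.

Lemma bernoulli (a : R) k : 0 <= a <= 1 -> 1 - k%:R * a <= (1 - a) ^+ k.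
Proof.
move=> /andP[a0 a1]; elim: k => [|k IH]; first by rewrite mul0r subr0 expr0.
rewrite exprSr; apply: (@le_trans _ _ ((1 - k%:R * a) * (1 - a))).
  rewrite -natr1 -subr_ge0.
  suff -> : (1 - k%:R * a) * (1 - a) - (1 - (k%:R + 1) * a) = k%:R * a ^+ 2.
    by rewrite mulr_ge0// sqr_ge0.
  by ring.
by rewrite ler_wpM2r// subr_ge0.
Qed.

Lemma bernoulliD (a : R) k : 0 <= a -> 1 + k%:R * a <= (1 + a) ^+ k.
Proof.
move=> a0; elim: k => [|k IH]; first by rewrite mul0r addr0 expr0.
rewrite exprSr; apply: (@le_trans _ _ ((1 + k%:R * a) * (1 + a))).
  rewrite -natr1 -subr_ge0.
  suff -> : (1 + k%:R * a) * (1 + a) - (1 + (k%:R + 1) * a) = k%:R * a ^+ 2.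
    by rewrite mulr_ge0// sqr_ge0.
  by ring.
by rewrite ler_wpM2r// addr_ge0.
Qed.

(** The polynomials (1 - y^n)^(2^n) take values in [0, 1] on [0, 1] and tend to
    the indicator of [0, 1/2) off the point 1/2: both limits follow from
    Bernoulli's inequality, as 2^n y^n = (2y)^n. *)
Definition step (n : nat) (y : R) : R := (1 - y ^+ n) ^+ (2 ^ n).

Lemma step01 n y : 0 <= y <= 1 -> 0 <= step n y <= 1.
Proof.
move=> /andP[y0 y1]; have yn : y ^+ n <= 1 by rewrite exprn_ile1.
have yn0 : 0 <= y ^+ n by rewrite exprn_ge0.
by rewrite /step exprn_ge0 ?subr_ge0//= exprn_ile1 ?subr_ge0// gerBl.
Qed.

Lemma step_cvg1 y : 0 <= y < 2^-1 -> step n y @[n --> \oo] --> (1 : R).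
Proof.
move=> /andP[y0 y1]; have y01 : 0 <= y <= 1 by rewrite y0/=; lra.
apply: (@squeeze_cvgr _ _ _ _ (fun n => 1 - (2 * y) ^+ n) (fun=> 1)).
- near=> n; have /andP[_ ->] := step01 n y01; rewrite andbT.
  have h : 0 <= y ^+ n <= 1 by rewrite exprn_ge0//= exprn_ile1//; lra.
  by have := bernoulli (2 ^ n) h; rewrite natrX -exprMn.
- rewrite -[X in _ --> X]subr0; apply: cvgB; first exact: cvg_cst.
  by apply: cvg_expr; rewrite ger0_norm; lra.
- exact: cvg_cst.
Unshelve. all: by end_near. Qed.

Lemma step_cvg0 y : 2^-1 < y <= 1 -> step n y @[n --> \oo] --> (0 : R).
Proof.
move=> /andP[y0 y1]; have y01 : 0 <= y <= 1 by rewrite y1 andbT; lra.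
have yp : 0 < 2 * y by lra.
apply: (@squeeze_cvgr _ _ _ _ (fun=> 0) (fun n => (2 * y)^-1 ^+ n)).
- near=> n; have /andP[-> _] := step01 n y01 => /=.
  have h0 : 0 <= y ^+ n by rewrite exprn_ge0//; lra.
  have h1 : y ^+ n <= 1 by rewrite exprn_ile1//; lra.
  have := bernoulliD (2 ^ n) h0; rewrite natrX -exprMn => hb.
  have hp : 0 < (2 * y) ^+ n by rewrite exprn_gt0.
  rewrite exprVn -[_^-1]mul1r ler_pdivlMr//.
  apply: (@le_trans _ _ (step n y * (1 + y ^+ n) ^+ (2 ^ n))).
    apply: ler_wpM2l; first by rewrite exprn_ge0// subr_ge0.
    by apply: le_trans hb; rewrite lerDr.
  rewrite /step -exprMn exprn_ile1//; first by rewrite mulr_ge0 ?subr_ge0// addr_ge0.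
  by have := sqr_ge0 (y ^+ n); lra.
- exact: cvg_cst.
- apply: cvg_expr; rewrite ger0_norm ?invr_ge0 ?(ltW yp)// invf_lt1//; lra.
Unshelve. all: by end_near. Qed.

Lemma ae_neq (x : R) : {ae mu, forall t, t != x}.
Proof.
exists [set x]; split => //.
- apply/eqP; rewrite eq_le measure_ge0 andbT -(lebesgue_measure_set1 x).
  by apply: le_measure; rewrite ?inE//; apply: measurableI.
- by move=> t /= /negP; rewrite negbK => /eqP.
Qed.

Lemma ae_arc : {ae mu, forall t, 0 <= t <= 2 * pi}.
Proof.
exists (~` `[0, 2 * pi]%classic); split => //.
- exact: measurableC.
- by rewrite /arc_measure /mrestr setICl measure0.
Qed.

Lemma trig_approx_ae F G : trig_approx F -> measurable_fun [set: R] G ->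
  {ae mu, forall t, F t = G t} -> (forall t, `|F t| <= 1) -> trig_approx G.
Proof.
move=> Fap mG FG F1; apply: (@trig_approx_lim (fun=> F) G (fun=> 1)) => //.
- by apply/Lfun2P; split=> //; apply: (@arc_integrable_bounded _ _ 1) => // t;
    rewrite expr1n normr1.
- by apply: arc_aeS FG => t ->; exact: cvg_cst.
Qed.

(** The function [y t = 1/2 - sin (t / 2) * sin ((x - t) / 2) / 2] is a trigonometric
    polynomial with values in [0, 1], and on the arc it is below 1/2 exactly for
    [t < x]; so the step polynomials at [y] tend to the indicator. *)
Lemma trig_approx_ray (x : R) : trig_approx (\1_(`]-oo, x[)).
Proof.
have m1 : measurable_fun [set: R] (\1_(`]-oo, x[) : R -> R) by exact: measurable_indic.
have [x0|x0] := ltP x 0.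
  apply: (trig_approx_ae (trig_approx_rtrig (rtrig_cst 0))) => //.
    apply: arc_aeS ae_arc => t /andP[t0 _].
    by rewrite indicE memNset//= in_itv/= => tx; lra.
  by move=> t; rewrite normr0.
have [x1|x1] := ltP (2 * pi) x.
  apply: (trig_approx_ae (trig_approx_rtrig (rtrig_cst 1))) => //.
    apply: arc_aeS ae_arc => t /andP[_ t0].
    by rewrite indicE mem_set//= in_itv/=; lra.
  by move=> t; rewrite normr1.
pose y t : R := 2^-1 - (cos (t - x / 2) - cos (x / 2)) / 4.
have y01 t : 0 <= y t <= 1.
  rewrite /y; have := cos_le1 (t - x / 2); have := cos_geN1 (t - x / 2).
  have := cos_le1 (x / 2); have := cos_geN1 (x / 2); lra.
have yE t : y t = 2^-1 - sin (t / 2) * sin ((x - t) / 2) / 2.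
  rewrite /y (_ : t - x / 2 = t / 2 - (x - t) / 2); last by field.
  rewrite (_ : x / 2 = t / 2 + (x - t) / 2); last by field.
  by rewrite cosB cosD; field.
have ry : rtrig y.
  have -> : y = fun t => (2^-1 + cos (x / 2) / 4) +
     (- (cos (x / 2) / 4) * cos t + - (sin (x / 2) / 4) * sin t).
    by apply/funext => t; rewrite /y cosB; field.
  apply: rtrigD; first exact: rtrig_cst.
  by apply: rtrigD; apply: rtrigM; [exact: rtrig_cst|exact: rtrig_cos|
    exact: rtrig_cst|exact: rtrig_sin].
apply: (@trig_approx_lim (fun n t => step n (y t)) _ (fun=> 1)) => //.
- move=> n; apply: trig_approx_rtrig; apply: rtrigX.
  have -> : (fun t => 1 - y t ^+ n) = (fun t => 1 + -1 * y t ^+ n).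
    by apply/funext => t; rewrite mulN1r.
  apply: rtrigD; first exact: rtrig_cst.
  by apply: rtrigM; [exact: rtrig_cst|exact: rtrigX].
- by apply/Lfun2P; split=> //; apply: (@arc_integrable_bounded _ _ 1) => // t;
    rewrite expr1n normr1.
- have ae1 := arc_aeS2 (fun t a b => conj a b) (ae_neq 0) (ae_neq (2 * pi)).
  have ae2 := arc_aeS2 (fun t a b => conj a b) ae_arc (ae_neq x).
  apply: (arc_aeS2 _ ae1 ae2) => t [t0 t1] [/andP[t2 t3] tx].
  have {t0 t2}t0 : 0 < t by rewrite lt_def t0.
  have {t1 t3}t1 : t < 2 * pi by rewrite lt_neqAle t1.
  have s0 : 0 < sin (t / 2) by apply: sin_gt0_pi; apply/andP; split; lra.
  have [ltx|ltx|/eqP] := ltgtP t x; last by rewrite (negbTE tx).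
    have : 0 < sin ((x - t) / 2).
      by apply: sin_gt0_pi; apply/andP; split; lra.
    move=> s1; rewrite indicE mem_set ?in_itv//=.
    apply: step_cvg1; have /andP[-> _] := y01 t => /=.
    by rewrite yE ltrBlDr ltrDl divr_gt0// mulr_gt0.
  have : 0 < sin ((t - x) / 2).
    by apply: sin_gt0_pi; apply/andP; split; lra.
  move=> s1; rewrite indicE memNset; last by rewrite /= in_itv/= => ?; lra.
  apply: step_cvg0; have /andP[_ ->] := y01 t; rewrite andbT.
  rewrite yE (_ : (x - t) / 2 = - ((t - x) / 2)); last by field.
  by rewrite sinN mulrN mulNr opprK ltrDl divr_gt0// mulr_gt0.
- move=> n t; have /andP[a b] := step01 n (y01 t); by rewrite ger0_norm.
Qed.

(** Rays generate the Borel sets, and approximability is stable under complements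
    and, by dominated convergence, under countable disjoint unions. *)
Lemma trig_approx_indic (A : set R) : measurable A -> trig_approx (\1_A).
Proof.
move=> mA.
pose P := [set A : set R | measurable A -> trig_approx (\1_A)].
suff : P A by exact.
apply: (@dynkin_induction _ _ (RGenInftyO.G (R:=R))).
- exact: RGenInftyO.measurableE.
- move=> _ _ [x ->] [y ->]; exists (Order.min x y).
  by apply/seteqP; split => t /=; rewrite !in_itv/= lt_min => /andP.
- move=> _; rewrite indicT; exact: trig_approx_rtrig (rtrig_cst 1).
- by move=> _ [x ->] _; exact: trig_approx_ray.
- move=> S mS PS _.
  have -> : \1_(~` S) = (fun t => -1 * \1_S t + 1) :> (R -> R).
    by apply/funext => t; rewrite !indicE in_setC; case: (_ \in _); rewrite /=; ring.
  by apply: trig_approxL; [exact: PS|exact: trig_approx_rtrig (rtrig_cst 1)].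
- move=> F mF tF PF mU.
  have ap n : trig_approx (fun t => \sum_(i < n) \1_(F i) t).
    elim: n => [|n IH].
      under eq_fun do rewrite big_ord0; exact: trig_approx_rtrig (rtrig_cst 0).
    under eq_fun do rewrite big_ord_recr/= addrC -[X in X + _]mul1r.
    by apply: trig_approxL => //; exact: PF.
  have E n t : \sum_(i < n) \1_(F i) t = \1_(\big[setU/set0]_(i < n) F i) t :> R.
    elim: n => [|n IH]; first by rewrite !big_ord0 indic0.
    rewrite !big_ord_recr/= IH !indicE in_setU.
    case: (boolP (t \in F n)) => [|_]; last by rewrite orbF addr0.
    case: (boolP (t \in \big[setU/set0]_(i < n) F i)) => [|_]; last by rewrite add0r.
    rewrite !inE => h1 h2; exfalso.
    move: h1; rewrite -bigcup_mkord => -[k /= kn Fk].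
    have := tF k n I I; rewrite /= => /(_ (ex_intro _ t (conj Fk h2))) kn'.
    by rewrite kn' ltnn in kn.
  apply: (@trig_approx_lim (fun n t => \sum_(i < n) \1_(F i) t) _ (fun=> 1)) => //.
  + by apply/Lfun2P; split=> //; apply: (@arc_integrable_bounded _ _ 1) => // t;
      rewrite expr1n normr1.
  + apply: aeW => t; under eq_fun do rewrite E.
    rewrite indicE; have [|tU] := boolP (t \in \bigcup_k F k).
      rewrite inE => -[k _ Fk].
      apply/cvgrPdist_lt => e e0; near=> n; rewrite indicE mem_set ?subrr ?normr0//.
      rewrite -bigcup_mkord; exists k => //=; near: n; exact: nbhs_infty_gt.
    apply/cvgrPdist_lt => e e0; near=> n; rewrite indicE memNset ?subrr ?normr0//.
    rewrite -bigcup_mkord => -[k _ Fk]; move: tU; rewrite notin_setE; apply.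
    by exists k.
  + by move=> n t; rewrite E indicE; case: (_ \in _); rewrite ?normr1 ?normr0.
- exact: (eq_ind _ (fun m : set (set R) => m A) mA _ (RGenInftyO.measurableE R)).
Unshelve. all: by end_near. Qed.

Import HBNNSimple.

(** A nonnegative function is a dominated limit of simple functions, and [F] is the
    difference of the nonnegative functions [(`|F| + F) / 2] and [(`|F| - F) / 2]. *)
Lemma trig_approx_Lfun2 (F : R -> R) : F \in Lfun mu 2%:E -> trig_approx F.
Proof.
have pos (G : R -> R) : G \in Lfun mu 2%:E -> (forall t, 0 <= G t) -> trig_approx G.
  move=> /[dup] G2 /Lfun2P[mG iG] G0.
  have mG' : measurable_fun [set: R] (EFin \o G) by exact/measurable_EFinP.
  pose g := nnsfun_approx measurableT mG'.
  have gcv t : g n t @[n --> \oo] --> G t.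
    have /fine_cvgP[_] : EFin \o g^~ t @ \oo --> (EFin \o G) t.
      by apply: (cvg_nnsfun_approx measurableT mG') => //= x _; rewrite lee_fin.
    by [].
  have gle n t : g n t <= G t.
    have nd : nondecreasing_seq (g^~ t).
      by move=> a b ab; exact/lefP/(nd_nnsfun_approx measurableT mG').
    have c : cvgn (g^~ t) by apply/cvg_ex; exists (G t); exact: gcv.
    have := nondecreasing_cvgn_le nd c n.
    by have /cvg_lim -> := gcv t.
  apply: (@trig_approx_lim (fun n => g n : R -> R) G G) => //.
  - move=> n.
    have -> : (g n : R -> R) = fun t => \sum_(r <- finmap.enum_fset (fset_set (range (g n)))) r * \1_(g n @^-1` [set r]) t.
      by apply/funext => t; rewrite fimfunE fsbig_finite.
    elim: (finmap.enum_fset _) => [|r s IH].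
      under eq_fun do rewrite big_nil; exact: trig_approx_rtrig (rtrig_cst 0).
    under eq_fun do rewrite big_cons.
    by apply: trig_approxL => //; exact: trig_approx_indic.
  - by apply: aeW => t; exact: gcv.
  - by move=> n t; rewrite ger0_norm.
move=> F2; have /Lfun2P[mF iF] := F2.
have ab : (fun t => `|F t|) \in Lfun mu 2%:E.
  apply/Lfun2P; split; first exact: measurableT_comp.
  by under [X in EFin \o X]eq_fun do rewrite real_normK ?num_real//.
have h2 (G : R -> R) : G \in Lfun mu 2%:E -> (fun t => 2^-1 * G t) \in Lfun mu 2%:E.
  by move=> G2; apply: (Lfun2_bounded _ _ (C := `|2^-1|)).
have neg : (fun t => -1 * F t) \in Lfun mu 2%:E.
  by apply: (Lfun2_bounded _ _ (C := 1)) => // _; rewrite normrN1.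
have p1 := pos _ (h2 _ (Lfun2D ab F2)).
have p2 := pos _ (h2 _ (Lfun2D ab neg)).
have -> : F = fun t => -1 * (2^-1 * (`|F t| + -1 * F t)) + 2^-1 * (`|F t| + F t).
  by apply/funext => t; field.
apply: trig_approxL; [apply: p2|apply: p1] => t; rewrite mulr_ge0//.
  by rewrite mulN1r subr_ge0 ler_norm.
by have := ler_norm (- F t); rewrite normrN; lra.
Qed.

Lemma csquare_tp_approx (h : circle R -> R[i]) : csquare h ->
  forall e, 0 < e -> exists c,
    Rintegral mu setT (fun t => normc (h (expi t) - tp c (expi t)) ^+ 2) < e.
Proof.
move=> [/trig_approx_Lfun2[r2 hr] /trig_approx_Lfun2[i2 hi]] e e0.
have e4 := divr_gt0 e0 (ltr0n _ 4).
have [c hc] := hr _ e4; have [d hd] := hi _ e4.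
exists (c ++ tpZ (Complex 0 1) d).
have ic := tpdist_integrable c r2; have id := tpdist_integrable d i2.
apply: (@le_lt_trans _ _ (Rintegral mu setT (fun t =>
    2 * tpdist (fun t => complex.Re (h (expi t))) c t +
    2 * tpdist (fun t => complex.Im (h (expi t))) d t))).
  have hcd : csquare (fun l => h l - tp (c ++ tpZ (Complex 0 1) d) l).
    apply: csquareD; first by split.
    by apply: csquareN; apply: ccont_csquare; exact: ccont_tp.
  apply: le_Rintegral => //.
  - under [X in EFin \o X]eq_fun do rewrite normcE2.
    by apply: rintD; case: hcd => /Lfun2P[_ a] /Lfun2P[_ b].
  - by apply: rintD; exact: rintZ.
  - move=> t _; rewrite /tpdist tpDE tpZE !normcE2 !(cReD, cImD, cReN, cImN, cReM, cImM) /=.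
    move: (complex.Re (tp c _)) (complex.Im (tp c _)) (complex.Re (tp d _)) (complex.Im (tp d _)).
    move: (complex.Re _) (complex.Im _) => x y p q r s; rewrite -subr_ge0.
    suff -> : 2 * ((x - p) ^+ 2 + (0 - q) ^+ 2) + 2 * ((y - r) ^+ 2 + (0 - s) ^+ 2) -
      ((x - (p + (0 * r - 1 * s))) ^+ 2 + (y - (q + (0 * s + 1 * r))) ^+ 2) =
      (x - p - s) ^+ 2 + (q + y - r) ^+ 2 by rewrite addr_ge0 ?sqr_ge0.
    by ring.
rewrite RintegralD//; [|exact: rintZ|exact: rintZ].
rewrite !RintegralZl//; move: hc hd.
move: (Rintegral _ _ _) (Rintegral _ _ _) => x y; clear -R; lra.
Qed.

End TrigPoly.

(** * Fourier coefficients and the Hardy space *)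

Section ScalarFourier.
Variable R : realType.
Local Notation mu := (@arc_measure R).
Implicit Types (h k : circle R -> R[i]) (m j : int).

Definition fc h m : R[i] := circle_mean (fun l => (val l) ^ (- m) * h l).
Definition msq h : R := complex.Re (circle_mean (fun l => h l * (h l)^*)).

Lemma csquareXz h m : csquare h -> csquare (fun l => val l ^ m * h l).
Proof. by apply: csquareM_ccont; exact: ccont_expz. Qed.

Lemma fcD h k m : csquare h -> csquare k -> fc (fun l => h l + k l) m = fc h m + fc k m.
Proof.
move=> h2 k2; rewrite /fc -cmeanD; [|exact/cintegrable_square/csquareXz..].
by congr circle_mean; apply/funext => l; rewrite mulrDr.
Qed.

Lemma fcZ a h m : csquare h -> fc (fun l => a * h l) m = a * fc h m.
Proof.
move=> h2; rewrite /fc -cmeanZ; last exact/cintegrable_square/csquareXz.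
by congr circle_mean; apply/funext => l; rewrite mulrCA.
Qed.

Lemma fc_sum (I : Type) (r : seq I) (P : pred I) (F : I -> circle R -> R[i]) m :
  (forall i, P i -> csquare (F i)) ->
  fc (fun l => \sum_(i <- r | P i) F i l) m = \sum_(i <- r | P i) fc (F i) m.
Proof.
move=> FI; rewrite /fc -(cmean_sum _ _).2.
  by congr circle_mean; apply/funext => l; rewrite mulr_sumr.
by move=> i Pi; exact/cintegrable_square/csquareXz/FI.
Qed.

Lemma fcXz h j m : fc (fun l => val l ^ j * h l) m = fc h (m - j).
Proof.
congr circle_mean; apply/funext => l.
by rewrite mulrA -expfzDr ?circle_neq0// opprB addrC.
Qed.

Lemma fc_cst a m : fc (fun=> a) m = (m == 0)%:R * a.
Proof.
rewrite (_ : (fun=> a) = fun l : circle R => a * 1); last by apply/funext => l; rewrite mulr1.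
rewrite fcZ; last exact/ccont_csquare/ccont_cst.
rewrite mulrC; congr (_ * _); rewrite /fc; under eq_fun do rewrite mulr1.
by rewrite cmean_expz oppr_eq0.
Qed.

Lemma fc0 m : fc (fun=> 0) m = 0. Proof. by rewrite fc_cst mulr0. Qed.

Lemma fc_expz j m : fc (fun l => val l ^ j) m = (m == j)%:R.
Proof.
rewrite (_ : (fun l => val l ^ j) = fun l : circle R => val l ^ j * 1); last first.
  by apply/funext => l; rewrite mulr1.
by rewrite (@fcXz (fun=> 1)) fc_cst mulr1 subr_eq0.
Qed.

Lemma fc_tp c m : fc (tp c) m = \sum_(x <- c) x.2 * (m == x.1)%:R.
Proof.
rewrite /tp fc_sum => [|x _]; last exact/csquareZ/ccont_csquare/ccont_expz.
apply: eq_bigr => x _; rewrite fcZ; last exact/ccont_csquare/ccont_expz.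
by rewrite fc_expz.
Qed.

Lemma mean_mul_tpJ h c : csquare h ->
  circle_mean (fun l => h l * (tp c l)^*) = \sum_(x <- c) (x.2)^* * fc h x.1.
Proof.
move=> h2; under eq_fun do rewrite /tp rmorph_sum mulr_sumr.
rewrite (cmean_sum _ _).2 /=.
  apply: eq_bigr => x _; rewrite -cmeanZ; last exact/cintegrable_square/csquareXz.
  by congr circle_mean; apply/funext => l; rewrite rmorphM /= -circle_expzJ; ring.
move=> x _; under eq_fun do rewrite rmorphM /= -circle_expzJ mulrCA.
by apply/cintegrable_square/csquareZ; under eq_fun do rewrite mulrC; exact: csquareXz.
Qed.

Lemma msqE h : csquare h ->
  msq h = (2 * pi)^-1 * Rintegral mu setT (fun t => normc (h (expi t)) ^+ 2).
Proof.
by move=> _; congr (_ * _); apply: eq_Rintegral => t _; rewrite mulJ.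
Qed.

Lemma msq_ge0 h : csquare h -> 0 <= msq h.
Proof.
move=> h2; rewrite msqE// mulr_ge0 ?invr_ge0 ?(ltW (twopi_gt0 _))//.
by apply: Rintegral_ge0 => t _; exact: sqr_ge0.
Qed.

Lemma msqB h k : csquare h -> csquare k ->
  msq (fun l => h l - k l) = msq h + msq k - 2 * complex.Re (circle_mean (fun l => h l * (k l)^*)).
Proof.
move=> h2 k2; have hJ := csquareJ h2; have kJ := csquareJ k2.
have P (a b : circle R -> R[i]) : csquare a -> csquare b -> cintegrable (fun l => a l * b l).
  exact: cintegrableM.
rewrite /msq.
have -> : circle_mean (fun l => (h l - k l) * (h l - k l)^*) =
  circle_mean (fun l => h l * (h l)^* ) + (-1) * circle_mean (fun l => h l * (k l)^* )
  + ((-1) * (circle_mean (fun l => h l * (k l)^* ))^* + circle_mean (fun l => k l * (k l)^* )).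
  have i1 := P _ _ h2 hJ; have i2 := P _ _ h2 kJ; have i4 := P _ _ k2 kJ.
  have i2' : cintegrable (fun l => (h l * (k l)^* )^* ).
    by under eq_fun do rewrite rmorphM /= conjCK; exact: P.
  have i3 := cintegrableZ (-1) i2; have i3' := cintegrableZ (-1) i2'.
  rewrite -cmeanJ// -cmeanZ// -cmeanZ// -cmeanD// -cmeanD// -cmeanD; last 2 first.
  - exact: cintegrableD.
  - exact: cintegrableD.
  congr circle_mean; apply/funext => l; rewrite rmorphB rmorphM /= conjCK; ring.
rewrite !mulN1r !cReD !cReN cReJ; ring.
Qed.

Lemma msq_approx h e : csquare h -> 0 < e -> exists c, msq (fun l => h l - tp c l) < e.
Proof.
move=> h2 e0; have e1 : 0 < 2 * pi * e by rewrite mulr_gt0// twopi_gt0.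
have [c hc] := csquare_tp_approx h2 e1; exists c.
rewrite msqE; last by apply: csquareD => //; exact/csquareN/ccont_csquare/ccont_tp.
by rewrite -ltr_pdivlMl ?invr_gt0 ?twopi_gt0// invrK.
Qed.

(** Projecting a trigonometric polynomial onto its analytic part does not take
    it further away from a Hardy function, by orthogonality. *)
Lemma msq_analytic_approx h e : csquare h -> (forall m, m < 0 -> fc h m = 0) -> 0 < e ->
  exists2 c, (forall x, x \in c -> 0 <= x.1) & msq (fun l => h l - tp c l) < e.
Proof.
move=> h2 hneg e0; have [c hc] := msq_approx h2 e0.
pose p := [seq x <- c | 0 <= x.1]; pose q := [seq x <- c | ~~ (0 <= x.1)].
exists p; first by move=> x; rewrite mem_filter => /andP[].
have pq l : tp c l = tp p l + tp q l.
  rewrite /tp /p /q !big_filter; exact: bigID.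
have g2 : csquare (fun l => h l - tp p l).
  by apply: csquareD => //; exact/csquareN/ccont_csquare/ccont_tp.
have q2 : csquare (tp q) by exact/ccont_csquare/ccont_tp.
have E : msq (fun l => h l - tp c l) = msq (fun l => h l - tp p l) + msq (tp q).
  have -> : (fun l => h l - tp c l) = (fun l => (h l - tp p l) - tp q l).
    by apply/funext => l; rewrite pq opprD addrA.
  rewrite msqB// mean_mul_tpJ// big_seq big1 ?mulr0 ?subr0// => x.
  rewrite mem_filter -ltNge => /andP[x0 _].
  rewrite fcD//; last exact/csquareN/ccont_csquare/ccont_tp.
  rewrite hneg// add0r; under [X in fc X]eq_fun do rewrite -mulN1r.
  rewrite fcZ ?fc_tp; last exact/ccont_csquare/ccont_tp.
  rewrite big_seq big1 ?mulr0// => y; rewrite mem_filter => /andP[y0 _].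
  by rewrite (_ : x.1 == y.1 = false) ?mulr0//; apply/eqP => xy; move: x0; rewrite xy ltNge y0.
by apply: le_lt_trans hc; rewrite E lerDl msq_ge0.
Qed.

(** The function is orthogonal to all trigonometric polynomials, which are dense,
    hence to itself; so it vanishes almost everywhere, and continuity does the
    rest. *)
Lemma ccont_fc_eq0 h : ccont h -> (forall m, fc h m = 0) -> h =1 (fun=> 0).
Proof.
move=> hc h0; have h2 := ccont_csquare hc.
have m0 : msq h = 0.
  apply/eqP; rewrite eq_le msq_ge0// andbT leNgt; apply/negP => hp.
  have [c] := msq_approx h2 hp.
  rewrite msqB//; last exact/ccont_csquare/ccont_tp.
  rewrite mean_mul_tpJ// big1 ?mulr0 ?subr0; last by move=> x _; rewrite h0 mulr0.
  by apply/negP; rewrite -leNgt lerDl msq_ge0//; exact/ccont_csquare/ccont_tp.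
apply: ccont_ae_eq => //; first exact: ccont_cst.
have v2 : L2 (fun l => (h l)%:M : 'cV_1).
  by apply/L2_csquare => i; under eq_fun do rewrite mxE ord1 eqxx.
have : aeq (fun l => (h l)%:M : 'cV_1) (fun=> 0).
  apply/l2norm_aeq => //; first exact: L2_0.
  under eq_fun do rewrite subr0.
  rewrite /l2norm /inner big_ord1.
  rewrite (_ : circle_mean _ = circle_mean (fun l => h l * (h l)^* )).
    by rewrite -/(msq h) m0 sqrtr0.
  by congr circle_mean; apply/funext => l; rewrite mxE eqxx.
by apply: arc_aeS => t /(congr1 (fun M : 'cV_1 => M 0 0)); rewrite !mxE.
Qed.

End ScalarFourier.

Section Hardy.
Variables (R : realType) (n : nat).
Implicit Types (f g : vfun R n) (m : int) (A : circle R -> 'M[R[i]]_n).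

Lemma fourierE f m i : fourier f m i = fc (fun l => f l i 0) m. Proof. by []. Qed.

Lemma l2norm_msq f : L2 f -> l2norm f ^+ 2 = \sum_(i < n) msq (fun l => f l i 0).
Proof. by move=> f2; rewrite l2norm_sq// /inner cRe_sum. Qed.

(** A Fourier coefficient is an inner product with a unit vector. *)
Lemma fourier_bound f m i : L2 f -> normc (fourier f m i) <= l2norm f.
Proof.
move=> f2; pose g : vfun R n := fun l => val l ^ m *: delta_mx i 0.
have g2 : L2 g.
  apply/L2_csquare => j; under eq_fun do rewrite !mxE.
  by apply: csquareXz; apply: ccont_csquare; exact: ccont_cst.
have g1 : l2norm g = 1.
  apply/eqP; rewrite -(@eqrXn2 _ 2) ?l2norm_ge0// expr1n l2norm_sq//; apply/eqP.
  rewrite /inner (bigD1 i)//= big1 ?addr0.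
    rewrite (_ : (fun l => _) = fun=> 1) ?cmean_cst//; apply/funext => l.
    by rewrite !mxE !eqxx mulr1 -circle_expzJ -expfzDr ?circle_neq0// subrr.
  move=> j ji; rewrite (_ : (fun l => _) = fun=> 0) ?cmean_cst//; apply/funext => l.
  by rewrite !mxE (negbTE ji) mulr0 mul0r.
have -> : fourier f m i = inner f g; last first.
  by have := CauchySchwarz f2 g2; rewrite g1 mulr1.
rewrite /inner (bigD1 i)//= big1 ?addr0; last first.
  move=> j ji; rewrite (_ : (fun l => _) = fun=> 0) ?cmean_cst//; apply/funext => l.
  by rewrite !mxE (negbTE ji) mulr0 rmorph0 mulr0.
congr circle_mean; apply/funext => l.
by rewrite !mxE !eqxx mulr1 mulrC circle_expzJ.
Qed.

Lemma fourierB f g m i : L2 f -> L2 g ->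
  fourier (fun l => f l - g l) m i = fourier f m i - fourier g m i.
Proof.
move=> f2 g2; rewrite !fourierE; under [X in fc X]eq_fun do rewrite !mxE -mulN1r.
rewrite fcD; [|exact: f2|exact/csquareZ/g2].
by rewrite fcZ ?mulN1r//; exact: g2.
Qed.

Lemma hardy0 : hardy (fun=> 0 : 'cV[R[i]]_n).
Proof.
split; first exact: L2_0.
by move=> m i _; rewrite fourierE; under [X in fc X]eq_fun do rewrite mxE; exact: fc0.
Qed.

(** The Fourier coefficients are continuous in the norm. *)
Lemma hardy_closed : closed_subspace (@hardy R n).
Proof.
split; [by move=> f []|exact: hardy0| |].
- move=> a f g [f2 hf] [g2 hg]; split; first by apply: L2D => //; exact: L2Z.
  move=> m i m0; rewrite fourierE; under [X in fc X]eq_fun do rewrite !mxE.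
  rewrite fcD; [|exact/csquareZ/f2|exact/g2].
  by rewrite fcZ -?fourierE ?hf ?hg ?mulr0 ?addr0//; exact: f2.
- move=> f f2 ap; split=> // m i m0.
  apply: normc_eq0; apply/eqP; rewrite eq_le normc_ge0 andbT leNgt; apply/negP => p.
  have [g [g2 hg]] := ap _ p.
  apply/negP; rewrite -leNgt.
  have -> : fourier f m i = fourier (fun l => f l - g l) m i by rewrite fourierB// hg// subr0.
  by apply: fourier_bound; exact: L2B.
Qed.

Lemma hardy_approx f e : hardy f -> 0 < e -> exists c : 'I_n -> seq (int * R[i]),
  (forall i x, x \in c i -> 0 <= x.1) /\ l2norm (fun l => f l - \col_i tp (c i) l) < e.
Proof.
move=> [f2 hf] e0.
have e1 : 0 < e ^+ 2 / (n.+1%:R) by rewrite divr_gt0// exprn_gt0.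
have /choice[c hc] : forall i, exists c, (forall x, x \in c -> 0 <= x.1) /\
    msq (fun l => f l i 0 - tp c l) < e ^+ 2 / (n.+1%:R).
  move=> i; have h2 : csquare (fun l => f l i 0) by exact: f2.
  have [c c0 hc] := msq_analytic_approx h2 (fun m => hf m i) e1.
  by exists c.
exists c; split=> [i x|]; first by have [+ _] := hc i; apply.
have g2 : L2 (fun l => f l - \col_i tp (c i) l).
  apply: L2B => //; apply/L2_csquare => i; under eq_fun do rewrite mxE.
  exact/ccont_csquare/ccont_tp.
rewrite -ltr_sqr ?nnegrE ?l2norm_ge0 ?(ltW e0)// l2norm_msq//.
apply: (@le_lt_trans _ _ (\sum_(i < n) e ^+ 2 / n.+1%:R)).
  apply: ler_sum => i _; have [_ /ltW] := hc i; apply: le_trans.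
  by rewrite le_eqVlt; apply/orP; left; apply/eqP; congr msq; apply/funext => l; rewrite !mxE.
rewrite sumr_const card_ord -[X in X < _]mulr_natl mulrCA gtr_pMr ?exprn_gt0// ltr_pdivrMr//.
by rewrite mul1r ltr_nat.
Qed.

Definition mcont A := forall i j, ccont (fun l => A l i j).

Lemma L2_mulM A f : mcont A -> L2 f -> L2 (mulM A f).
Proof.
move=> Ac f2; apply/L2_csquare => i; under eq_fun do rewrite /mulM mxE.
by apply: csquare_sum => j _; apply: csquareM_ccont => //; exact: f2.
Qed.

Lemma msq_le (h k : circle R -> R[i]) : csquare h -> csquare k ->
  (forall l, normc (h l) ^+ 2 <= normc (k l) ^+ 2) -> msq h <= msq k.
Proof.
move=> h2 k2 hk; rewrite !msqE// ler_pM2l ?invr_gt0 ?twopi_gt0//.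
have I (a : circle R -> R[i]) : csquare a ->
    (@arc_measure R).-integrable setT (EFin \o (fun t => normc (a (expi t)) ^+ 2)).
  move=> a2; under [X in EFin \o X]eq_fun do rewrite normcE2.
  by apply: rintD; case: a2 => /Lfun2P[_ ?] /Lfun2P[_ ?].
by apply: le_Rintegral => //; exact: I.
Qed.

(** By the Cauchy-Schwarz inequality in C^n, each of the [n] entries of the product
    is pointwise at most [sqrt n * C] times the length of the vector. *)
Lemma l2norm_mulM A f (C : R) : mcont A -> (forall l i j, normc (A l i j) <= C) -> 0 <= C -> L2 f ->
  l2norm (mulM A f) <= n%:R * C * l2norm f.
Proof.
move=> Ac AC C0 f2.
rewrite -ler_sqr ?nnegrE ?l2norm_ge0 ?mulr_ge0 ?l2norm_ge0//.
have sq0 l : 0 <= \sum_(j < n) normc (f l j 0) ^+ 2 by apply: sumr_ge0 => j _; exact: sqr_ge0.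
have cs (x : 'I_n -> R) : (\sum_j x j) ^+ 2 <= n%:R * \sum_j x j ^+ 2.
  have -> : (\sum_j x j) ^+ 2 = \sum_i \sum_j x i * x j.
    by rewrite expr2 mulr_suml; apply: eq_bigr => i _; rewrite mulr_sumr.
  have -> : n%:R * \sum_j x j ^+ 2 =
      \sum_(i < n) \sum_(j < n) (x i ^+ 2 * 2^-1 + x j ^+ 2 * 2^-1).
    set S := \sum_j x j ^+ 2.
    transitivity (\sum_(i < n) (n%:R * (x i ^+ 2 * 2^-1) + S * 2^-1)); last first.
      apply: eq_bigr => i _.
      by rewrite big_split/= sumr_const card_ord mulr_natl -mulr_suml.
    rewrite big_split/= -mulr_sumr -mulr_suml sumr_const card_ord.
    by rewrite -[X in _ = _ + X]mulr_natl -/S; field.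
  apply: ler_sum => i _; apply: ler_sum => j _; have := sqr_ge0 (x i - x j); nra.
have pt l i : normc (mulM A f l i 0) ^+ 2 <= n%:R * C ^+ 2 * \sum_(j < n) normc (f l j 0) ^+ 2.
  rewrite /mulM mxE; apply: (@le_trans _ _ ((\sum_j C * normc (f l j 0)) ^+ 2)).
    rewrite ler_sqr ?nnegrE ?normc_ge0//; last by apply: sumr_ge0 => j _; rewrite mulr_ge0 ?normc_ge0.
    apply: (le_trans (normc_sum _ _ _)); apply: ler_sum => j _.
    by rewrite normcM ler_wpM2r ?normc_ge0.
  apply: (le_trans (cs _)); rewrite -mulrA ler_wpM2l// mulr_sumr; apply: ler_sum => j _.
  by rewrite exprMn.
have Af2 := L2_mulM Ac f2.
rewrite l2norm_msq// exprMn l2norm_msq//.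
have int (g : vfun R n) : L2 g -> \sum_(i < n) msq (fun l => g l i 0) =
    (2 * pi)^-1 * Rintegral (@arc_measure R) setT (sqn g).
  by move=> g2; rewrite -l2norm_msq// l2norm_sq// innerE.
rewrite (int f)//.
apply: (@le_trans _ _ (\sum_(i < n) (2 * pi)^-1 *
    Rintegral (@arc_measure R) setT (fun t => n%:R * C ^+ 2 * sqn f t))).
  apply: ler_sum => i _; have Afi : csquare (fun l => mulM A f l i 0) by exact: (Af2 i).
  rewrite msqE// ler_pM2l ?invr_gt0 ?twopi_gt0//.
  apply: le_Rintegral => //.
  - have [/Lfun2P[_ a] /Lfun2P[_ b]] := Afi.
    by under [X in EFin \o X]eq_fun do rewrite normcE2; exact: rintD.
  - by apply: rintZ; exact: sqn_integrable.
rewrite RintegralZl//; last exact: sqn_integrable.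
by rewrite sumr_const card_ord -mulr_natl le_eqVlt; apply/orP; left; apply/eqP; ring.
Qed.

Lemma mulMB A f g : mulM A (fun l => f l - g l) = (fun l => mulM A f l - mulM A g l).
Proof. by apply/funext => l; rewrite /mulM mulmxBr. Qed.

Lemma mcont_bounded A : mcont A -> exists2 C, 0 < C & forall l i j, normc (A l i j) <= C.
Proof.
move=> Ac; have /choice[C hC] : forall x : 'I_n * 'I_n, exists C, 0 < C /\
    forall l, normc (A l x.1 x.2) <= C.
  by move=> x; have [C C0 hC] := ccont_bounded (Ac x.1 x.2); exists C.
exists (1 + \sum_x C x).
  by rewrite ltr_pwDl// sumr_ge0// => x _; have [/ltW] := hC x.
move=> l i j; have [_ /(_ l) h] := hC (i, j); apply: (le_trans h).
rewrite (bigD1 (i, j))//= addrCA lerDl addr_ge0// sumr_ge0// => x _.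
by have [/ltW] := hC x.
Qed.

(** The product of an analytic matrix with an analytic trigonometric polynomial has
    no negative frequency, and such polynomials are dense in the Hardy space. *)
Lemma hardy_mulM A f : mcont A -> (forall i j m, m < 0 -> fc (fun l => A l i j) m = 0) ->
  hardy f -> hardy (mulM A f).
Proof.
move=> Ac A0 hf; have [f2 _] := hf.
have [_ _ _] := hardy_closed; apply; first exact: L2_mulM.
move=> e e0; have [C C0 AC] := mcont_bounded Ac.
have e1 : 0 < e / (n.+1%:R * C) by rewrite divr_gt0// mulr_gt0.
have [c [c0 hc]] := hardy_approx hf e1.
pose p : vfun R n := fun l => \col_i tp (c i) l.
have p2 : L2 p.
  apply/L2_csquare => i; under eq_fun do rewrite mxE; exact/ccont_csquare/ccont_tp.
exists (mulM A p).
  split; first exact: L2_mulM.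
  move=> m i m0; rewrite fourierE; under [X in fc X]eq_fun do rewrite /mulM !mxE.
  have AE j : csquare (fun l => A l i j) by exact/ccont_csquare/Ac.
  rewrite fc_sum => [|j _]; last by apply: csquareM_ccont => //; exact: p2.
  rewrite big1// => j _; under [X in fc X]eq_fun do rewrite mxE /tp mulr_sumr.
  rewrite fc_sum => [|x _]; last first.
    apply: csquareM_ccont => //; apply/csquareZ/ccont_csquare/ccont_expz.
  rewrite big_seq big1// => x xc.
  under [X in fc X]eq_fun do rewrite mulrCA [X in _ * X]mulrC.
  rewrite fcZ; last exact: csquareXz.
  by rewrite fcXz A0 ?mulr0// subr_lt0 (lt_le_trans m0)// (c0 j).
rewrite -mulMB; apply: (le_lt_trans (l2norm_mulM Ac AC (ltW C0) (L2B f2 p2))).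
have h0 := l2norm_ge0 (fun l => f l - p l).
rewrite ltr_pdivlMr ?mulr_gt0// mulrC in hc.
apply: le_lt_trans hc; rewrite ler_wpM2r//= ler_pM2r// ler_nat//.
Qed.

End Hardy.

(** * The frame of the wandering subspace *)

Section Frame.
Variables (R : realType) (n : nat).
Implicit Types (f g : vfun R n) (A : circle R -> 'M[R[i]]_n).

Definition adjm (A : 'M[R[i]]_n) : 'M[R[i]]_n := map_mx Num.conj A^T.

Lemma adjmM (A B : 'M[R[i]]_n) : adjm (A *m B) = adjm B *m adjm A.
Proof. by rewrite /adjm trmx_mul map_mxM. Qed.

Lemma fcJ (h : circle R -> R[i]) m : csquare h -> fc (fun l => (h l)^*) m = (fc h (- m))^*.
Proof.
move=> h2; rewrite /fc -cmeanJ; last exact/cintegrable_square/csquareXz.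
by congr circle_mean; apply/funext => l; rewrite rmorphM /= -circle_expzJ opprK.
Qed.

Lemma closed_aeq (V : set (vfun R n)) f g : closed_subspace V -> V g -> L2 f -> aeq f g -> V f.
Proof.
move=> [VL2 _ _ Vcl] Vg f2 fg; apply: Vcl => // e e0; exists g => //.
by rewrite (l2norm_aeq f2 (VL2 _ Vg)).2.
Qed.

Lemma closed_sum (V : set (vfun R n)) (I : Type) (r : seq I) (a : I -> R[i]) (F : I -> vfun R n) :
  closed_subspace V -> (forall i, V (F i)) -> V (fun l => \sum_(i <- r) a i *: F i l).
Proof.
move=> [_ V0 Vlin _] VF; elim: r => [|i r IH].
  by under eq_fun do rewrite big_nil.
by under eq_fun do rewrite big_cons; exact: Vlin.
Qed.

Lemma shift_iter (V : set (vfun R n)) f (k : nat) : shift_invariant V -> V f ->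
  V (fun l => val l ^ k%:Z *: f l).
Proof.
move=> Vs Vf; elim: k => [|k IH]; first by under eq_fun do rewrite expr0z scale1r.
apply: Vs; exists (fun l => val l ^ k%:Z *: f l) => //.
by apply/funext => l; rewrite /fwd_shift scalerA -exprSz.
Qed.

Variables (V : set (vfun R n)) (s : 'I_n -> vfun R n).
Hypothesis Vcl : closed_subspace V.
Hypothesis Vsh : shift_invariant V.
Hypothesis sc : forall j i, ccont (fun l => s j l i 0).
Hypothesis sb : l2_basis s (wandering V).

Definition framemx (l : circle R) : 'M[R[i]]_n := \matrix_(i, j) s j l i 0.
(** The normalization at [1] removes the choice of the basis [s]. *)
Definition framepsi (l : circle R) : 'M[R[i]]_n := framemx l *m invmx (framemx (circle1 R)).

Let s2 j : L2 (s j). Proof. by move=> i; exact: ccont_csquare (sc j i). Qed.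

Lemma wandering_comb (c : 'I_n -> R[i]) : wandering V (fun l => \sum_j c j *: s j l).
Proof.
apply/sb.1; split; first by apply: L2_sum => j _; exact: L2Z.
by exists c; exact: aeq_refl.
Qed.

Let Ws j : wandering V (s j).
Proof.
have := wandering_comb (fun k => (k == j)%:R); congr (wandering V _).
apply/funext => l; rewrite (bigD1 j)//= eqxx scale1r big1 ?addr0// => k kj.
by rewrite (negbTE kj) scale0r.
Qed.

(** For [k >= 0], [val l ^ k.+1 g] lies in the image of the shift. *)
Lemma wandering_shift f g (k : nat) : wandering V f -> V g ->
  inner f (fun l => val l ^ k.+1%:Z *: g l) = 0.
Proof.
move=> [_ Wf] Vg; apply: Wf; exists (fun l => val l ^ k%:Z *: g l).
  exact: shift_iter.
by apply/funext => l; rewrite /fwd_shift scalerA -exprSz.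
Qed.

Let gram i j l : R[i] := \sum_k (s i l k 0)^* * s j l k 0.

Let gram_cont i j : ccont (gram i j).
Proof. by apply: ccont_sum => k _; apply: ccontM => //; exact: ccontJ. Qed.

Let gram_pos i j (m : nat) : fc (gram i j) m.+1%:Z = 0.
Proof.
have := wandering_shift m (Ws j) (Ws i).1; rewrite /inner => <-.
rewrite /gram fc_sum => [|k _]; last by apply/ccont_csquare/ccontM => //; exact: ccontJ.
apply: eq_bigr => k _; congr circle_mean; apply/funext => l.
by rewrite mxE rmorphM /= -circle_expzJ; ring.
Qed.

Let gramJ i j l : gram j i l = (gram i j l)^*.
Proof.
rewrite /gram rmorph_sum; apply: eq_bigr => k _ /=.
by rewrite rmorphM /= conjCK mulrC.
Qed.

Let gram_const i j l : gram i j l = fc (gram i j) 0.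
Proof.
have c0 : ccont (fun l => gram i j l - fc (gram i j) 0).
  by apply: ccontD => //; apply: ccontN; exact: ccont_cst.
apply/eqP; rewrite -subr_eq0; apply/eqP; apply: (ccont_fc_eq0 c0) => m.
have -> : fc (fun l => gram i j l - fc (gram i j) 0) m =
    fc (gram i j) m + fc (fun=> - fc (gram i j) 0) m.
  by apply: fcD; [exact: ccont_csquare|exact/ccont_csquare/ccont_cst].
rewrite fc_cst; case: m => [[|m]|m].
- by rewrite eqxx mul1r subrr.
- by rewrite gram_pos mul0r addr0.
- rewrite NegzE eqr_oppLR oppr0 mul0r addr0.
  have -> : gram i j = fun l => (gram j i l)^* by apply/funext => x; rewrite gramJ.
  by rewrite fcJ ?opprK ?gram_pos ?rmorph0//; exact: ccont_csquare.
Qed.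

Let framemx_gram l : adjm (framemx l) *m framemx l = \matrix_(i, j) fc (gram i j) 0.
Proof.
apply/matrixP => i j; rewrite !mxE -(gram_const i j l).
by apply: eq_bigr => k _; rewrite !mxE.
Qed.

(** The Gram matrix of the columns is the same at all points of the circle, because
    its Fourier coefficients other than the constant one vanish by
    orthogonality. A vector that it kills is therefore a linear relation between
    the basis vectors on the whole circle. *)
Lemma framemx_unit l : framemx l \in unitmx.
Proof.
suff : adjm (framemx l) *m framemx l \in unitmx.
  by rewrite unitmx_mul => /andP[].
rewrite unitmxE unitfE; apply/det0P => -[v v0 vG].
have fv l' : framemx l' *m (map_mx Num.conj v^T) = 0.
  pose w := framemx l' *m (map_mx Num.conj v^T).
  have : map_mx Num.conj w^T *m w = 0.
    have -> : map_mx Num.conj w^T = v *m adjm (framemx l').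
      rewrite /w trmx_mul map_mxM /= map_trmx -map_mx_comp.
      rewrite trmxK /adjm; congr (_ *m _).
      by apply/matrixP => i j; rewrite !mxE /= conjCK.
    rewrite /w mulmxA -(mulmxA v) framemx_gram.
    by rewrite -(framemx_gram l) vG mul0mx.
  move=> /matrixP /(_ 0 0); rewrite !mxE => e.
  have {e} : \sum_k (normc (w k 0) ^+ 2) = 0.
    have := congr1 (@complex.Re R) e; rewrite cRe_sum /= => e1; rewrite -[RHS]e1.
    by apply: eq_bigr => k _; rewrite !mxE mulrC mulJ.
  move=> /eqP; rewrite psumr_eq0 => [/allP e|k _]; last exact: sqr_ge0.
  apply/matrixP => k j; rewrite ord1 [RHS]mxE.
  by have := e k (mem_index_enum k); rewrite sqrf_eq0 => /eqP /normc_eq0.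
have : forall j, (v 0 j)^* = 0.
  apply: sb.2; apply: aeW => t.
  apply/matrixP => i j; have /matrixP/(_ i 0) := fv (expi t).
  rewrite !mxE => e; rewrite ord1 summxE -[RHS]e; apply: eq_bigr => k _.
  by rewrite !mxE mulrC.
move=> vz; case/eqP: v0; apply/matrixP => i j; rewrite ord1 mxE.
by apply/eqP; rewrite -conjC_eq0 vz.
Qed.

Lemma framepsi_adj l : adjm (framepsi l) *m framepsi l = 1%:M.
Proof.
rewrite /framepsi adjmM mulmxA -(mulmxA (adjm (invmx _))) framemx_gram.
rewrite -(framemx_gram (circle1 R)) -mulmxA -mulmxA mulmxV ?framemx_unit// mulmx1.
by rewrite -adjmM mulmxV ?framemx_unit// /adjm trmx1 map_mx1.
Qed.

Lemma framepsi_unitary l : framepsi l \is unitarymx.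
Proof. by apply/unitarymxP/mulmx1C; exact: framepsi_adj. Qed.

Lemma framepsi1 : framepsi (circle1 R) = 1%:M.
Proof. by rewrite /framepsi mulmxV// framemx_unit. Qed.

Lemma framepsi_cont : mcont framepsi.
Proof.
move=> i j; under eq_fun do rewrite mxE.
apply: ccont_sum => k _; apply: ccontM; last exact: ccont_cst.
by under eq_fun do rewrite mxE.
Qed.

Lemma adjm_cont A : mcont A -> mcont (fun l => adjm (A l)).
Proof. by move=> Ac i j; under eq_fun do rewrite !mxE; apply: ccontJ. Qed.

Let Wpsi i : wandering V (fun l => framepsi l *m delta_mx i 0).
Proof.
have := wandering_comb (fun j => invmx (framemx (circle1 R)) j i); congr (wandering V _).
apply/funext => l; rewrite -colE; apply/matrixP => k j.
rewrite ord1 summxE !mxE; apply: eq_bigr => p _; rewrite !mxE mulrC; congr (_ * _).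
Qed.

(** For [g] in [V], the positive shifts of [g] are orthogonal to the columns of
    [framepsi], so [adjm framepsi g] has no negative frequency. Conversely,
    [framepsi] maps analytic polynomials into [V], which is closed. Since
    [framepsi] is unitary at each point of the circle, [adjm framepsi] inverts
    it, and the two inclusions follow. *)
Lemma framepsi_hardy : V = mulM framepsi @` @hardy R n.
Proof.
have [VL2 V0 Vlin Vlim] := Vcl.
apply/seteqP; split => [g Vg|_ [f hf <-]].
  exists (mulM (fun l => adjm (framepsi l)) g); last first.
    apply/funext => l; rewrite /mulM mulmxA.
    by have /mulmx1C -> := framepsi_adj l; rewrite mul1mx.
  split; first by apply: L2_mulM (VL2 _ Vg); apply: adjm_cont; exact: framepsi_cont.
  case=> // m i _; rewrite NegzE.
  have Wi := (Wpsi i).1; have g2 := VL2 _ Vg.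
  have gs2 : L2 (fun l => val l ^ m.+1%:Z *: g l) by exact: (VL2 _ (shift_iter m.+1 Vsh Vg)).
  have : inner (fun l => val l ^ m.+1%:Z *: g l) (fun l => framepsi l *m delta_mx i 0) = 0.
    by rewrite innerC ?wandering_shift ?rmorph0//; exact: VL2.
  rewrite /inner => <-; rewrite /fourier opprK -(cmean_sum _ _).2; last first.
    move=> k _; apply: cintegrableM; first exact: gs2.
    by apply: csquareJ; exact: (VL2 _ Wi k).
  congr circle_mean; apply/funext => l.
  rewrite /mulM mxE mulr_sumr; apply: eq_bigr => k _.
  by rewrite -colE !mxE; ring.
have [f2 _] := hf.
apply: Vlim; first by apply: L2_mulM => //; exact: framepsi_cont.
move=> e e0; have [C C0 AC] := mcont_bounded framepsi_cont.
have e1 : 0 < e / (n.+1%:R * C) by rewrite divr_gt0// mulr_gt0.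
have [c [c0 hc]] := hardy_approx hf e1.
pose p : vfun R n := fun l => \col_i tp (c i) l.
have p2 : L2 p.
  apply/L2_csquare => i; under eq_fun do rewrite mxE; exact/ccont_csquare/ccont_tp.
exists (mulM framepsi p).
  have Vtp i d : (forall x, x \in d -> 0 <= x.1) ->
      V (fun l => tp d l *: (framepsi l *m delta_mx i 0)).
    elim: d => [|x d IH] d0.
      by under eq_fun do rewrite /tp big_nil scale0r.
    under eq_fun do rewrite /tp big_cons scalerDl -scalerA.
    apply: Vlin; last by apply: IH => y yd; apply: d0; rewrite inE yd orbT.
    have : 0 <= x.1 by apply: d0; rewrite inE eqxx.
    by case: (x.1) => // k _; apply: shift_iter => //; exact: (Wpsi i).1.
  have := closed_sum (index_enum 'I_n) (fun=> 1) Vcl (fun i => Vtp i (c i) (c0 i)).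
  congr (V _); apply/funext => l; rewrite /mulM.
  under eq_bigr do rewrite scale1r.
  have -> : p l = \sum_i tp (c i) l *: delta_mx i 0.
    apply/matrixP => i j; rewrite ord1 summxE (bigD1 i)//= !mxE !eqxx mulr1 big1 ?addr0// => k ki.
    by rewrite !mxE eq_sym (negbTE ki) mulr0.
  by rewrite mulmx_sumr; apply: eq_bigr => i _; rewrite -scalemxAr.
rewrite -mulMB; apply: (le_lt_trans (l2norm_mulM framepsi_cont AC (ltW C0) (L2B f2 p2))).
have h0 := l2norm_ge0 (fun l => f l - p l).
rewrite ltr_pdivlMr ?mulr_gt0// mulrC in hc.
apply: le_lt_trans hc; rewrite ler_wpM2r//= ler_pM2r// ler_nat//.
Qed.

End Frame.

(** * Calculus of smooth functions *)

Section Smooth.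
Variables (R : realType) (E : normedModType R).
Implicit Types (D U : set E) (f g : E -> R) (k : nat).

Lemma Ck_on_cont D k f x : Ck_on D k f -> D x -> {for x, continuous f}.
Proof. by case: k => [|k] [h _]; exact: h. Qed.

Lemma Ck_onS D k f : Ck_on D k.+1 f -> Ck_on D k f.
Proof.
elim: k f => [|k IH] f; first by case.
case=> cf df; split=> // v; have [dv Cv] := df v.
by split=> //; exact: IH.
Qed.

Lemma Ck_on_local D k f :
  (forall x, D x -> exists2 U, U x & Ck_on U k f) -> Ck_on D k f.
Proof.
elim: k f => [|k IH] f h; split.
- by move=> x Dx; have [U Ux Cf] := h x Dx; exact: Ck_on_cont Cf Ux.
- by [].
- by move=> x Dx; have [U Ux Cf] := h x Dx; exact: Ck_on_cont Cf Ux.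
- move=> v; split=> [x Dx|].
    by have [U Ux [_ /(_ v)[dv _]]] := h x Dx; exact: dv.
  apply: IH => x Dx; have [U Ux [_ /(_ v)[_ Cv]]] := h x Dx.
  by exists U.
Qed.

Lemma Ck_on_sub D U k f : D `<=` U -> Ck_on U k f -> Ck_on D k f.
Proof. by move=> DU Cf; apply: Ck_on_local => x Dx; exists U => //; exact: DU. Qed.

Lemma near_open D x : open D -> D x -> \forall y \near x, D y.
Proof. by move=> oD Dx; exact: open_nbhs_nbhs. Qed.

Lemma eq_Ck_on D k f g : open D -> {in D, f =1 g} -> Ck_on D k f -> Ck_on D k g.
Proof.
move=> oD; elim: k f g => [|k IH] f g fg.
  case=> cf _; split=> // x Dx.
  have n : \forall y \near x, f y = g y.
    by apply: filterS (near_open oD Dx) => y Dy; apply: fg; rewrite inE.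
  have := cf x Dx; rewrite /prop_for /continuous_at (fg x) ?inE//.
  by apply: cvg_trans; exact: near_eq_cvg.
move=> /[dup] Cf [cf df].
have nfg x : D x -> \forall y \near x, f y = g y.
  by move=> Dx; apply: filterS (near_open oD Dx) => y Dy; apply: fg; rewrite inE.
have Cg := IH f g fg (Ck_onS Cf).
split=> [x Dx|v]; first exact: Ck_on_cont Cg Dx.
have [dv Cv] := df v; split=> [x Dx|].
  exact: near_eq_derivable (nfg x Dx) (dv x Dx).
apply: IH Cv => x; rewrite inE => Dx; exact: near_eq_derive (nfg x Dx).
Qed.

Lemma Ck_on_cst D k (a : R) : Ck_on D k (fun=> a).
Proof.
elim: k a => [|k IH] a; first by split=> // x _; exact: cvg_cst.
split=> [x _|v]; first exact: cvg_cst.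
split=> [x _|]; first exact: derivable_cst.
by rewrite (_ : 'D_v _ = fun=> 0) //; apply/funext => x; rewrite derive_cst.
Qed.

Lemma Ck_onD D k f g : open D -> Ck_on D k f -> Ck_on D k g ->
  Ck_on D k (fun x => f x + g x).
Proof.
move=> oD; elim: k f g => [|k IH] f g [cf df] [cg dg].
  by split=> // x Dx; apply: cvgD; [exact: cf|exact: cg].
split=> [x Dx|v]; first by apply: cvgD; [exact: cf|exact: cg].
have [dfv Cfv] := df v; have [dgv Cgv] := dg v; split=> [x Dx|].
  by apply: derivableD; [exact: dfv|exact: dgv].
apply: (eq_Ck_on oD _ (IH _ _ Cfv Cgv)) => x; rewrite inE => Dx.
by rewrite -deriveD//; [exact: dfv|exact: dgv].
Qed.

Lemma Ck_onM D k f g : open D -> Ck_on D k f -> Ck_on D k g ->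
  Ck_on D k (fun x => f x * g x).
Proof.
move=> oD; elim: k f g => [|k IH] f g.
  by move=> [cf _] [cg _]; split=> // x Dx; apply: cvgM; [exact: cf|exact: cg].
move=> /[dup] Cf [cf df] /[dup] Cg [cg dg]; split=> [x Dx|v].
  by apply: cvgM; [exact: cf|exact: cg].
have [dfv Cfv] := df v; have [dgv Cgv] := dg v; split=> [x Dx|].
  by apply: derivableM; [exact: dfv|exact: dgv].
have C := Ck_onD oD (IH _ _ (Ck_onS Cf) Cgv) (IH _ _ (Ck_onS Cg) Cfv).
apply: (eq_Ck_on oD _ C) => x; rewrite inE => Dx.
by rewrite (@deriveM _ _ f g)//; [exact: dfv|exact: dgv].
Qed.

Lemma Ck_onN D k f : open D -> Ck_on D k f -> Ck_on D k (fun x => - f x).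
Proof.
move=> oD Cf; apply: (eq_Ck_on oD _ (Ck_onM oD (Ck_on_cst D k (-1)) Cf)).
by move=> x _; rewrite mulN1r.
Qed.

Lemma Ck_onV D k f : open D -> (forall x, D x -> f x != 0) -> Ck_on D k f ->
  Ck_on D k (fun x => (f x)^-1).
Proof.
move=> oD f0; elim: k => [|k IH].
  by move=> [cf _]; split=> // x Dx; apply: cvgV; [exact: f0|exact: cf].
move=> /[dup] Cf [cf df]; split=> [x Dx|v].
  by apply: cvgV; [exact: f0|exact: cf].
have [dfv Cfv] := df v; split=> [x Dx|].
  by apply: derivableV; [exact: f0|exact: dfv].
have CV := IH (Ck_onS Cf).
have C := Ck_onN oD (Ck_onM oD (Ck_onM oD CV CV) Cfv).
apply: (eq_Ck_on oD _ C) => x; rewrite inE => Dx.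
rewrite deriveV//; [|exact: f0|exact: dfv].
by rewrite /GRing.scale/= mulNr -exprVn expr2.
Qed.

Lemma smooth_on_local D f :
  (forall k x, D x -> exists2 U, U x & Ck_on U k f) -> smooth_on D f.
Proof. by move=> h k; apply: Ck_on_local => x; exact: h. Qed.

Lemma smooth_on_derive D f v : smooth_on D f -> smooth_on D (fun x => 'D_v f x).
Proof. by move=> sf k; have [_ /(_ v)[]] := sf k.+1. Qed.

Lemma smooth_on_derivable D f v x : smooth_on D f -> D x -> derivable f x v.
Proof. by move=> sf Dx; have [_ /(_ v)[dv _]] := sf 1%N; exact: dv. Qed.

Lemma smooth_on_cont D f x : smooth_on D f -> D x -> {for x, continuous f}.
Proof. by move=> sf Dx; exact: Ck_on_cont (sf 0%N) Dx. Qed.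

End Smooth.

Section SmoothComp.
Variables (R : realType) (E F : normedModType R).
Variables (A : F -> E) (L : F -> E).
Hypothesis AL : forall x v (h : R), A (h *: v + x) = h *: L v + A x.
Hypothesis Ac : continuous A.

Lemma derive_comp_affine (f : E -> R) x v : 'D_v (f \o A) x = 'D_(L v) f (A x).
Proof. by rewrite /derive /=; under eq_fun do rewrite AL. Qed.

Lemma derivable_comp_affine (f : E -> R) x v :
  derivable f (A x) (L v) -> derivable (f \o A) x v.
Proof. by move=> d; rewrite /derivable /=; under eq_fun do rewrite AL. Qed.

Lemma Ck_on_comp_affine (D : set E) (D' : set F) k (f : E -> R) :
  (forall x, D' x -> D (A x)) -> Ck_on D k f -> Ck_on D' k (f \o A).
Proof.
move=> DD; elim: k f => [|k IH] f [cf df].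
  by split=> // x Dx; apply: continuous_comp; [exact: Ac|apply: cf; exact: DD].
split=> [x Dx|v]; first by apply: continuous_comp; [exact: Ac|apply: cf; exact: DD].
have [dfv Cfv] := df (L v); split=> [x Dx|].
  by apply: derivable_comp_affine; apply: dfv; exact: DD.
rewrite (_ : (fun x => _) = (fun x => 'D_(L v) f x) \o A); first exact: IH.
by apply/funext => x; rewrite derive_comp_affine.
Qed.

End SmoothComp.

(** ** Complex-valued smooth functions *)

Section CSmooth.
Variables (R : realType) (E : normedModType R) (D : set E).
Hypothesis oD : open D.
Implicit Types (F G : E -> R[i]).

Definition csmooth (D : set E) F :=
  smooth_on D (fun x => complex.Re (F x)) /\ smooth_on D (fun x => complex.Im (F x)).

Lemma csmooth_cst (a : R[i]) : csmooth D (fun=> a).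
Proof. by split=> k; exact: Ck_on_cst. Qed.

Lemma eq_csmooth F G : {in D, F =1 G} -> csmooth D F -> csmooth D G.
Proof.
move=> FG [r i]; split=> k.
- by apply: (eq_Ck_on oD _ (r k)) => x Dx; rewrite FG.
- by apply: (eq_Ck_on oD _ (i k)) => x Dx; rewrite FG.
Qed.

Lemma csmoothD F G : csmooth D F -> csmooth D G -> csmooth D (fun x => F x + G x).
Proof.
move=> [r i] [r' i']; split=> k.
- by under eq_fun do rewrite cReD; exact: Ck_onD.
- by under eq_fun do rewrite cImD; exact: Ck_onD.
Qed.

Lemma csmoothM F G : csmooth D F -> csmooth D G -> csmooth D (fun x => F x * G x).
Proof.
move=> [r i] [r' i']; split=> k.
- under eq_fun do rewrite cReM; apply: Ck_onD => //; first exact: Ck_onM.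
  by apply: Ck_onN => //; exact: Ck_onM.
- by under eq_fun do rewrite cImM; apply: Ck_onD => //; exact: Ck_onM.
Qed.

Lemma csmoothJ F : csmooth D F -> csmooth D (fun x => (F x)^*).
Proof.
move=> [r i]; split=> k; first by under eq_fun do rewrite cReJ.
by under eq_fun do rewrite cImJ; exact: Ck_onN.
Qed.

Lemma csmooth_sum (I : Type) (r : seq I) (P : pred I) (H : I -> E -> R[i]) :
  (forall i, csmooth D (H i)) -> csmooth D (fun x => \sum_(i <- r | P i) H i x).
Proof.
move=> Hs; elim: r => [|i r IH].
  by under eq_fun do rewrite big_nil; exact: csmooth_cst.
under eq_fun do rewrite big_cons.
by have [Pi|Pi] := boolP (P i); rewrite ?Pi ?(negbTE Pi)//; exact: csmoothD.
Qed.

Lemma csmooth_prod (I : Type) (r : seq I) (P : pred I) (H : I -> E -> R[i]) :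
  (forall i, csmooth D (H i)) -> csmooth D (fun x => \prod_(i <- r | P i) H i x).
Proof.
move=> Hs; elim: r => [|i r IH].
  by under eq_fun do rewrite big_nil; exact: csmooth_cst.
under eq_fun do rewrite big_cons.
by have [Pi|Pi] := boolP (P i); rewrite ?Pi ?(negbTE Pi)//; exact: csmoothM.
Qed.

Lemma csmoothV F : (forall x, D x -> F x != 0) -> csmooth D F ->
  csmooth D (fun x => (F x)^-1).
Proof.
move=> F0 sF; have [r i] := sF; have sJ := csmoothJ sF.
pose N x := complex.Re (F x) * complex.Re (F x) + complex.Im (F x) * complex.Im (F x).
have N0 x : D x -> N x != 0.
  move=> Dx; have := F0 x Dx; apply: contra.
  rewrite /N -!expr2 -normcE2 sqrf_eq0 => /eqP /normc_eq0 ->; exact: eqxx.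
have sN : csmooth D (fun x => ((N x)^-1)%:C%C).
  split=> k /=; last exact: Ck_on_cst.
  by apply: Ck_onV => //; apply: Ck_onD => //; exact: Ck_onM.
apply: eq_csmooth (csmoothM sJ sN) => x; rewrite inE => Dx.
apply: (mulfI (F0 x Dx)); rewrite divff ?F0// mulrA mulJ -rmorphM /=.
by rewrite normcE2 !expr2 divff// N0.
Qed.

Definition mxsmooth (D : set E) m n (A : E -> 'M[R[i]]_(m, n)) :=
  forall i j, csmooth D (fun x => A x i j).

Lemma mxsmoothM m n p (A : E -> 'M[R[i]]_(m, n)) (B : E -> 'M[R[i]]_(n, p)) :
  mxsmooth D A -> mxsmooth D B -> mxsmooth D (fun x => A x *m B x).
Proof.
move=> As Bs i j; under eq_fun do rewrite mxE.
by apply: csmooth_sum => k; apply: csmoothM; [exact: As|exact: Bs].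
Qed.

Lemma csmooth_det n (A : E -> 'M[R[i]]_n) : mxsmooth D A -> csmooth D (fun x => \det (A x)).
Proof.
move=> As; apply: csmooth_sum => s; apply: csmoothM; first exact: csmooth_cst.
by apply: csmooth_prod => i; exact: As.
Qed.

(** Cramer's rule. *)
Lemma mxsmoothV n (A : E -> 'M[R[i]]_n) : (forall x, D x -> A x \in unitmx) ->
  mxsmooth D A -> mxsmooth D (fun x => invmx (A x)).
Proof.
move=> Au As i j.
have s : csmooth D (fun x => (\det (A x))^-1 * ((-1) ^+ (j + i) * \det (row' j (col' i (A x))))).
  apply: csmoothM.
    by apply: csmoothV; [move=> x /Au; rewrite unitmxE unitfE|exact: csmooth_det].
  apply: csmoothM; first exact: csmooth_cst.
  apply: csmooth_det => a b; under eq_fun do rewrite !mxE; exact: As.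
apply: eq_csmooth s => x; rewrite inE => Dx.
by rewrite /invmx Au// !mxE /cofactor.
Qed.

End CSmooth.

(** * Unconditional sums and the sum over words *)

Section Sums.
Variables (R : realType) (T : eqType).
Implicit Types (f g M : T -> R) (l : seq T).

Lemma sum_subseq l l' g : (forall x, 0 <= g x) -> uniq l -> {subset l <= l'} ->
  \sum_(x <- l) g x <= \sum_(x <- l') g x.
Proof.
move=> g0; elim: l l' => [|x l IH] l' /=.
  by rewrite big_nil => _ _; apply: sumr_ge0.
move=> /andP[xl ul] sub.
rewrite big_cons (perm_big _ (perm_to_rem (sub x (mem_head _ _)))) big_cons lerD2l.
apply: IH => // y yl; have := sub y; rewrite inE yl orbT => /(_ isT) yl'.
have : y \in x :: rem x l' by rewrite -(perm_mem (perm_to_rem (sub x (mem_head _ _)))).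
by rewrite inE => /orP[/eqP yx|//]; move: xl; rewrite -yx yl.
Qed.

Definition abs_bounded f (C : R) := forall l, uniq l -> \sum_(x <- l) `|f x| <= C.

(** Convergence along the finite subsets of the index type, represented by lists
    without repetition. *)
Definition has_sum f (S : R) := forall e, 0 < e -> exists l0, forall l,
  uniq l -> {subset l0 <= l} -> `|\sum_(x <- l) f x - S| <= e.

Lemma has_sum_unique f S S' : has_sum f S -> has_sum f S' -> S = S'.
Proof.
move=> h h'; apply/eqP; rewrite -subr_eq0 -normr_le0 leNgt; apply/negP => d0.
have [l hl] := h _ (divr_gt0 d0 (ltr0n _ 3)); have [l' hl'] := h' _ (divr_gt0 d0 (ltr0n _ 3)).
have := hl (undup (l ++ l')) (undup_uniq _); have := hl' (undup (l ++ l')) (undup_uniq _).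
set s := \sum_(_ <- _) _ => a b.
have {}a : `|s - S'| <= `|S - S'| / 3 by apply: a => x xl; rewrite mem_undup mem_cat xl orbT.
have {}b : `|s - S| <= `|S - S'| / 3 by apply: b => x xl; rewrite mem_undup mem_cat xl.
have := ler_normB (s - S') (s - S).
by rewrite (_ : s - S' - (s - S) = S - S'); [lra|ring].
Qed.

Lemma eq_has_sum f g S : f =1 g -> has_sum f S -> has_sum g S.
Proof. by move=> /funext ->. Qed.

Lemma has_sumL (a : R) f g S S' : has_sum f S -> has_sum g S' ->
  has_sum (fun x => a * f x + g x) (a * S + S').
Proof.
move=> h h' e e0.
have a1 : 0 < `|a| + 1 by rewrite ltr_wpDl.
have [l hl] := h _ (divr_gt0 (divr_gt0 e0 (ltr0n _ 2)) a1).
have [l' hl'] := h' _ (divr_gt0 e0 (ltr0n _ 2)).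
exists (l ++ l') => k uk sub.
rewrite big_split/= -mulr_sumr.
have -> : a * \sum_(i <- k) f i + \sum_(i <- k) g i - (a * S + S') =
  a * (\sum_(i <- k) f i - S) + (\sum_(i <- k) g i - S') by ring.
apply: (le_trans (ler_normD _ _)); rewrite normrM.
have b1 : `|\sum_(i <- k) f i - S| <= e / 2 / (`|a| + 1).
  by apply: hl => // x xl; apply: sub; rewrite mem_cat xl.
have b2 : `|\sum_(i <- k) g i - S'| <= e / 2.
  by apply: hl' => // x xl; apply: sub; rewrite mem_cat xl orbT.
have : `|a| * `|\sum_(i <- k) f i - S| <= e / 2; last by lra.
apply: (@le_trans _ _ ((`|a| + 1) * (e / 2 / (`|a| + 1)))).
  by apply: ler_pM => //; rewrite lerDl.
by rewrite mulrC divfK// gt_eqF.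
Qed.

Lemma has_sum0 : has_sum (fun=> 0) 0.
Proof. by move=> e e0; exists [::] => l _ _; rewrite big1// subrr normr0 ltW. Qed.

Lemma has_sumZ (a : R) f S : has_sum f S -> has_sum (fun x => a * f x) (a * S).
Proof.
move=> h; have := has_sumL a h has_sum0; rewrite addr0.
by under eq_fun do rewrite addr0.
Qed.

Lemma has_sumD f g S S' : has_sum f S -> has_sum g S' -> has_sum (fun x => f x + g x) (S + S').
Proof.
move=> h h'; have := has_sumL 1 h h'; rewrite mul1r.
by under eq_fun do rewrite mul1r.
Qed.

Lemma abs_bounded_ge0 f C : abs_bounded f C -> 0 <= C.
Proof. by move=> /(_ [::] isT); rewrite big_nil. Qed.

(** The sum of a nonnegative family is a supremum, and [f] is the difference of the
    nonnegative families [`|f| + f] and [`|f|]. *)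
Lemma abs_bounded_has_sum f C : abs_bounded f C -> exists S, has_sum f S.
Proof.
have pos g K : (forall x, 0 <= g x) -> abs_bounded g K -> exists S, has_sum g S.
  move=> g0 gK.
  pose A := [set s | exists2 l, uniq l & s = \sum_(x <- l) g x].
  have supA : has_sup A.
    split; first by exists 0; exists [::]; rewrite ?big_nil.
    exists K => _ [l ul ->]; apply: le_trans (gK l ul).
    by apply: ler_sum => x _; exact: ler_norm.
  exists (sup A) => e e0.
  have [_ [l0 ul0 ->] h0] := sup_adherent e0 supA.
  exists l0 => l ul sub.
  have a1 := sum_subseq g0 ul0 sub.
  have a2 : \sum_(x <- l) g x <= sup A by apply: ub_le_sup => //; [exact: supA.2|exists l].
  by rewrite ler_norml; apply/andP; split; lra.
move=> fC.
have [S hS] : exists S, has_sum (fun x => `|f x| + f x) S.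
  apply: (pos _ (2 * C)) => [x|l ul]; first by have := ler_norm (- f x); rewrite normrN; lra.
  apply: (@le_trans _ _ (\sum_(x <- l) 2 * `|f x|)).
    apply: ler_sum => x _; rewrite (le_trans (ler_normD _ _))// normr_id; lra.
  by rewrite -mulr_sumr ler_pM2l//; exact: fC.
have [S' hS'] : exists S, has_sum (fun x => `|f x|) S.
  apply: (pos _ C) => // l ul; under eq_bigr do rewrite normr_id; exact: fC.
exists (-1 * S' + S); rewrite (_ : f = fun x => -1 * `|f x| + (`|f x| + f x)).
  exact: has_sumL.
by apply/funext => x; ring.
Qed.

Lemma abs_bounded_tail f C : abs_bounded f C -> forall e, 0 < e -> exists2 l0, uniq l0 &
  forall l, uniq l -> {in l, forall x, x \notin l0} -> \sum_(x <- l) `|f x| <= e.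
Proof.
move=> fC e e0.
have fC' : abs_bounded (fun x => `|f x|) C.
  by move=> l ul; under eq_bigr do rewrite normr_id; exact: fC.
have [S hS] := abs_bounded_has_sum fC'.
have [l0 h0] := hS _ (divr_gt0 e0 (ltr0n _ 2)).
exists (undup l0); first exact: undup_uniq.
move=> l ul dis.
have u : uniq (undup l0 ++ l).
  rewrite cat_uniq undup_uniq ul andbT/=; apply/hasPn => x xl; exact: dis.
have a2 : `|\sum_(x <- undup l0 ++ l) `|f x| - S| <= e / 2.
  by apply: h0 => // x xl; rewrite mem_cat mem_undup xl.
have a1 : `|\sum_(x <- undup l0) `|f x| - S| <= e / 2.
  by apply: h0; [exact: undup_uniq|move=> x; rewrite mem_undup].
move: a1 a2; rewrite big_cat/=; set u1 := \sum_(x <- undup l0) _; set u2 := \sum_(x <- l) _.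
rewrite !ler_norml => /andP[? ?] /andP[? ?]; lra.
Qed.

Lemma cvg_bigsum (X I : Type) (F : set_system X) (FF : Filter F) (s : seq I) (f : I -> X -> R)
    (a : I -> R) : (forall p, f p h @[h --> F] --> a p) ->
  \sum_(p <- s) f p h @[h --> F] --> \sum_(p <- s) a p.
Proof.
move=> fa; elim: s => [|p s IH].
  under eq_fun do rewrite big_nil; rewrite big_nil; exact: cvg_cst.
by under eq_fun do rewrite big_cons; rewrite big_cons; apply: cvgD.
Qed.

(** Tannery's theorem: dominated convergence for unconditional sums. *)
Lemma has_sum_cvg (X : Type) (F : set_system X) (FF : ProperFilter F) (phi : T -> X -> R)
    (a : T -> R) (Phi : X -> R) (A C : R) (M : T -> R) :
  abs_bounded M C ->
  (forall s, phi s h @[h --> F] --> a s) ->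
  (\forall h \near F, forall s, `|phi s h| <= M s) ->
  (\forall h \near F, has_sum (phi^~ h) (Phi h)) ->
  has_sum a A -> Phi h @[h --> F] --> A.
Proof.
move=> MC pa pM pS hA.
have M0 s : 0 <= M s.
  have [h /(_ s)] := filter_ex pM; exact: le_trans.
have aM s : `|a s| <= M s.
  rewrite leNgt; apply/negP => lt.
  have d0 : 0 < `|a s| - M s by rewrite subr_gt0.
  have /cvgrPdist_lt/(_ _ d0) cl := pa s.
  have [h [/(_ s) h1 h2]] := filter_ex (filterI pM cl).
  have := ler_normD (a s - phi s h) (phi s h); rewrite subrK; lra.
apply/cvgrPdist_lt => e e0; have e8 := divr_gt0 e0 (ltr0n R 8).
have [l0 ul0 tail] := abs_bounded_tail MC e8.
have cf : \sum_(s <- l0) phi s h @[h --> F] --> \sum_(s <- l0) a s.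
  exact: cvg_bigsum.
have /cvgrPdist_lt/(_ _ e8) cl := cf.
apply: filterS (filterI (filterI pM pS) cl) => h [[hM hS] hd].
have [l1 h1] := hS _ e8; have [l2 h2] := hA _ e8.
pose rest := [seq x <- undup (l1 ++ l2) | x \notin l0].
have urest : uniq rest by rewrite filter_uniq// undup_uniq.
have drest : {in rest, forall x, x \notin l0} by move=> x; rewrite mem_filter => /andP[].
have ul : uniq (l0 ++ rest).
  by rewrite cat_uniq ul0 urest andbT/=; apply/hasPn => x; exact: drest.
have insub x : x \in l1 ++ l2 -> x \in l0 ++ rest.
  by move=> xl; rewrite mem_cat mem_filter mem_undup xl andbT orbN.
have b1 : `|\sum_(x <- l0 ++ rest) phi x h - Phi h| <= e / 8.
  by apply: h1 => // x xl; apply: insub; rewrite mem_cat xl.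
have b2 : `|\sum_(x <- l0 ++ rest) a x - A| <= e / 8.
  by apply: h2 => // x xl; apply: insub; rewrite mem_cat xl orbT.
have tl (f : T -> R) : (forall s, `|f s| <= M s) -> `|\sum_(x <- rest) f x| <= e / 8.
  move=> fM; apply: (le_trans (ler_norm_sum _ _ _)); apply: le_trans (tail _ urest drest).
  by apply: ler_sum => s _; rewrite (ger0_norm (M0 s)).
have b3 := tl _ hM; have b4 := tl _ aM.
move: b1 b2 b3 b4 hd; rewrite !big_cat/=.
move: (\sum_(_ <- _) _) (\sum_(_ <- _) _) (\sum_(_ <- _) _) (\sum_(_ <- _) _) => x y z w.
move: e0; clear; rewrite !ler_norml !ltr_norml => e0.
move=> /andP[? ?] /andP[? ?] /andP[? ?] /andP[? ?] /andP[? ?]; apply/andP; split; lra.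
Qed.

End Sums.

Definition word (K : nzRingType) (T : Type) N (b : T -> 'M[K]_N) (w : seq T) : 'M[K]_N :=
  foldr (fun m A => b m *m A) 1%:M w.

Lemma word_cons (K : nzRingType) (T : Type) N (b : T -> 'M[K]_N) m w :
  word b (m :: w) = b m *m word b w.
Proof. by []. Qed.

Section Words.
Variables (R : realType) (T : eqType).

(** The letters are weighted by a substochastic kernel [beta]; the weights [r]
    leave room for the block-triangular letters used for derivatives. *)
Definition contracting N (beta : T -> 'M[R]_N) (r : 'I_N -> R) (theta : R) :=
  [/\ 0 <= theta < 1, forall i, 0 < r i, forall m i j, 0 <= beta m i j &
      forall i l, uniq l -> \sum_(m <- l) \sum_j beta m i j * r j <= theta * r i].

Lemma word_ge0 N (beta : T -> 'M[R]_N) w i j : (forall m i j, 0 <= beta m i j) ->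
  0 <= word beta w i j.
Proof.
move=> b0; elim: w i => [|m w IH] i; first by rewrite mxE ler0n.
by rewrite word_cons mxE sumr_ge0// => k _; rewrite mulr_ge0.
Qed.

Lemma word_le N (b beta : T -> 'M[R]_N) w i j :
  (forall m i j, `|b m i j| <= beta m i j) -> `|word b w i j| <= word beta w i j.
Proof.
move=> bb; elim: w i => [|m w IH] i; first by rewrite mxE normr_nat.
rewrite !word_cons !mxE; apply: (le_trans (ler_norm_sum _ _ _)).
by apply: ler_sum => k _; rewrite normrM ler_pM.
Qed.

Fixpoint words_of (l : seq T) k : seq (seq T) :=
  if k is k'.+1 then [seq m :: w | m <- l, w <- words_of l k'] else [:: [::]].

Lemma mem_words_of l w : all (mem l) w -> w \in words_of l (size w).
Proof.
elim: w => [|m w IH] //= /andP[ml wl].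
by apply/allpairsP; exists (m, w); split => //; exact: IH.
Qed.

(** The words of length [k] are bounded by the [k]-th term of a geometric series. *)
Lemma words_of_sum N (beta : T -> 'M[R]_N) r theta l k i : contracting beta r theta -> uniq l ->
  \sum_(w <- words_of l k) \sum_j word beta w i j * r j <= theta ^+ k * r i.
Proof.
move=> [/andP[th0 th1] r0 b0 bt] ul; elim: k i => [|k IH] i.
  rewrite big_seq1 (bigD1 i)//= mxE eqxx mul1r big1 ?addr0 ?expr0 ?mul1r// => j ji.
  by rewrite mxE eq_sym (negbTE ji) mul0r.
rewrite big_allpairs_dep.
apply: (@le_trans _ _ (\sum_(m <- l) \sum_j beta m i j * (theta ^+ k * r j))).
  apply: ler_sum => m _.
  rewrite (eq_bigr (fun w => \sum_p beta m i p * \sum_j word beta w p j * r j)).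
    rewrite exchange_big/=; apply: ler_sum => p _; rewrite -mulr_sumr.
    by apply: ler_wpM2l => //; exact: IH.
  move=> w _; under eq_bigr do rewrite word_cons mxE mulr_suml.
  rewrite exchange_big/=; apply: eq_bigr => p _; rewrite mulr_sumr.
  by apply: eq_bigr => j _; rewrite mulrA.
rewrite exprS -mulrA mulrCA.
under eq_bigr do under eq_bigr do rewrite mulrCA.
under eq_bigr do rewrite -mulr_sumr.
by rewrite -mulr_sumr ler_wpM2l ?exprn_ge0//; exact: bt.
Qed.

Lemma geometric_sum_le (theta : R) n : 0 <= theta < 1 -> \sum_(k <- iota 0 n) theta ^+ k <= (1 - theta)^-1.
Proof.
move=> /andP[t0 t1]; have t1' : 0 < 1 - theta by rewrite subr_gt0.
rewrite -[leRHS]mul1r ler_pdivlMr//.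
suff -> : (\sum_(k <- iota 0 n) theta ^+ k) * (1 - theta) = 1 - theta ^+ n.
  by rewrite gerBl exprn_ge0.
rewrite -[n in iota 0 n]subn0 -/(index_iota 0 n) big_mkord.
by rewrite -[RHS]opprB subrX1 -mulNr opprB mulrC.
Qed.

Lemma word_sum_bound N (beta : T -> 'M[R]_N) r theta i (ws : seq (seq T)) :
  contracting beta r theta -> uniq ws ->
  \sum_(w <- ws) \sum_j word beta w i j * r j <= (1 - theta)^-1 * r i.
Proof.
move=> /[dup] C [th r0 b0 _] uws.
pose l := undup (flatten ws); pose L := (\max_(w <- ws) size w).+1.
have sub : {subset ws <= flatten [seq words_of l k | k <- iota 0 L]}.
  move=> w wws; apply/flatten_mapP; exists (size w).
    rewrite mem_iota/= add0n ltnS.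
    by apply: (@leq_bigmax_seq _ _ xpredT (fun w => size w)).
  apply: mem_words_of; apply/allP => m mw; rewrite /= mem_undup.
  by apply/flattenP; exists w.
apply: le_trans (sum_subseq _ uws sub) _.
  by move=> w; apply: sumr_ge0 => j _; rewrite mulr_ge0 ?word_ge0// ltW.
rewrite big_flatten big_map.
apply: (@le_trans _ _ (\sum_(k <- iota 0 L) theta ^+ k * r i)).
  by apply: ler_sum => k _; apply: words_of_sum => //; exact: undup_uniq.
by rewrite -mulr_suml ler_wpM2r ?(ltW (r0 i))//; exact: geometric_sum_le.
Qed.

Lemma word_abs_bounded N (beta : T -> 'M[R]_N) r theta i j :
  contracting beta r theta -> abs_bounded (fun w => word beta w i j) ((1 - theta)^-1 * r i / r j).
Proof.
move=> /[dup] C [th r0 b0 _] ws uws; rewrite ler_pdivlMr ?r0//.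
apply: le_trans (word_sum_bound i C uws).
rewrite mulr_suml; apply: ler_sum => w _; rewrite ger0_norm ?word_ge0//.
rewrite (bigD1 j)//= lerDl; apply: sumr_ge0 => k _.
by rewrite mulr_ge0 ?word_ge0// ltW.
Qed.

End Words.

Section TotalSum.
Variables (R : realType) (T : eqType).

(** The value is [0] for families that have no sum. *)
Definition tsum (f : T -> R) : R := xget 0 (has_sum f).

Lemma tsumE (f : T -> R) S : has_sum f S -> tsum f = S.
Proof.
by move=> h; apply: (has_sum_unique _ h); apply: (@xgetPex _ 0 (has_sum f)); exists S.
Qed.

Lemma abs_bounded_tsum (f : T -> R) C : abs_bounded f C -> has_sum f (tsum f).
Proof. by move=> /abs_bounded_has_sum[S hS]; rewrite (tsumE hS). Qed.

Lemma abs_bounded_le (f g : T -> R) C : (forall x, `|f x| <= `|g x|) ->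
  abs_bounded g C -> abs_bounded f C.
Proof.
by move=> fg gC l ul; apply: le_trans (gC l ul); exact: ler_sum.
Qed.

End TotalSum.

Section WordSmooth.
Variables (R : realType) (E : normedModType R) (T : eqType).
Implicit Types (D U : set E) (k : nat).

(** Families of functions whose iterated derivatives are, locally uniformly,
    absolutely summable over the index set. *)
Fixpoint CkS D k (b : T -> E -> R) : Prop :=
  [/\ forall x, D x -> exists M C, abs_bounded M C /\
        \forall y \near x, forall m, `|b m y| <= M m,
      forall m x, D x -> {for x, continuous (b m)} &
      if k is k'.+1 then
        forall v, (forall m x, D x -> derivable (b m) x v) /\
          CkS D k' (fun m x => 'D_v (b m) x)
      else True].

Lemma CkS_S D k b : CkS D k.+1 b -> CkS D k b.
Proof.
elim: k b => [|k IH] b; first by case.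
case=> s c d; split=> // v; have [dv Cv] := d v; split=> //; exact: IH.
Qed.

Lemma CkS_sub D U k b : U `<=` D -> CkS D k b -> CkS U k b.
Proof.
move=> UD; elim: k b => [|k IH] b [s c d]; split=> //.
- by move=> x /UD; exact: s.
- by move=> m x /UD; exact: c.
- by move=> x /UD; exact: s.
- by move=> m x /UD; exact: c.
- move=> v; have [dv Cv] := d v; split; last exact: IH.
  by move=> m x /UD; exact: dv.
Qed.

Lemma CkS0 D k : CkS D k (fun _ _ => 0).
Proof.
have s x : D x -> exists M C, abs_bounded (M : T -> R) C /\
    \forall y \near x, forall m, `|0 : R| <= M m.
  move=> _; exists (fun=> 0), 0; split; last by near=> y => m; rewrite normr0.
  by move=> l _; rewrite big1// => i _; rewrite normr0.
elim: k => [|k IH]; first by split=> // m x _; exact: cvg_cst.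
split=> // [m x _|v]; first exact: cvg_cst.
split; first by move=> m x _; exact: derivable_cst.
by rewrite (_ : (fun _ => _) = fun _ _ => 0)//; apply/funext => m; apply/funext => x; rewrite derive_cst.
Unshelve. all: by end_near. Qed.

Lemma CkS_cont D k b m x : CkS D k b -> D x -> {for x, continuous (b m)}.
Proof. by case: k => [|k] [_ c _]; exact: c. Qed.

Lemma CkS_bound D k b x : CkS D k b -> D x -> exists M C, abs_bounded M C /\
  \forall y \near x, forall m, `|b m y| <= M m.
Proof. by case: k => [|k] [s _ _]; exact: s. Qed.

Lemma word_cont N (b : T -> E -> 'M[R]_N) x w i j :
  (forall m i j, {for x, continuous (fun y => b m y i j)}) ->
  {for x, continuous (fun y => word (b^~ y) w i j)}.
Proof.
move=> bc; elim: w i => [|m w IH] i; first exact: cvg_cst.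
rewrite /prop_for /continuous_at.
under eq_fun do rewrite word_cons mxE; rewrite word_cons mxE.
apply: cvg_bigsum => p; apply: cvgM; [exact: bc|exact: IH].
Qed.

Section Derivative.
Variables (N : nat) (b : T -> E -> 'M[R]_N) (v : E).

Definition Dmx m x : 'M[R]_N := \matrix_(i, j) 'D_v (fun y => b m y i j) x.

(** Dual-number letters: the upper right block of a word in them is the
    derivative of the word, by the product rule. *)
Definition dualmx m x : 'M[R]_(N + N) := block_mx (b m x) (Dmx m x) 0 (b m x).

Lemma word_dual x w : exists A, word (dualmx^~ x) w =
  block_mx (word (b^~ x) w) A 0 (word (b^~ x) w).
Proof.
elim: w => [|m w [A IH]]; first by exists 0; exact: scalar_mx_block.
exists (b m x *m A + Dmx m x *m word (b^~ x) w).
rewrite word_cons IH mulmx_block !word_cons.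
by rewrite !mulmx0 !mul0mx !addr0 !add0r.
Qed.

Lemma is_derive_word x w i j : (forall m i j, derivable (fun y => b m y i j) x v) ->
  is_derive x v (fun y => word (b^~ y) w i j)
    (word (dualmx^~ x) w (lshift N i) (rshift N j)).
Proof.
move=> bd; elim: w i => [|m w IH] i.
  rewrite /= [X in is_derive _ _ _ X]mxE eq_lrshift.
  exact: is_derive_cst.
have [A wA] := word_dual x w.
rewrite word_cons wA mulmx_block block_mxEur.
have AE p : A p j = word (dualmx^~ x) w (lshift N p) (rshift N j) by rewrite wA block_mxEur.
rewrite !mxE -big_split/=.
rewrite (_ : (fun y => _) = fun y => \sum_p b m y i p * word (b^~ y) w p j); last first.
  by apply/funext => y; rewrite mxE.
elim: (index_enum _) => [|p s IHs].
  by under eq_fun do rewrite big_nil; rewrite big_nil; exact: is_derive_cst.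
under eq_fun do rewrite big_cons; rewrite big_cons.
apply: is_deriveD => //.
have h1 : is_derive x v (fun y => b m y i p) (Dmx m x i p).
  by rewrite mxE; apply: derivableP; exact: bd.
have h2 := IH p; rewrite -AE in h2.
apply: (is_derive_eq (is_deriveM h1 h2)).
by rewrite /GRing.scale/= [word _ _ _ _ * _]mulrC.
Qed.

End Derivative.

Lemma is_derive_line (f : E -> R) (x v : E) (t : R) : derivable f (t *: v + x) v ->
  is_derive t (1 : R) (fun t : R => f (t *: v + x)) ('D_v f (t *: v + x)).
Proof.
have AL (y u s : R) : (s *: u + y) *: v + x = s *: (u *: v) + (y *: v + x).
  by rewrite scalerDl scalerA addrA.
move=> d; apply: DeriveDef.
  have := @derivable_comp_affine _ _ _ (fun t : R => t *: v + x) ( *:%R^~ v) AL f t 1.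
  by rewrite scale1r; apply.
have := @derive_comp_affine _ _ _ (fun t : R => t *: v + x) ( *:%R^~ v) AL f t 1.
by rewrite scale1r.
Qed.

Lemma line_MVT (g dg : R -> R) (h M : R) :
  (forall t, `|t| <= `|h| -> is_derive t (1 : R) g (dg t) /\ `|dg t| <= M) ->
  `|g h - g 0| <= M * `|h|.
Proof.
move=> H.
have gen (a c : R) : a <= c -> (forall t, a <= t <= c -> `|t| <= `|h|) -> `|g c - g a| <= M * (c - a).
  move=> ac sub.
  have [t tac ->] : exists2 t, t \in `[a, c]%R & g c - g a = dg t * (c - a).
    apply: MVT_segment => //.
      move=> t; rewrite in_itv/= => /andP[t1 t2]; apply: (H t _).1; apply: sub.
      by rewrite !ltW.
    apply: derivable_within_continuous => t; rewrite in_itv/= => tac.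
    by have [[]] := H t (sub t tac).
  rewrite normrM (ger0_norm (_ : 0 <= c - a)) ?subr_ge0// ler_wpM2r ?subr_ge0//.
  by apply: (H t _).2; apply: sub; move: tac; rewrite in_itv.
have [h0|h0] := leP 0 h.
  rewrite (ger0_norm h0) -[X in M * X]subr0; apply: gen => // t /andP[t0 th].
  by rewrite !ger0_norm.
rewrite distrC (ltr0_norm h0) -[X in M * X]add0r; apply: gen; first exact: ltW.
move=> t /andP[ht t0]; rewrite (ltr0_norm h0) ler0_norm// lerN2//.
Qed.

Definition wsum N (P : pred (seq T)) (b : T -> E -> 'M[R]_N) i j (x : E) : R :=
  tsum (fun w => (P w)%:R * word (b^~ x) w i j).

Section WordSum.
Variables (N : nat) (b : T -> E -> 'M[R]_N) (D : set E) (beta : T -> 'M[R]_N).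
Variables (r : 'I_N -> R) (theta : R) (P : pred (seq T)).
Hypothesis oD : open D.
Hypothesis ctr : contracting beta r theta.
Hypothesis bb : forall m x i j, D x -> `|b m x i j| <= beta m i j.

Let P_le w a c (y : R) : `|y| <= word beta w a c -> `|(P w)%:R * y| <= word beta w a c.
Proof.
have [_ _ b0 _] := ctr; move=> h; rewrite normrM.
by case: (P w); rewrite ?normr1 ?mul1r// normr0 mul0r word_ge0.
Qed.

Lemma wsum_has_sum x i j : D x ->
  has_sum (fun w => (P w)%:R * word (b^~ x) w i j) (wsum P b i j x).
Proof.
move=> Dx; apply: abs_bounded_tsum; apply: abs_bounded_le (word_abs_bounded i j ctr) => w.
have [_ _ b0 _] := ctr; rewrite [leRHS]ger0_norm ?word_ge0//.
by apply: P_le; apply: word_le => *; exact: bb.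
Qed.

Lemma wsum_cont x i j : (forall m i j, {for x, continuous (fun y => b m y i j)}) -> D x ->
  {for x, continuous (wsum P b i j)}.
Proof.
move=> bc Dx; have nD := near_open oD Dx.
rewrite /prop_for /continuous_at.
apply: (has_sum_cvg (phi := fun w y => (P w)%:R * word (b^~ y) w i j) _ (word_abs_bounded i j ctr) _ _ _ (wsum_has_sum i j Dx)).
- by move=> w; apply: cvgM; [exact: cvg_cst|exact: word_cont].
- apply: filterS nD => y Dy w; apply: P_le; apply: word_le => *; exact: bb.
- by apply: filterS nD => y Dy; exact: wsum_has_sum.
Qed.

End WordSum.

(** The difference quotients of the words are dominated by the summable words in
    [beta], by the mean value theorem, so the sum may be differentiated term by
    term. *)
Lemma wsum_derive N (b : T -> E -> 'M[R]_N) v D (beta : T -> 'M[R]_(N + N)) r theta P x i j :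
  open D -> D x -> contracting beta r theta ->
  (forall m y i j, D y -> `|dualmx b v m y i j| <= beta m i j) ->
  (forall m y i j, D y -> derivable (fun y => b m y i j) y v) ->
  is_derive x v (wsum P b i j) (wsum P (dualmx b v) (lshift N i) (rshift N j) x).
Proof.
move=> oD Dx ctr bb bd.
have [_ _ beta0 _] := ctr.
have hs y : D y -> has_sum (fun w => (P w)%:R * word (b^~ y) w i j) (wsum P b i j y).
  move=> Dy; have := wsum_has_sum P ctr bb (lshift N i) (lshift N j) Dy.
  rewrite (_ : wsum P _ _ _ _ = wsum P b i j y).
    apply: eq_has_sum => w; have [A ->] := word_dual b v y w.
    by rewrite block_mxEul.
  congr tsum; apply/funext => w; have [A ->] := word_dual b v y w.
  by rewrite block_mxEul.
have cA : {for (0 : R), continuous (fun h : R => h *: v + x)}.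
  by apply: cvgD; [apply: cvgZr_tmp; exact: cvg_id|exact: cvg_cst].
have : \forall h \near (0 : R), D (h *: v + x).
  by apply: cA; rewrite scale0r add0r; exact: near_open.
move=> /nbhs_ballP[d /= d0 hd].
have Dh t : `|t| < d -> D (t *: v + x).
  by move=> td; apply: hd; rewrite /ball/= sub0r normrN.
have lim : h^-1 *: (wsum P b i j (h *: v + x) - wsum P b i j x) @[h --> 0^'] -->
    wsum P (dualmx b v) (lshift N i) (rshift N j) x.
  pose B w := word beta w (lshift N i) (rshift N j).
  have nd : \forall h \near (0 : R)^', `|h| < d.
    by apply: (@dnbhs0_lt _ _ d).
  have nz : \forall h \near (0 : R)^', h != 0 by exact: nbhs_dnbhs_neq.
  apply: (@has_sum_cvg R _ R (0 : R)^' _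
    (fun w h => h^-1 * ((P w)%:R * word (b^~ (h *: v + x)) w i j - (P w)%:R * word (b^~ x) w i j))
    _ _ _ _ _ (word_abs_bounded (lshift N i) (rshift N j) ctr) _ _ _
    (wsum_has_sum P ctr bb (lshift N i) (rshift N j) Dx)).
  - move=> w.
    have [dw <-] := is_derive_word w i j (fun m a c => bd m x a c Dx).
    under eq_fun do rewrite -mulrBr mulrCA.
    by apply: cvgM; [exact: cvg_cst|exact: dw].
  - apply: filterS (filterI nd nz) => h [hlt h0] w.
    rewrite -mulrBr mulrCA normrM.
    suff q : `|h^-1 * (word (b^~ (h *: v + x)) w i j - word (b^~ x) w i j)| <= B w.
      by case: (P w); rewrite ?normr1 ?mul1r// normr0 mul0r word_ge0.
    rewrite normrM normfV mulrC ler_pdivrMr ?normr_gt0//.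
    have := @line_MVT (fun t => word (b^~ (t *: v + x)) w i j)
      (fun t => word (dualmx b v ^~ (t *: v + x)) w (lshift N i) (rshift N j)) h (B w).
    rewrite scale0r add0r; apply => t th; have Dt := Dh t (le_lt_trans th hlt); split.
      have [dw <-] := is_derive_word w i j (fun m a c => bd m _ a c Dt).
      exact: (@is_derive_line (fun y => word (b^~ y) w i j)).
    by apply: word_le => m a c; exact: bb.
  - apply: filterS nd => h hlt.
    have := has_sumZ h^-1 (has_sumL (-1) (hs x Dx) (hs _ (Dh h hlt))).
    rewrite (_ : h^-1 *: _ = h^-1 * (-1 * wsum P b i j x + wsum P b i j (h *: v + x))).
      by apply: eq_has_sum => w; rewrite mulN1r addrC.
    by rewrite mulN1r addrC.
apply: DeriveDef; last exact: cvg_lim.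
by apply/cvg_ex; exists (wsum P (dualmx b v) (lshift N i) (rshift N j) x).
Qed.

(** Giving the weight [eps * r] to the second copy of the indices scales the upper
    right block by [eps], which is chosen to use half of the room left by
    [theta < 1]. *)
Lemma dual_contracting N (beta : T -> 'M[R]_N) r theta (M : 'I_N * 'I_N -> T -> R) C :
  contracting beta r theta -> (forall a, abs_bounded (M a) (C a)) ->
  exists r2 theta2, contracting (fun m => block_mx (beta m) (\matrix_(i, j) `|M (i, j) m|) 0 (beta m))
     r2 theta2.
Proof.
move=> [/andP[th0 th1] r0 b0 bt] MC.
have C0 a : 0 <= C a by exact: abs_bounded_ge0 (MC a).
(* K bounds the weighted row sums of the off-diagonal block, for all rows at once. *)
pose K := 1 + \sum_i \sum_j C (i, j) * r j / r i.
have K0 : 0 < K.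
  rewrite ltr_pwDl// sumr_ge0// => i _; apply: sumr_ge0 => j _.
  by rewrite divr_ge0 ?mulr_ge0 ?(ltW (r0 _)).
pose eps := (1 - theta) / 2 / K.
have e0 : 0 < eps by rewrite divr_gt0// divr_gt0// subr_gt0.
exists (fun i => match fintype.split i with inl a => r a | inr a => eps * r a end), ((1 + theta) / 2).
split.
- by apply/andP; split; lra.
- by move=> i; case: (fintype.split i) => a //; rewrite mulr_gt0.
- move=> m i j; rewrite -(fintype.splitK i) -(fintype.splitK j); case: (fintype.split i) => a; case: (fintype.split j) => c /=.
  + by rewrite block_mxEul.
  + by rewrite block_mxEur mxE.
  + by rewrite block_mxEdl mxE.
  + by rewrite block_mxEdr.
- move=> i l ul.
  under eq_bigr do rewrite big_split_ord/=.
  rewrite -(fintype.splitK i); case: (fintype.split i) => a /=.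
    under eq_bigr do (under eq_bigr do rewrite block_mxEul (unsplitK (inl _));
      under [X in _ + X]eq_bigr do rewrite block_mxEur (unsplitK (inr _)) mxE).
    rewrite big_split/= (unsplitK (inl _)).
    have h1 := bt a l ul.
    have h2 : \sum_(m <- l) \sum_j `|M (a, j) m| * (eps * r j) <= eps * (K * r a).
      rewrite exchange_big/=.
      apply: (@le_trans _ _ (\sum_j C (a, j) * (eps * r j))).
        apply: ler_sum => j _; rewrite -mulr_suml ler_wpM2r//; last exact: MC.
        by rewrite mulr_ge0// ltW.
      have -> : \sum_j C (a, j) * (eps * r j) = eps * ((\sum_j C (a, j) * r j / r a) * r a).
        rewrite mulr_suml mulr_sumr; apply: eq_bigr => j _.
        by rewrite divfK ?gt_eqF ?r0// mulrCA.
      rewrite ler_pM2l// ler_pM2r ?r0// /K [X in _ <= _ + X](bigD1 a)//= addrCA lerDl addr_ge0//.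
      apply: sumr_ge0 => i' _; apply: sumr_ge0 => j _.
      by rewrite divr_ge0 ?mulr_ge0 ?(ltW (r0 _)).
    apply: (le_trans (lerD h1 h2)).
    rewrite mulrA /eps divfK ?gt_eqF// -mulrDl ler_pM2r ?r0//; lra.
  under eq_bigr do (under eq_bigr do rewrite block_mxEdl mxE mul0r;
    under [X in _ + X]eq_bigr do rewrite block_mxEdr (unsplitK (inr _)) mulrCA).
  under eq_bigr do rewrite big1 ?add0r// -mulr_sumr.
  rewrite -mulr_sumr (unsplitK (inr _)) mulrCA ler_pM2l//.
  apply: (le_trans (bt a l ul)); rewrite ler_pM2r ?r0//; lra.
Qed.

(** By [wsum_derive], a derivative of a sum of words is an entry of a sum of words
    in the dual-number letters, locally contracting by [dual_contracting]. *)
Lemma wsum_Ck k : forall N (b : T -> E -> 'M[R]_N) D beta r theta, open D ->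
  contracting beta r theta ->
  (forall m x i j, D x -> `|b m x i j| <= beta m i j) ->
  (forall i j, CkS D k (fun m x => b m x i j)) ->
  forall P i j, Ck_on D k (wsum P b i j).
Proof.
elim: k => [|k IH] N b D beta r theta oD ctr bb bC P i j.
  split=> // x Dx; apply: (@wsum_cont _ _ _ _ _ _ P oD ctr bb) => // m a c.
  exact: (@CkS_cont _ _ _ m x (bC a c) Dx).
split=> [x Dx|v].
  by apply: (@wsum_cont _ _ _ _ _ _ P oD ctr bb) => // m a c; exact: (@CkS_cont _ _ _ m x (bC a c) Dx).
have bd a c : (forall m x, D x -> derivable (fun y => b m y a c) x v) /\
    CkS D k (fun m x => 'D_v (fun y => b m y a c) x).
  by have [_ _ /(_ v)] := bC a c.
(* The bounds for the derivatives of the letters are local, so the contraction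
   constants of the dual letters depend on the point. *)
have loc x : D x -> exists U, [/\ open U, U x, U `<=` D &
    exists r2 theta2 beta2, contracting beta2 r2 theta2 /\
      forall m y i j, U y -> `|dualmx b v m y i j| <= beta2 m i j].
  move=> Dx.
  have /choice[M /= /choice[C MC]] : forall a : 'I_N * 'I_N, exists M C, abs_bounded (M : T -> R) C /\
      \forall y \near x, forall m, `|'D_v (fun z => b m z a.1 a.2) y| <= M m.
    by move=> a; exact: CkS_bound (bd a.1 a.2).2 Dx.
  have nM : \forall y \near x, forall a m, `|'D_v (fun z => b m z a.1 a.2) y| <= M a m.
    by apply: filter_forall => a; exact: (MC a).2.
  have [r2 [theta2 ctr2]] := dual_contracting ctr (fun a => (MC a).1).
  exists (D `&` [set y | forall a m, `|'D_v (fun z => b m z a.1 a.2) y| <= M a m]^°); split.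
  - by apply: openI => //; exact: open_interior.
  - by split.
  - by move=> y [].
  - exists r2, theta2, (fun m => block_mx (beta m) (\matrix_(i, j) `|M (i, j) m|) 0 (beta m)).
    split; first exact: ctr2.
    move=> m y a c [Dy /interior_subset/= My]; have [_ _ b0 _] := ctr.
    rewrite -(fintype.splitK a) -(fintype.splitK c); case: (fintype.split a) => p; case: (fintype.split c) => q /=.
    + by rewrite /dualmx !block_mxEul; exact: bb.
    + rewrite /dualmx !block_mxEur !mxE; apply: le_trans (My (p, q) m) _; exact: ler_norm.
    + by rewrite /dualmx !block_mxEdl !mxE normr0.
    + by rewrite /dualmx !block_mxEdr; exact: bb.
have der x U r2 theta2 beta2 : open U -> U x -> U `<=` D -> contracting beta2 r2 theta2 ->
    (forall m y i j, U y -> `|dualmx b v m y i j| <= beta2 m i j) ->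
    is_derive x v (wsum P b i j) (wsum P (dualmx b v) (lshift N i) (rshift N j) x).
  move=> oU Ux UD ctr2 bb2; apply: (wsum_derive P i j oU Ux ctr2 bb2) => m y a c /UD Dy.
  exact: (bd a c).1.
split=> [x Dx|].
  have [U [oU Ux UD [r2 [theta2 [beta2 [ctr2 bb2]]]]]] := loc x Dx.
  by have [] := der x U r2 theta2 beta2 oU Ux UD ctr2 bb2.
apply: Ck_on_local => x Dx.
have [U [oU Ux UD [r2 [theta2 [beta2 [ctr2 bb2]]]]]] := loc x Dx.
exists U => //.
have C : Ck_on U k (wsum P (dualmx b v) (lshift N i) (rshift N j)).
  apply: (IH _ _ _ _ _ _ oU ctr2 bb2) => a c.
  rewrite -(fintype.splitK a) -(fintype.splitK c); case: (fintype.split a) => p; case: (fintype.split c) => q /=.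
  - rewrite (_ : (fun _ => _) = fun m y => b m y p q).
      by apply: CkS_sub UD _; apply: CkS_S; exact: bC.
    by apply/funext => m; apply/funext => y; rewrite /dualmx block_mxEul.
  - rewrite (_ : (fun _ => _) = fun m y => 'D_v (fun z => b m z p q) y).
      by apply: CkS_sub UD _; exact: (bd p q).2.
    by apply/funext => m; apply/funext => y; rewrite /dualmx block_mxEur mxE.
  - rewrite (_ : (fun _ => _) = fun _ _ => 0); first exact: CkS0.
    by apply/funext => m; apply/funext => y; rewrite /dualmx block_mxEdl mxE.
  - rewrite (_ : (fun _ => _) = fun m y => b m y p q).
      by apply: CkS_sub UD _; apply: CkS_S; exact: bC.
    by apply/funext => m; apply/funext => y; rewrite /dualmx block_mxEdr.
apply: (eq_Ck_on oU _ C) => y; rewrite inE => Uy.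
by have [_ ->] := der y U r2 theta2 beta2 oU Uy UD ctr2 bb2.
Qed.

End WordSmooth.

(** * Averages along the circle variable *)

Section Averages.
Variable R : realType.
Local Notation E := (R * R * R)%type.
Local Notation mu := (@arc_measure R).
Implicit Types (G : E -> R) (D : set E) (q v : E).

(** Points of [E] are coordinates [(t, x, y)]: an angle, and the real and imaginary
    parts of a coordinate on the surface. *)
Definition e1 : E := (1, 0, 0).

Lemma e1E (s : R) q : s *: e1 + q = (s + q.1.1, q.1.2, q.2).
Proof.
case: q => [[t x] y]; rewrite /e1 /=.
transitivity (s * 1 + t, s * 0 + x, s * 0 + y) => //.
by rewrite mulr1 !mulr0 !add0r.
Qed.

Lemma line_cont q : continuous (fun s : R => s *: e1 + q).
Proof. by move=> s; apply: cvgD; [apply: cvgZr_tmp; exact: cvg_id|exact: cvg_cst]. Qed.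

Lemma comp_cont (X : topologicalType) (f : X -> E) G (x : X) : {for x, continuous f} ->
  {for f x, continuous G} -> {for x, continuous (fun z => G (f z))}.
Proof. by move=> fc gc; exact: (@continuous_comp _ _ _ f G). Qed.

(** Compactness of the arc makes continuity at its points uniform. *)
Lemma circle_tube G q : (forall s, {for s *: e1 + q, continuous G}) ->
  forall e, 0 < e -> \forall p \near q, forall s, 0 <= s <= 2 * pi ->
    `|G (s *: e1 + p) - G (s *: e1 + q)| <= e.
Proof.
move=> Gc e e0.
have /compact_near_coveringP cov := @segment_compact R 0 (2 * pi).
have := cov E (nbhs q) (fun p s => `|G (s *: e1 + p) - G (s *: e1 + q)| <= e) _ _.
move=> /(_ _) h; apply: filterS (h _) => [p hp s s01|s _].
  by apply: hp; rewrite /= in_itv.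
have c2 : {for (s, q), continuous (fun z : R * E => G (z.1 *: e1 + z.2))}.
  apply: (@comp_cont _ (fun z : R * E => z.1 *: e1 + z.2)); last exact: Gc.
  by apply: cvgD; [apply: cvgZr_tmp; exact: cvg_fst|exact: cvg_snd].
have c1 : {for (s, q), continuous (fun z : R * E => G (z.1 *: e1 + q))}.
  apply: (@comp_cont _ (fun z : R * E => z.1 *: e1 + q)); last exact: Gc.
  by apply: cvgD; [apply: cvgZr_tmp; exact: cvg_fst|exact: cvg_cst].
have c3 : G (z.1 *: e1 + z.2) - G (z.1 *: e1 + q) @[z --> (s, q)] --> (0 : R).
  by rewrite -(subrr (G (s *: e1 + q))); exact: cvgB c2 c1.
have /cvgrPdist_le/(_ _ e0) := c3.
by apply: filterS => z; rewrite sub0r normrN.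
Qed.

Definition arcint (w : R -> R) G q : R := Rintegral mu setT (fun s => w s * G (s *: e1 + q)).

Section Kernel.
Variables (w : R -> R) (W : R).
Hypothesis wc : continuous w.
Hypothesis wW : forall s, `|w s| <= W.

Lemma arcint_eps (e : R) : 0 < e -> 2 * pi * W * (e / (2 * pi * (W + 1))) <= e.
Proof.
have W0 : 0 <= W by exact: le_trans (normr_ge0 _) (wW 0).
move=> e0; have p0 := pi_gt0 R; have -> : 2 * pi * W * (e / (2 * pi * (W + 1))) = e * (W / (W + 1)).
  have W1 : W + 1 != 0 by rewrite gt_eqF// ltr_wpDl.
  have pn : pi != 0 :> R by rewrite gt_eqF.
  by move: (pi : R) pn => x xn; field; rewrite W1 xn.
by apply: ler_piMr; [exact: ltW|rewrite ler_pdivrMr ?ltr_wpDl// mul1r lerDl].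
Qed.

Lemma arcint_integrable G q : (forall s, {for s *: e1 + q, continuous G}) ->
  mu.-integrable setT (EFin \o (fun s => w s * G (s *: e1 + q))).
Proof.
move=> Gc; apply/Lfun1_integrable.
have C : continuous (fun s => w s * G (s *: e1 + q)).
  move=> s; apply: cvgM; first exact: wc.
  by have := comp_cont (@line_cont q s) (Gc s).
have mC := continuous_measurable_fun C.
have ab : 0 <= 2 * pi :> R by rewrite ltW// twopi_gt0.
have cn : {within `[0, 2 * pi], continuous (fun t => `|w t * G (t *: e1 + q)|)}.
  by apply: continuous_subspaceT => t; apply: cvg_norm; exact: C.
have [c _ hc] := EVT_max ab cn.
apply/Lfun1_integrable/integrableP; split; first exact/measurable_EFinP.
rewrite integral_mrestr; last by apply: measurableT_comp => //; exact/measurable_EFinP.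
have /integrableP[_] := @continuous_compact_integrable R (fun s => w s * G (s *: e1 + q)) `[0, 2 * pi]
   (@segment_compact R 0 (2 * pi)) (continuous_subspaceT C).
by [].
Qed.

Lemma arcint_le G q C : (forall s, {for s *: e1 + q, continuous G}) -> 0 <= C ->
  (forall s, 0 <= s <= 2 * pi -> `|G (s *: e1 + q)| <= C) ->
  `|arcint w G q| <= 2 * pi * W * C.
Proof.
move=> Gc C0 GC; have int := arcint_integrable Gc.
have W0 : 0 <= W by exact: le_trans (normr_ge0 _) (wW 0).
have E0 : Rintegral mu setT (fun=> W * C) = 2 * pi * W * C.
  rewrite Rintegral_cst//.
  transitivity (W * C * (2 * pi)); last by ring.
  by congr (_ * _); exact: (congr1 fine (@arc_measureT R)).
apply: (le_trans (le_normr_Rintegral measurableT int)); rewrite -E0.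
have inorm : mu.-integrable setT (EFin \o (fun s => `|w s * G (s *: e1 + q)|)).
  by have := integrable_norm int.
rewrite /Rintegral; apply: fine_le.
- exact: integrable_fin_num inorm.
- by apply: integrable_fin_num => //; apply: (@arc_integrable_bounded _ _ `|W * C|).
rewrite (_ : (\int[mu]_x (W * C)%:E = \int[mu]_(x in setT) (W * C)%:E)%E)//.
apply: ae_ge0_le_integral => //.
- by case/integrableP : inorm.
- by move=> x _; rewrite lee_fin mulr_ge0.
- apply: arc_aeS (@ae_arc R) => s s01 _; rewrite lee_fin normrM.
  by apply: ler_pM => //; exact: GC.
Qed.

Lemma arcint_cont D G q : (forall s p, D p -> D (s *: e1 + p)) -> open D ->
  (forall p, D p -> {for p, continuous G}) -> D q -> {for q, continuous (arcint w G)}.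
Proof.
move=> Dinv oD Gc Dq; have Gc' p : D p -> forall s, {for s *: e1 + p, continuous G}.
  by move=> Dp s; apply: Gc; exact: Dinv.
have W0 : 0 <= W by exact: le_trans (normr_ge0 _) (wW 0).
apply/cvgrPdist_le => e e0.
have K0 : 0 < 2 * pi * (W + 1) by rewrite mulr_gt0 ?twopi_gt0// ltr_wpDl.
have d0 : 0 < e / (2 * pi * (W + 1)) by rewrite divr_gt0.
have tube := circle_tube (Gc' q Dq) d0.
apply: filterS (filterI (near_open oD Dq) tube) => p [Dp hp].
rewrite distrC /arcint -RintegralB//; [|exact/arcint_integrable/Gc'..].
under eq_Rintegral do rewrite -mulrBr.
have cB s : {for s *: e1 + p, continuous (fun z => G z - G (z - p + q))}.
  have eq : s *: e1 + p - p + q = s *: e1 + q by rewrite addrK.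
  apply: cvgB; first exact: Gc'.
  have fc : {for s *: e1 + p, continuous (fun z : E => z - p + q)}.
    by apply: cvgD; [apply: cvgB; [exact: cvg_id|exact: cvg_cst]|exact: cvg_cst].
  by have := comp_cont fc; apply; rewrite eq; exact: Gc'.
have := @arcint_le (fun z => G z - G (z - p + q)) p _ cB (ltW d0).
rewrite /arcint; under eq_Rintegral do rewrite addrK.
move=> h; have hp' s : 0 <= s <= 2 * pi ->
    `|G (s *: e1 + p) - G (s *: e1 + p - p + q)| <= e / (2 * pi * (W + 1)).
  by move=> s01; rewrite addrK; exact: hp.
apply: (le_trans (h hp')).
exact: arcint_eps.
Qed.

(** Differentiation under the integral sign: the mean value theorem bounds the error
    of the difference quotient by the oscillation of the derivative. *)
Lemma arcint_derive D G v q : (forall s p, D p -> D (s *: e1 + p)) -> open D ->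
  (forall p, D p -> {for p, continuous G}) ->
  (forall p, D p -> derivable G p v) -> (forall p, D p -> {for p, continuous ('D_v G)}) -> D q ->
  is_derive q v (arcint w G) (arcint w ('D_v G) q).
Proof.
move=> Dinv oD Gc Gd dGc Dq.
have Gc' p : D p -> forall s, {for s *: e1 + p, continuous G}.
  by move=> Dp s; apply: Gc; exact: Dinv.
have dGc' p : D p -> forall s, {for s *: e1 + p, continuous ('D_v G)}.
  by move=> Dp s; apply: dGc; exact: Dinv.
have W0 : 0 <= W by exact: le_trans (normr_ge0 _) (wW 0).
have lim : h^-1 *: (arcint w G (h *: v + q) - arcint w G q) @[h --> 0^'] --> arcint w ('D_v G) q.
  apply/cvgrPdist_le => e e0.
  have K0 : 0 < 2 * pi * (W + 1) by rewrite mulr_gt0 ?twopi_gt0// ltr_wpDl.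
  have d0 : 0 < e / (2 * pi * (W + 1)) by rewrite divr_gt0.
  have tube := circle_tube (dGc' q Dq) d0.
  have cA : {for (0 : R), continuous (fun h : R => h *: v + q)}.
    by apply: cvgD; [apply: cvgZr_tmp; exact: cvg_id|exact: cvg_cst].
  pose S : set E := [set p | D p /\ forall s, 0 <= s <= 2 * pi ->
      `|'D_v G (s *: e1 + p) - 'D_v G (s *: e1 + q)| <= e / (2 * pi * (W + 1))].
  have nS : \forall p \near q, S p by exact: filterI (near_open oD Dq) tube.
  have : \forall h \near (0 : R), S (h *: v + q).
    by apply: (cA S); rewrite scale0r add0r.
  move=> /nbhs_ballP[d /= dp hd].
  have Dh t : `|t| < d -> D (t *: v + q) /\ forall s, 0 <= s <= 2 * pi ->
      `|'D_v G (s *: e1 + (t *: v + q)) - 'D_v G (s *: e1 + q)| <= e / (2 * pi * (W + 1)).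
    by move=> td; apply: hd; rewrite /ball/= sub0r normrN.
  have nd : \forall h \near (0 : R)^', `|h| < d by apply: (@dnbhs0_lt _ _ d).
  have nz : \forall h \near (0 : R)^', h != 0 by exact: nbhs_dnbhs_neq.
  apply: filterS (filterI nd nz) => h [hlt h0].
  have [Dhq _] := Dh h hlt.
  (* H is the error of the difference quotient; it is bounded on the whole circle by
     the oscillation of the derivative between q and h *: v + q. *)
  pose H z := 'D_v G z - h^-1 * (G (h *: v + z) - G z).
  have Hc s : {for s *: e1 + q, continuous H}.
    apply: cvgB; first exact: dGc'.
    apply: cvgM; first exact: cvg_cst.
    apply: cvgB; last exact: Gc'.
    have fc : {for s *: e1 + q, continuous (fun z : E => h *: v + z)}.
      by apply: cvgD; [exact: cvg_cst|exact: cvg_id].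
    by have := comp_cont fc; apply; rewrite addrCA; exact: Gc'.
  have -> : arcint w ('D_v G) q - h^-1 *: (arcint w G (h *: v + q) - arcint w G q) = arcint w H q.
    have i1 := arcint_integrable (dGc' q Dq); have i2 := arcint_integrable (Gc' q Dq).
    have i3 := arcint_integrable (Gc' _ Dhq).
    rewrite (_ : h^-1 *: (arcint w G (h *: v + q) - arcint w G q) = Rintegral mu setT
        (fun s => h^-1 * (w s * G (s *: e1 + (h *: v + q)) - w s * G (s *: e1 + q)))); last first.
      by rewrite RintegralZl ?RintegralB//; exact: rintB.
    rewrite /arcint.
    rewrite -RintegralB//; last by apply: rintZ; exact: rintB.
    by apply: eq_Rintegral => s _; rewrite /H (addrCA (h *: v)); ring.
  apply: (le_trans (arcint_le Hc (ltW d0) _)).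
    move=> s s01; rewrite /H.
    pose g (t : R) := h^-1 * (G (t *: v + (s *: e1 + q)) - t * 'D_v G (s *: e1 + q)).
    have := @line_MVT R g (fun t => h^-1 * ('D_v G (t *: v + (s *: e1 + q)) - 'D_v G (s *: e1 + q))) h
      (e / (2 * pi * (W + 1)) / `|h|).
    rewrite /g scale0r add0r mul0r subr0.
    have -> : h^-1 * (G (h *: v + (s *: e1 + q)) - h * 'D_v G (s *: e1 + q)) - h^-1 * G (s *: e1 + q)
      = - ('D_v G (s *: e1 + q) - h^-1 * (G (h *: v + (s *: e1 + q)) - G (s *: e1 + q))).
      by field.
    rewrite normrN divfK ?normr_eq0//; apply=> t th.
    have [Dt ht] := Dh t (le_lt_trans th hlt).
    have Dt' : D (t *: v + (s *: e1 + q)) by rewrite addrCA; exact: Dinv.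
    split; last first.
      rewrite normrM normfV mulrC ler_pM2r ?invr_gt0 ?normr_gt0//.
      by rewrite (addrCA (t *: v)); exact: ht.
    have d1 := is_derive_line (Gd _ Dt').
    have d2 : is_derive t (1 : R) (fun t : R => t * 'D_v G (s *: e1 + q)) ('D_v G (s *: e1 + q)).
      by apply: is_derive_eq; rewrite /GRing.scale/= mulr0 mulr1 add0r.
    by have := is_deriveZ h^-1 (is_deriveB d1 d2).
  exact: arcint_eps.
apply: DeriveDef; last exact: cvg_lim.
by apply/cvg_ex; exists (arcint w ('D_v G) q).
Qed.

End Kernel.

Definition tperiodic (G : E -> R) := forall q, G ((2 * pi) *: e1 + q) = G q.

(** A translation commutes with directional derivatives. *)
Lemma shift_derive (s : R) G v : (forall q, G (s *: e1 + q) = G q) ->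
  forall q, 'D_v G (s *: e1 + q) = 'D_v G q.
Proof.
move=> Gp q.
have := @derive_comp_affine R E E (fun p => s *: e1 + p) id _ G q v.
move=> <-; last by move=> x u h; rewrite addrCA.
by congr ('D_v _ q); apply/funext => p; exact: Gp.
Qed.

Lemma tperiodic_derive G v : tperiodic G -> tperiodic ('D_v G).
Proof. by move=> Gp q; exact: shift_derive. Qed.

Definition cosw (m : int) (s : R) : R := cos (m%:~R * s).
Definition sinw (m : int) (s : R) : R := sin (m%:~R * s).

Lemma cosw_cont m : continuous (cosw m).
Proof. by move=> s; apply: continuous_comp; [exact: mulrl_continuous|exact: continuous_cos]. Qed.

Lemma sinw_cont m : continuous (sinw m).
Proof. by move=> s; apply: continuous_comp; [exact: mulrl_continuous|exact: continuous_sin]. Qed.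

Lemma cosw_le m s : `|cosw m s| <= 1.
Proof. by rewrite ler_norml cos_geN1 cos_le1. Qed.

Lemma sinw_le m s : `|sinw m s| <= 1.
Proof. by rewrite ler_norml sin_geN1 sin_le1. Qed.

Lemma is_derive_mul (m s : R) : is_derive s (1 : R) (fun s : R => m * s) m.
Proof. by apply: is_derive_eq; rewrite /GRing.scale/= mulr1. Qed.

Lemma is_derive_sinw m s : is_derive s (1 : R) (sinw m) (m%:~R * cosw m s).
Proof.
have := is_derive1_comp (is_derive_sin (m%:~R * s)) (is_derive_mul m%:~R s).
by move=> h; apply: (is_derive_eq h); rewrite mulrC.
Qed.

Lemma is_derive_cosw m s : is_derive s (1 : R) (cosw m) (- m%:~R * sinw m s).
Proof.
have := is_derive1_comp (is_derive_cos (m%:~R * s)) (is_derive_mul m%:~R s).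
by move=> h; apply: (is_derive_eq h); rewrite mulNr mulrC mulNr.
Qed.

Lemma sinw2pi m : sinw m (2 * pi) = 0 /\ cosw m (2 * pi) = 1.
Proof.
have e2 : expi (2 * pi) = circle1 R by rewrite -[2 * pi]add0r expiD2pi expi0.
have := expi_expz m (2 * pi : R); rewrite e2 /= exp1rz.
by case.
Qed.

Lemma sinw0 m : sinw m 0 = 0 /\ cosw m 0 = 1.
Proof. by rewrite /sinw /cosw mulr0 sin0 cos0. Qed.

Section Modes.
Variable D : set E.
Hypothesis Dinv : forall s p, D p -> D (s *: e1 + p).
Hypothesis oD : open D.

(** Integration by parts; the boundary terms cancel by periodicity. *)
Lemma arcint_by_parts (w dw : R -> R) G q : (forall s, is_derive s (1 : R) w (dw s)) ->
  continuous dw -> w (2 * pi) = w 0 ->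
  (forall p, D p -> derivable G p e1) -> (forall p, D p -> {for p, continuous G}) ->
  (forall p, D p -> {for p, continuous ('D_e1 G)}) ->
  tperiodic G -> D q -> arcint dw G q = - arcint w ('D_e1 G) q.
Proof.
move=> wd dwc wp Gd Gc dGc Gp Dq.
have Dq' s : D (s *: e1 + q) by exact: Dinv.
have wc : continuous w.
  by move=> t; apply: differentiable_continuous; apply/derivable1_diffP; have [] := wd t.
have gd (s : R) : is_derive s (1 : R) (fun s => G (s *: e1 + q)) ('D_e1 G (s *: e1 + q)).
  by apply: is_derive_line; exact: Gd.
have int1 := arcint_integrable dwc (fun s => Gc _ (Dq' s)).
have int2 := arcint_integrable wc (fun s => dGc _ (Dq' s)).
apply/eqP; rewrite -addr_eq0 /arcint -RintegralD//.
have H1 (s : R) : is_derive s (1 : R) (fun s => w s * G (s *: e1 + q))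
    (dw s * G (s *: e1 + q) + w s * 'D_e1 G (s *: e1 + q)).
  apply: (is_derive_eq (is_deriveM (wd s) (gd s))).
  by rewrite /GRing.scale/= addrC [dw s * _]mulrC.
have H2 : continuous (fun s => dw s * G (s *: e1 + q) + w s * 'D_e1 G (s *: e1 + q)).
  move=> s; apply: cvgD; apply: cvgM.
  + exact: dwc.
  + by have := comp_cont (@line_cont q s) (Gc _ (Dq' s)).
  + exact: wc.
  + by have := comp_cont (@line_cont q s) (dGc _ (Dq' s)).
by rewrite (arc_FTC H1 H2) wp Gp scale0r add0r subrr.
Qed.

Lemma mode_parts1 m H q : smooth_on D H -> tperiodic H -> D q ->
  m%:~R * arcint (cosw m) H q = - arcint (sinw m) ('D_e1 H) q /\
  m%:~R * arcint (sinw m) H q = arcint (cosw m) ('D_e1 H) q.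
Proof.
have [s2 c2] := sinw2pi m; have [s0 c0] := sinw0 m.
move=> Hs Hp Dq; have dHs := smooth_on_derive e1 Hs.
have Hc p : D p -> {for p, continuous H} by move=> Dp; exact: smooth_on_cont Hs Dp.
have dHc p : D p -> {for p, continuous ('D_e1 H)} by move=> Dp; exact: smooth_on_cont dHs Dp.
have Hd p : D p -> derivable H p e1 by move=> Dp; exact: smooth_on_derivable Hs Dp.
have Hi s : {for s *: e1 + q, continuous H} by apply: Hc; exact: Dinv.
split.
- rewrite -(arcint_by_parts (@is_derive_sinw m) _ _ Hd Hc dHc Hp Dq) ?s2 ?s0//.
    rewrite /arcint -RintegralZl//; last by apply: arcint_integrable; [exact: cosw_cont|exact: Hi].
    by apply: eq_Rintegral => s _; rewrite mulrA.
  by move=> s; apply: cvgM; [exact: cvg_cst|exact: cosw_cont].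
- apply: oppr_inj; rewrite -(arcint_by_parts (@is_derive_cosw m) _ _ Hd Hc dHc Hp Dq) ?c2 ?c0//.
    rewrite -mulNr /arcint -RintegralZl//; last by apply: arcint_integrable; [exact: sinw_cont|exact: Hi].
    by apply: eq_Rintegral => s _; rewrite mulrA.
  by move=> s; apply: cvgM; [exact: cvg_cst|exact: sinw_cont].
Qed.

Variable G : E -> R.
Hypothesis Gs : smooth_on D G.
Hypothesis Gp : tperiodic G.

Lemma mode_parts m q : D q ->
  m%:~R ^+ 2 * arcint (cosw m) G q = - arcint (cosw m) ('D_e1 ('D_e1 G)) q /\
  m%:~R ^+ 2 * arcint (sinw m) G q = - arcint (sinw m) ('D_e1 ('D_e1 G)) q.
Proof.
move=> Dq.
have dGs := smooth_on_derive e1 Gs; have dGp := @tperiodic_derive _ e1 Gp.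
have [p1 p2] := mode_parts1 m Gs Gp Dq; have [p3 p4] := mode_parts1 m dGs dGp Dq.
have F (k a b d : R) : k * a = b -> k * b = d -> k ^+ 2 * a = d.
  by move=> <- <-; rewrite expr2 mulrA.
split; last by apply: F p2 _.
by apply: F p1 _; rewrite mulrN p4.
Qed.

(** Two integrations by parts trade the factor [m ^ 2] for a second derivative in the
    angle, which is bounded near the circle through [q]. *)
Lemma mode_bound q : D q -> exists2 C : R, 0 <= C & \forall p \near q, forall m : int,
  `|arcint (cosw m) G p| <= C / (1 + m%:~R ^+ 2) /\ `|arcint (sinw m) G p| <= C / (1 + m%:~R ^+ 2).
Proof.
move=> Dq.
have dGs := smooth_on_derive e1 Gs; have ddGs := smooth_on_derive e1 dGs.
have B (H : E -> R) : smooth_on D H -> exists2 C : R, 0 <= C & \forall p \near q,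
    forall s : R, 0 <= s <= 2 * pi -> `|H (s *: e1 + p)| <= C.
  move=> Hs; have Hi s : {for s *: e1 + q, continuous H}.
    by apply: smooth_on_cont Hs _; exact: Dinv.
  have ab : 0 <= 2 * pi :> R by rewrite ltW// twopi_gt0.
  have cn : {within `[0, 2 * pi], continuous (fun t => `|H (t *: e1 + q)|)}.
    apply: continuous_subspaceT => t; apply: cvg_norm.
    by have := comp_cont (@line_cont q t) (Hi t).
  have [c _ hc] := EVT_max ab cn.
  exists (`|H (c *: e1 + q)| + 1); first by rewrite addr_ge0.
  apply: filterS (circle_tube Hi ltr01) => p hp s s01.
  have := hp s s01; have := hc s; rewrite in_itv/= => /(_ s01) h1 h2.
  have := ler_normD (H (s *: e1 + p) - H (s *: e1 + q)) (H (s *: e1 + q)).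
  by rewrite subrK => h3; apply: (le_trans h3); rewrite addrC lerD.
(* The bound for G itself serves the summand 1 of 1 + m^2, the bound for its second
   derivative the summand m^2. *)
have [C1 C10 hC1] := B _ Gs; have [C2 C20 hC2] := B _ ddGs.
exists (2 * pi * 1 * C1 + 2 * pi * 1 * C2).
  by rewrite addr_ge0// mulr_ge0// mulr1 ltW// twopi_gt0.
apply: filterS (filterI (near_open oD Dq) (filterI hC1 hC2)) => p [Dp [h1 h2]] m.
have Gi (H : E -> R) : smooth_on D H -> forall s, {for s *: e1 + p, continuous H}.
  by move=> Hs s; apply: smooth_on_cont Hs _; exact: Dinv.
have m0 : 0 < 1 + m%:~R ^+ 2 :> R by rewrite ltr_pwDl// sqr_ge0.
have [e1' e2'] := mode_parts m Dp.
have F (w : R -> R) : continuous w -> (forall s, `|w s| <= 1) ->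
    m%:~R ^+ 2 * arcint w G p = - arcint w ('D_e1 ('D_e1 G)) p ->
    `|arcint w G p| <= (2 * pi * 1 * C1 + 2 * pi * 1 * C2) / (1 + m%:~R ^+ 2).
  move=> wc w1 eqn; rewrite ler_pdivlMr// -[X in _ * X]gtr0_norm// -normrM mulrDr [arcint w G p * 1]mulr1.
  apply: (le_trans (ler_normD _ _)); apply: lerD.
    exact: (arcint_le wc w1 (Gi _ Gs) C10 h1).
  rewrite mulrC eqn normrN; exact: (arcint_le wc w1 (Gi _ ddGs) C20 h2).
by split; apply: F => //; [exact: cosw_cont|exact: cosw_le|exact: sinw_cont|exact: sinw_le].
Qed.

End Modes.

End Averages.

(** * Fourier modes of a smooth family *)

Section SumFamilies.
Variables (R : realType) (E : normedModType R) (T : eqType).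
Implicit Types (D : set E) (b : T -> E -> R).

Lemma eq_CkS D k b b' : open D -> (forall m x, D x -> b m x = b' m x) ->
  CkS D k b -> CkS D k b'.
Proof.
move=> oD; elim: k b b' => [|k IH] b b' bb.
all: have nbb m x : D x -> \forall y \near x, b m y = b' m y by
    move=> Dx; apply: filterS (near_open oD Dx) => y; exact: bb.
all: have S x : D x -> (exists M C, abs_bounded (M : T -> R) C /\
    \forall y \near x, forall m, `|b m y| <= M m) ->
   exists M C, abs_bounded (M : T -> R) C /\ \forall y \near x, forall m, `|b' m y| <= M m by
  move=> Dx [M [C [MC nM]]]; exists M, C; split=> //;
  apply: filterS (filterI (near_open oD Dx) nM) => y [Dy h] m; rewrite -bb.
all: have Cn m x : D x -> {for x, continuous (b m)} -> {for x, continuous (b' m)} by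
  move=> Dx; rewrite /prop_for /continuous_at bb// => c; apply: cvg_trans c;
  exact: near_eq_cvg (nbb m x Dx).
  by case=> s c _; split=> // [x Dx|m x Dx]; [apply: S => //; exact: s|apply: Cn => //; exact: c].
case=> s c d; split=> // [x Dx|m x Dx|v]; [by apply: S => //; exact: s|by apply: Cn => //; exact: c|].
have [dv Cv] := d v; split=> [m x Dx|].
  exact: near_eq_derivable (nbb m x Dx) (dv m x Dx).
apply: IH Cv => m x Dx; exact: near_eq_derive (nbb m x Dx).
Qed.

Lemma abs_bounded_L (a : R) (f g : T -> R) C C' : abs_bounded f C -> abs_bounded g C' ->
  abs_bounded (fun x => `|a| * `|f x| + `|g x|) (`|a| * C + C').
Proof.
move=> fC gC l ul.
apply: (@le_trans _ _ (`|a| * \sum_(x <- l) `|f x| + \sum_(x <- l) `|g x|)).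
  by rewrite mulr_sumr -big_split/=; apply: ler_sum => x _; rewrite ger0_norm// addr_ge0// mulr_ge0.
by apply: lerD; [apply: ler_wpM2l => //; exact: fC|exact: gC].
Qed.

Lemma CkSL D k b b' (a : R) : open D -> CkS D k b -> CkS D k b' ->
  CkS D k (fun m x => a * b m x + b' m x).
Proof.
move=> oD; elim: k b b' => [|k IH] b b' C1 C2.
all: have c m x : D x -> {for x, continuous (fun x => a * b m x + b' m x)} by
  move=> Dx; apply: cvgD; [apply: cvgM; [exact: cvg_cst|exact: CkS_cont C1 Dx]|exact: CkS_cont C2 Dx].
all: have s x : D x -> exists M C, abs_bounded (M : T -> R) C /\
    \forall y \near x, forall m, `|a * b m y + b' m y| <= M m by
  move=> Dx; have [M [C [MC nM]]] := CkS_bound C1 Dx;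
  have [M' [C' [MC' nM']]] := CkS_bound C2 Dx;
  exists (fun m => `|a| * `|M m| + `|M' m|), (`|a| * C + C'); split;
  [exact: abs_bounded_L|apply: filterS (filterI nM nM') => y [h h'] m;
   apply: (le_trans (ler_normD _ _)); rewrite normrM; apply: lerD;
   [apply: ler_wpM2l => //; apply: le_trans (h m) _; exact: ler_norm
   |apply: le_trans (h' m) _; exact: ler_norm]].
  by [].
split=> // v; have [_ _ /(_ v)[d1 D1]] := C1; have [_ _ /(_ v)[d2 D2]] := C2.
have dm m x : D x -> derivable (fun x => a * b m x) x v.
  by move=> Dx; apply: derivableM; [exact: derivable_cst|exact: d1].
split=> [m x Dx|].
  by apply: derivableD; [exact: dm|exact: d2].
apply: eq_CkS (IH _ _ D1 D2) => // m x Dx.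
rewrite (@deriveD _ _ _ (fun x => a * b m x) (b' m))//; [|exact: dm|exact: d2].
by congr (_ + _); rewrite (@deriveZ _ _ _ (b m) a)//; exact: d1.
Qed.

End SumFamilies.

(** The nonnegative and the negative integers contribute at most [4 * C] each, by
    comparison with the telescoping series of [4 / ((k + 1) * (k + 2))]. *)
Lemma inverse_square_bounded (R : realType) (C : R) : 0 <= C ->
  abs_bounded (fun m : int => C / (1 + m%:~R ^+ 2)) (8 * C).
Proof.
move=> C0 l ul.
pose g (m : int) : R := C / (1 + m%:~R ^+ 2).
have p0 (m : int) : 0 < 1 + m%:~R ^+ 2 :> R by rewrite ltr_pwDl// sqr_ge0.
have g0 m : 0 <= g m by rewrite divr_ge0// ltW.
under eq_bigr => m _ do rewrite (ger0_norm (g0 m)).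
pose K := \max_(m <- l) `|m|%N.+1.
have tel n : \sum_(k <- iota 0 n) (1 + k%:R ^+ 2)^-1 <= 4 * (1 - (n.+1%:R)^-1) :> R.
  elim: n => [|n IH]; first by rewrite big_nil invr1 subrr mulr0.
  rewrite -(addn1 n) iotaD add0n big_cat/= big_seq1 addn1.
  suff : (1 + n%:R ^+ 2)^-1 <= 4 * ((n.+1%:R)^-1 - (n.+2%:R)^-1) :> R.
    by move=> h; apply: le_trans (lerD IH h) _; rewrite -mulrDr addrA subrK.
  have a0 : 0 <= n%:R :> R by [].
  rewrite !mulrSr; move: (n%:R : R) a0 => a a0.
  have h : (1 + a ^+ 2)^-1 <= 4 / ((a + 1) * (a + 1 + 1)).
    have q1 : 0 < 1 + a ^+ 2 by rewrite ltr_pwDl// sqr_ge0.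
    have q2 : 0 < (a + 1) * (a + 1 + 1) by apply: mulr_gt0; lra.
    rewrite ler_pdivlMr// mulrC ler_pdivrMr//; nra.
  apply: (le_trans h); rewrite le_eqVlt; apply/orP; left; apply/eqP; field.
  by apply/andP; split; apply: lt0r_neq0; lra.
have tel4 n : \sum_(k <- iota 0 n) (1 + k%:R ^+ 2)^-1 <= 4 :> R.
  apply: le_trans (tel n) _; have : 0 <= (n.+1%:R : R)^-1 by rewrite invr_ge0.
  move: (_^-1) => z z0; lra.
pose L := [seq Posz k | k <- iota 0 K] ++ [seq Negz k | k <- iota 0 K].
have sub : {subset l <= L}.
  move=> m ml; have mK : (`|m| < K)%N by rewrite /K (big_rem m)//= leq_maxl.
  rewrite mem_cat; case: m ml mK => k _ kK; apply/orP; [left|right].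
    by apply/mapP; exists k => //; rewrite mem_iota.
  by apply/mapP; exists k => //; rewrite mem_iota/= add0n; apply: ltn_trans kK; rewrite /=.
apply: (le_trans (sum_subseq g0 ul sub)).
rewrite /L big_cat/= !big_map.
have h1 : \sum_(k <- iota 0 K) g (Posz k) <= 4 * C.
  rewrite -mulr_sumr mulrC; apply: ler_wpM2r => //; exact: tel4.
have h2 : \sum_(k <- iota 0 K) g (Negz k) <= 4 * C.
  apply: le_trans h1; apply: ler_sum => k _; rewrite /g; apply: ler_wpM2l => //.
  rewrite lef_pV2 ?posrE ?p0// lerD2l NegzE mulrNz sqrrN.
  by rewrite ler_sqr ?nnegrE// ler_nat.
lra.
Qed.

Section ModeFamilies.
Variable R : realType.
Local Notation E := (R * R * R)%type.
Local Notation e1 := (e1 R).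
Variable D : set E.
Hypothesis Dinv : forall s p, D p -> D (s *: e1 + p).
Hypothesis oD : open D.

Lemma arcint_CkS k G : smooth_on D G -> tperiodic G ->
  CkS D k (fun m => arcint (cosw m) G) /\ CkS D k (fun m => arcint (sinw m) G).
Proof.
have step (w : int -> R -> R) : (forall m, continuous (w m)) -> (forall m s, `|w m s| <= 1) ->
    (forall G q, smooth_on D G -> tperiodic G -> D q -> exists2 C : R, 0 <= C &
      \forall p \near q, forall m : int, `|arcint (w m) G p| <= C / (1 + m%:~R ^+ 2)) ->
    forall G, smooth_on D G -> tperiodic G -> CkS D k (fun m => arcint (w m) G).
  move=> wc w1 wb.
  have C (H : E -> R) : smooth_on D H -> forall p, D p -> {for p, continuous H}.
    by move=> Hs p Dp; exact: smooth_on_cont Hs Dp.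
  have B (H : E -> R) x : smooth_on D H -> tperiodic H -> D x ->
      exists M C, abs_bounded (M : int -> R) C /\
      \forall y \near x, forall m, `|arcint (w m) H y| <= M m.
    move=> Hs Hp Dx; have [c c0 nC] := wb H x Hs Hp Dx.
    exists (fun m => c / (1 + m%:~R ^+ 2)), (8 * c); split => //; exact: inverse_square_bounded.
  elim: k => [|k IH] H Hs Hp; have Hc := C H Hs;
   have c m x : D x -> {for x, continuous (arcint (w m) H)} by
     move=> Dx; apply: (arcint_cont (wc m) (w1 m) Dinv oD Hc Dx).
    by split=> // x Dx; exact: B.
  split=> [x Dx|//|v]; [exact: B|]; have dHs := smooth_on_derive v Hs.
  have der m x : D x -> is_derive x v (arcint (w m) H) (arcint (w m) ('D_v H) x).
    move=> Dx; apply: (arcint_derive (wc m) (w1 m) Dinv oD Hc _ _ Dx) => p Dp.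
      exact: smooth_on_derivable Hs Dp.
    exact: smooth_on_cont dHs Dp.
  split=> [m x Dx|]; first by have [] := der m x Dx.
  apply: eq_CkS (IH _ dHs (@tperiodic_derive _ _ v Hp)) => // m x Dx.
  by have [_ ->] := der m x Dx.
move=> Gs Gp; split; apply: step => //.
- exact: cosw_cont.
- exact: cosw_le.
- move=> H q Hs Hp Dq; have [C C0 nC] := mode_bound Dinv oD Hs Hp Dq; exists C => //.
  by apply: filterS nC => p h m; have [] := h m.
- exact: sinw_cont.
- exact: sinw_le.
- move=> H q Hs Hp Dq; have [C C0 nC] := mode_bound Dinv oD Hs Hp Dq; exists C => //.
  by apply: filterS nC => p h m; have [] := h m.
Qed.

(** The pair of real modes rotates with angular speed [m] under translation of
    the circle variable. *)
Lemma arcint_rotate m G q t : smooth_on D G -> tperiodic G -> D q ->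
  arcint (cosw m) G (t *: e1 + q) = cosw m t * arcint (cosw m) G q + sinw m t * arcint (sinw m) G q /\
  arcint (sinw m) G (t *: e1 + q) = cosw m t * arcint (sinw m) G q - sinw m t * arcint (cosw m) G q.
Proof.
move=> Gs Gp Dq.
have dGs := smooth_on_derive e1 Gs.
have Dl s : D (s *: e1 + q) by exact: Dinv.
have Gc p : D p -> {for p, continuous G} by move=> Dp; exact: smooth_on_cont Gs Dp.
have Gd p : D p -> derivable G p e1 by move=> Dp; exact: smooth_on_derivable Gs Dp.
have dGc p : D p -> {for p, continuous ('D_e1 G)} by move=> Dp; exact: smooth_on_cont dGs Dp.
pose c s := arcint (cosw m) G (s *: e1 + q); pose d s := arcint (sinw m) G (s *: e1 + q).
have dc (s : R) : is_derive s (1 : R) c (m%:~R * d s).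
  rewrite /d (mode_parts1 Dinv m Gs Gp (Dl s)).2.
  have [dv <-] := arcint_derive (@cosw_cont R m) (@cosw_le R m) Dinv oD Gc Gd dGc (Dl s).
  exact: is_derive_line.
have dd (s : R) : is_derive s (1 : R) d (- (m%:~R * c s)).
  rewrite /c (mode_parts1 Dinv m Gs Gp (Dl s)).1 opprK.
  have [dv <-] := arcint_derive (@sinw_cont R m) (@sinw_le R m) Dinv oD Gc Gd dGc (Dl s).
  exact: is_derive_line.
have cst (f : R -> R) : (forall s : R, is_derive s (1 : R) f 0) -> f t = f 0.
  move=> df; have := @line_MVT R f (fun=> 0) t 0; rewrite mul0r => h.
  by apply/eqP; rewrite -subr_eq0 -normr_le0; apply: h => s _; rewrite normr0.
have A : c t * cosw m t - d t * sinw m t = c 0.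
  have /cst : forall s : R, is_derive s (1 : R) (fun s => c s * cosw m s - d s * sinw m s) 0.
    move=> s; apply: (is_derive_eq (is_deriveB (is_deriveM (dc s) (is_derive_cosw m s))
    (is_deriveM (dd s) (is_derive_sinw m s)))).
    by rewrite /GRing.scale/=; ring.
  by move=> h; apply: etrans h _; rewrite (sinw0 R m).1 (sinw0 R m).2 mulr1 mulr0 subr0.
have B : c t * sinw m t + d t * cosw m t = d 0.
  have /cst : forall s : R, is_derive s (1 : R) (fun s => c s * sinw m s + d s * cosw m s) 0.
    move=> s; apply: (is_derive_eq (is_deriveD (is_deriveM (dc s) (is_derive_sinw m s))
    (is_deriveM (dd s) (is_derive_cosw m s)))).
    by rewrite /GRing.scale/=; ring.
  by move=> h; apply: etrans h _; rewrite (sinw0 R m).1 (sinw0 R m).2 mulr1 mulr0 add0r.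
have c0 : c 0 = arcint (cosw m) G q by rewrite /c scale0r add0r.
have d0 : d 0 = arcint (sinw m) G q by rewrite /d scale0r add0r.
rewrite -/(c t) -/(d t) -c0 -d0 -A -B.
have := cos2Dsin2 (m%:~R * t); rewrite -/(cosw m t) -/(sinw m t).
move: (c t) (d t) (cosw m t) (sinw m t) => x y a b ab; split.
  transitivity (x * (a ^+ 2 + b ^+ 2)); [by rewrite ab mulr1|by ring].
transitivity (y * (a ^+ 2 + b ^+ 2)); [by rewrite ab mulr1|by ring].
Qed.

(** The integral of [e^(-ims) F(q + s e1) / (2 pi)] over [s]. At a point of angle [t]
    it equals [e^(imt)] times the [m]-th Fourier coefficient of [F] on the
    circle through that point, that is, the [m]-th term of the Fourier series. *)
Definition mode (m : int) (F : E -> R[i]) q : R[i] :=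
  let r := fun q => complex.Re (F q) in let i := fun q => complex.Im (F q) in
  Complex ((2 * pi)^-1 * (arcint (cosw m) r q + arcint (sinw m) i q))
          ((2 * pi)^-1 * (arcint (cosw m) i q - arcint (sinw m) r q)).

Lemma mode_CkS k F : csmooth D F ->
  (forall q, F ((2 * pi) *: e1 + q) = F q) ->
  CkS D k (fun m q => complex.Re (mode m F q)) /\ CkS D k (fun m q => complex.Im (mode m F q)).
Proof.
move=> [rs ims] Fp.
have rp : tperiodic (fun q => complex.Re (F q)) by move=> q; rewrite Fp.
have ip : tperiodic (fun q => complex.Im (F q)) by move=> q; rewrite Fp.
have [c1 s1] := arcint_CkS k rs rp; have [c2 s2] := arcint_CkS k ims ip.
have z := @CkS0 R E int D k.
split.
- apply: eq_CkS (CkSL (2 * pi)^-1 oD c1 (CkSL (2 * pi)^-1 oD s2 z)) => // m x _.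
  by rewrite /mode addr0 -mulrDr.
- apply: eq_CkS (CkSL (2 * pi)^-1 oD c2 (CkSL (- (2 * pi)^-1) oD s1 z)) => // m x _.
  by rewrite /mode addr0 mulNr -mulrBr.
Qed.

Lemma mode_rotate m F q t : csmooth D F -> (forall q, F ((2 * pi) *: e1 + q) = F q) -> D q ->
  mode m F (t *: e1 + q) = val (expi t) ^ m * mode m F q.
Proof.
move=> [rs ims] Fp Dq.
have rp : tperiodic (fun q => complex.Re (F q)) by move=> p; rewrite Fp.
have ip : tperiodic (fun q => complex.Im (F q)) by move=> p; rewrite Fp.
have [c1 s1] := arcint_rotate m t rs rp Dq; have [c2 s2] := arcint_rotate m t ims ip Dq.
rewrite expi_expz; apply: complexP; rewrite ?cReM ?cImM /mode /= ?c1 ?s1 ?c2 ?s2 /cosw /sinw;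
  move: ((2 * pi)^-1 : R) => z; ring.
Qed.

End ModeFamilies.

Section FourierModes.
Variable R : realType.
Local Notation E := (R * R * R)%type.
Local Notation e1 := (e1 R).

Lemma mode_fc m (F : E -> R[i]) q (h : circle R -> R[i]) : ccont h ->
  (forall s, F (s *: e1 + q) = h (expi s)) -> mode m F q = fc h m.
Proof.
move=> [hr hi] Fh.
have e s : (Complex (cos s) (sin s)) ^ (- m) = Complex (cosw m s) (- sinw m s) :> R[i].
  by rewrite -[Complex _ _]/(val (expi s)) expi_expz /= /cosw /sinw mulrNz mulNr cosN sinN.
have int (w f : R -> R) : continuous w -> continuous f ->
    (@arc_measure R).-integrable setT (EFin \o (fun s => w s * f s)).
  move=> wc fc; have Gc s : {for s *: e1 + (0 : E), continuous (fun p : E => f p.1.1)}.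
    apply: (@continuous_comp _ _ _ (fun p : E => p.1.1) f); last exact: fc.
    by apply: (@continuous_comp _ _ _ (fun p : E => p.1) fst); exact: cvg_fst.
  have := arcint_integrable wc Gc.
  by under [X in EFin \o X]eq_fun do rewrite e1E addr0.
have cc := @cosw_cont R m; have sc := @sinw_cont R m.
have hr' : continuous (fun s : R => complex.Re (F (s *: e1 + q))) by under eq_fun do rewrite Fh.
have hi' : continuous (fun s : R => complex.Im (F (s *: e1 + q))) by under eq_fun do rewrite Fh.
apply: complexP; rewrite /mode /fc /circle_mean /=; congr (_ * _); rewrite /arcint.
- rewrite -RintegralD//; [|exact: int..].
  by apply: eq_Rintegral => s _; rewrite !Fh e cReM/=; ring.
- rewrite -RintegralB//; [|exact: int..].
  by apply: eq_Rintegral => s _; rewrite !Fh e cImM/=; ring.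
Qed.

End FourierModes.

(** * Complex sums and Fourier series *)

Section ComplexSums.
Variables (R : realType) (T : eqType).
Implicit Types (f g : T -> R[i]) (M : T -> R).

(** One finite set of indices serves all families dominated by [M]. *)
Lemma tsum_uniform (M : T -> R) C : abs_bounded M C -> forall e, 0 < e -> exists2 l0, uniq l0 &
  forall f : T -> R, (forall s, `|f s| <= M s) -> `|tsum f - \sum_(s <- l0) f s| <= e.
Proof.
move=> MC e e0; have [l0 ul0 tail] := abs_bounded_tail MC e0; exists l0 => // f fM.
have fb : abs_bounded f C.
  by apply: abs_bounded_le MC => s; apply: le_trans (fM s) _; exact: ler_norm.
have hs := abs_bounded_tsum fb.
apply/ler_addgt0Pr => e' e0'; have [l1 h1] := hs _ e0'.
pose rest := [seq x <- undup l1 | x \notin l0].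
have urest : uniq rest by rewrite filter_uniq// undup_uniq.
have drest : {in rest, forall x, x \notin l0} by move=> x; rewrite mem_filter => /andP[].
have ul : uniq (l0 ++ rest).
  by rewrite cat_uniq ul0 urest andbT/=; apply/hasPn => x; exact: drest.
have b1 : `|\sum_(x <- l0 ++ rest) f x - tsum f| <= e'.
  by apply: h1 => // x xl; rewrite mem_cat mem_filter mem_undup xl andbT orbN.
have b2 : `|\sum_(x <- rest) f x| <= e.
  apply: (le_trans (ler_norm_sum _ _ _)); apply: le_trans (tail _ urest drest).
  by apply: ler_sum => s _; apply: le_trans (fM s) _; exact: ler_norm.
move: b1 b2; rewrite big_cat/= !ler_norml => /andP[? ?] /andP[? ?].
by apply/andP; split; lra.
Qed.

Lemma has_sum1 (a : T) (c : R) : has_sum (fun x => (x == a)%:R * c) c.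
Proof.
move=> e e0; exists [:: a] => l ul sub.
have al : a \in l by apply: sub; rewrite mem_head.
rewrite (perm_big _ (perm_to_rem al)) big_cons eqxx mul1r big_seq big1 => [|x].
  by rewrite /= addr0 subrr normr0 ltW.
by rewrite mem_rem_uniq// inE => /andP[/negbTE -> _]; rewrite mul0r.
Qed.

Definition csum f : R[i] :=
  Complex (tsum (fun x => complex.Re (f x))) (tsum (fun x => complex.Im (f x))).

Definition chas_sum f (S : R[i]) :=
  has_sum (fun x => complex.Re (f x)) (complex.Re S) /\
  has_sum (fun x => complex.Im (f x)) (complex.Im S).

Lemma chas_sum_unique f S S' : chas_sum f S -> chas_sum f S' -> S = S'.
Proof. by move=> [a b] [a' b']; apply: complexP; [exact: has_sum_unique a a'|exact: has_sum_unique b b']. Qed.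

Lemma csumE f S : chas_sum f S -> csum f = S.
Proof. by move=> [a b]; apply: complexP => /=; exact: tsumE. Qed.

Lemma abs_chas_sum f M C : abs_bounded M C -> (forall s, normc (f s) <= M s) ->
  chas_sum f (csum f).
Proof.
move=> MC fM; split; apply: (@abs_bounded_tsum _ _ _ C); apply: abs_bounded_le MC => s.
- by apply: le_trans (ler_Re_normc _) (le_trans (fM s) (ler_norm _)).
- by apply: le_trans (ler_Im_normc _) (le_trans (fM s) (ler_norm _)).
Qed.

Lemma chas_sum0 : chas_sum (fun=> 0) 0.
Proof. by split; exact: has_sum0. Qed.

Lemma chas_sumD f g S S' : chas_sum f S -> chas_sum g S' -> chas_sum (fun x => f x + g x) (S + S').
Proof.
move=> [a b] [a' b']; split; rewrite ?cReD ?cImD.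
- by under eq_fun do rewrite cReD; exact: has_sumD.
- by under eq_fun do rewrite cImD; exact: has_sumD.
Qed.

Lemma chas_sumZ (a : R[i]) f S : chas_sum f S -> chas_sum (fun x => a * f x) (a * S).
Proof.
move=> [r i]; split; rewrite ?cReM ?cImM.
- have := has_sumL (complex.Re a) r (has_sumZ (- complex.Im a) i).
  by rewrite mulNr; apply: eq_has_sum => x; rewrite cReM mulNr.
- have := has_sumL (complex.Re a) i (has_sumZ (complex.Im a) r).
  by apply: eq_has_sum => x; rewrite cImM.
Qed.

Lemma chas_sum_big (I : Type) (r : seq I) (f : I -> T -> R[i]) (S : I -> R[i]) :
  (forall i, chas_sum (f i) (S i)) -> chas_sum (fun x => \sum_(i <- r) f i x) (\sum_(i <- r) S i).
Proof.
move=> h; elim: r => [|i r IH].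
  by under eq_fun do rewrite big_nil; rewrite big_nil; exact: chas_sum0.
by under eq_fun do rewrite big_cons; rewrite big_cons; exact: chas_sumD.
Qed.

Lemma chas_sum1 (a : T) (c : R[i]) : chas_sum (fun x => (x == a)%:R * c) c.
Proof.
have e x : (x == a)%:R = ((x == a)%:R : R)%:C%C by case: (x == a).
split; apply: eq_has_sum (has_sum1 a _) => x; rewrite e ?cReM ?cImM/=; ring.
Qed.

Lemma csum_uniform (M : T -> R) C : abs_bounded M C -> forall e, 0 < e -> exists2 l0, uniq l0 &
  forall f, (forall s, normc (f s) <= M s) -> normc (csum f - \sum_(s <- l0) f s) <= e.
Proof.
move=> MC e e0; have [l0 ul0 h] := tsum_uniform MC (divr_gt0 e0 (ltr0n R 2)).
exists l0 => // f fM; apply: (le_trans (normc_ler_ReIm _)).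
rewrite cReD cImD cReN cImN cRe_sum cIm_sum.
have a1 : `|tsum (fun x => complex.Re (f x)) - \sum_(s <- l0) complex.Re (f s)| <= e / 2.
  by apply: h => s; exact: le_trans (ler_Re_normc _) (fM s).
have a2 : `|tsum (fun x => complex.Im (f x)) - \sum_(s <- l0) complex.Im (f s)| <= e / 2.
  by apply: h => s; exact: le_trans (ler_Im_normc _) (fM s).
by have := lerD a1 a2; rewrite -splitr.
Qed.

Lemma normc_csum_le f M C : abs_bounded M C -> (forall s, normc (f s) <= M s) ->
  normc (csum f) <= C.
Proof.
move=> MC fM; apply/ler_addgt0Pr => e e0; have [l0 ul0 h] := csum_uniform MC e0.
rewrite -[csum f](subrK (\sum_(s <- l0) f s)) addrC.
apply: (le_trans (normcD _ _)); apply: lerD; last exact: h.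
apply: (le_trans (normc_sum _ _ _)); apply: le_trans (MC l0 ul0).
by apply: ler_sum => s _; apply: le_trans (fM s) (ler_norm _).
Qed.

End ComplexSums.

(** Fubini for a sum over nonempty words, split along the first letter. *)
Section FirstLetter.
Variables (R : realType) (T : eqType).

Lemma sum_share_le (l : seq T) (c : R) : 0 <= c -> \sum_(m <- l) (c / (size l).+1%:R) <= c.
Proof.
move=> c0; have -> : \sum_(m <- l) (c / (size l).+1%:R) = c * ((size l)%:R / (size l).+1%:R).
  have G x : \sum_(m <- l) x = (size l)%:R * x :> R.
    elim: l => [|m l IH]; first by rewrite big_nil mul0r.
    by rewrite big_cons IH /= -[in RHS]addn1 natrD; ring.
  by rewrite G mulrCA.
by apply: ler_piMr => //; rewrite ler_pdivrMr// mul1r ler_nat.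
Qed.

Lemma has_sum_cons (f : seq T -> R) C : abs_bounded f C -> f [::] = 0 ->
  has_sum (fun m => tsum (fun w => f (m :: w))) (tsum f).
Proof.
move=> fC f0; have hs := abs_bounded_tsum fC => e e0.
have e2 : 0 < e / 2 by rewrite divr_gt0.
have [l0 h0] := hs _ e2.
exists (flatten l0) => la ula sub.
have k0 : 0 < e / 2 / (size la).+1%:R by rewrite divr_gt0.
have fin m : exists lb : seq (seq T), forall l, uniq l -> {subset lb <= l} ->
    `|\sum_(w <- l) f (m :: w) - tsum (fun w => f (m :: w))| <= e / 2 / (size la).+1%:R.
  have fmC : abs_bounded (fun w => f (m :: w)) C.
    move=> l ul; have := fC [seq m :: w | w <- l]; rewrite big_map; apply.
    by rewrite map_inj_uniq// => x y [].
  exact: (abs_bounded_tsum fmC).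
have [LB hLB] := choice fin.
(* lb is large enough for the inner sums at all m in la, and the grid of la and lb
   contains all the nonempty words of l0. *)
pose lb := undup (flatten [seq LB m | m <- la] ++ [seq behead w | w <- l0]).
have ulb : uniq lb by exact: undup_uniq.
pose P := [seq m :: w | m <- la, w <- lb].
have uP : uniq P by apply: allpairs_uniq => // -[x y] [x' y'] _ _ [-> ->].
have key : \sum_(w <- P) f w = \sum_(m <- la) \sum_(w <- lb) f (m :: w) by rewrite big_allpairs_dep.
have b1 : `|\sum_(w <- P) f w - tsum f| <= e / 2.
  have -> : \sum_(w <- P) f w = \sum_(w <- [::] :: P) f w by rewrite big_cons f0 add0r.
  apply: h0.
    by rewrite /= uP andbT; apply/negP => /allpairsP[[x y] []].
  move=> [|m w] wl; first by rewrite mem_head.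
  rewrite inE/=; apply/allpairsP; exists (m, w) => /=; split=> //.
    by apply: sub; apply/flattenP; exists (m :: w) => //; rewrite mem_head.
  by rewrite mem_undup mem_cat; apply/orP; right; apply/mapP; exists (m :: w).
have b2 : `|\sum_(m <- la) tsum (fun w => f (m :: w)) - \sum_(w <- P) f w| <= e / 2.
  rewrite key -sumrB; apply: (le_trans (ler_norm_sum _ _ _)).
  apply: (@le_trans _ _ (\sum_(m <- la) (e / 2 / (size la).+1%:R))).
    rewrite !big_seq; apply: ler_sum => m ml; rewrite distrC; apply: hLB => // w wl.
    rewrite mem_undup mem_cat; apply/orP; left; apply/flattenP; exists (LB m) => //.
    exact: map_f.
  exact/sum_share_le/ltW.
have := lerD b2 b1; rewrite -splitr; apply: le_trans.
by apply: le_trans (ler_normD _ _); rewrite addrA subrK.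
Qed.

Lemma chas_sum_cons (f : seq T -> R[i]) M C : abs_bounded M C -> (forall w, normc (f w) <= M w) ->
  f [::] = 0 -> chas_sum (fun m => csum (fun w => f (m :: w))) (csum f).
Proof.
move=> MC fM f0; split; apply: (@has_sum_cons _ C); rewrite ?f0//.
- apply: abs_bounded_le MC => s; exact: le_trans (ler_Re_normc _) (le_trans (fM s) (ler_norm _)).
- apply: abs_bounded_le MC => s; exact: le_trans (ler_Im_normc _) (le_trans (fM s) (ler_norm _)).
Qed.

End FirstLetter.

Lemma l2norm_le (R : realType) (n : nat) (f : vfun R n) (K : R) :
  (forall i, ccont (fun l => f l i 0)) -> 0 <= K -> (forall l i, normc (f l i 0) <= K) ->
  l2norm f <= n%:R * K.
Proof.
move=> fcont K0 fK; have f2 : L2 f by move=> i; exact: ccont_csquare (fcont i).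
rewrite -(ler_pXn2r (ltn0Sn 1)) ?nnegrE ?l2norm_ge0 ?mulr_ge0// l2norm_msq//.
apply: (@le_trans _ _ (\sum_(i < n) K ^+ 2)).
  apply: ler_sum => i _; have c2 := ccont_csquare (ccont_cst (K%:C%C)).
  apply: le_trans (msq_le (ccont_csquare (fcont i)) c2 _) _.
    by move=> l; rewrite normcR ger0_norm// ler_pXn2r ?nnegrE ?normc_ge0.
  by rewrite /msq mulJ normcR ger0_norm// cmean_cst.
rewrite sumr_const card_ord -[leLHS]mulr_natl exprMn ler_wpM2r ?sqr_ge0//.
by rewrite -natrX ler_nat; case: (n) => // k; rewrite expnS expn1 leq_pmulr.
Qed.

Section FourierSeries.
Variables (R : realType).
Implicit Types (h : circle R -> R[i]) (m k : int).

Lemma circle_normc_expz (l : circle R) m : normc (val l ^ m) = 1.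
Proof. by have [t _ ->] := expi_surj l; rewrite expi_expz circle_normc. Qed.

Lemma fc_le h k C : ccont h -> (forall l, normc (h l) <= C) -> normc (fc h k) <= C.
Proof.
move=> hc hC; have C0 : 0 <= C by apply: le_trans (hC (circle1 R)); exact: normc_ge0.
pose f : vfun R 1 := fun l => \col_(_ < 1) h l.
have fE : (fun l => f l 0 0) = h by apply/funext => l; rewrite mxE.
have f2 : L2 f by apply/L2_csquare => i; rewrite ord1 fE; exact: ccont_csquare.
have := fourier_bound k 0 f2; rewrite fourierE fE => /le_trans; apply.
rewrite -[C]mul1r; apply: (@l2norm_le R 1) => // [i|l i]; first by rewrite ord1 fE.
by rewrite mxE.
Qed.

Variables (T : eqType) (phi : T -> circle R -> R[i]) (M : T -> R) (C : R).
Hypothesis phic : forall s, ccont (phi s).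
Hypothesis phiM : forall s l, normc (phi s l) <= M s.
Hypothesis MC : abs_bounded M C.

Lemma ccont_csum : ccont (fun l => csum (phi^~ l)).
Proof.
have hs l := abs_chas_sum MC (phiM^~ l).
split=> t.
- apply: (has_sum_cvg (phi := fun s t => complex.Re (phi s (expi t))) (nbhs_pfilter t) MC _ _ _ (hs _).1).
  + by move=> s; exact: (phic s).1.
  + by near=> x => s; exact: le_trans (ler_Re_normc _) (phiM s _).
  + by near=> x; exact: (hs _).1.
- apply: (has_sum_cvg (phi := fun s t => complex.Im (phi s (expi t))) (nbhs_pfilter t) MC _ _ _ (hs _).2).
  + by move=> s; exact: (phic s).2.
  + by near=> x => s; exact: le_trans (ler_Im_normc _) (phiM s _).
  + by near=> x; exact: (hs _).2.
Unshelve. all: by end_near. Qed.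

Lemma fc_csum k : fc (fun l => csum (phi^~ l)) k = csum (fun s => fc (phi s) k).
Proof.
apply/eqP; rewrite -subr_eq0; apply/eqP/normc_small => e e0.
have [l0 _ h] := csum_uniform MC (divr_gt0 e0 (ltr0n R 2)).
have fM s : normc (fc (phi s) k) <= M s by exact: fc_le.
have a1 := h _ fM.
have cs : ccont (fun l => \sum_(s <- l0) phi s l) by exact: ccont_sum.
have cd : ccont (fun l => csum (phi^~ l) + (-1) * \sum_(s <- l0) phi s l).
  by apply: ccontD; [exact: ccont_csum|apply: ccontM => //; exact: ccont_cst].
have a2 : normc (fc (fun l => csum (phi^~ l) + (-1) * \sum_(s <- l0) phi s l) k) <= e / 2.
  by apply: fc_le => // l; rewrite mulN1r; exact: h.
move: a2; rewrite fcD; [|exact/ccont_csquare/ccont_csum|apply: csquareZ; exact: ccont_csquare].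
rewrite fcZ ?fc_sum; [|by move=> s _; exact: ccont_csquare|exact: ccont_csquare].
rewrite mulN1r => a2; have := lerD a2 a1; rewrite -splitr; apply: le_trans.
rewrite -[normc (csum _ - _)]normcN; apply: le_trans (normcD _ _).
by rewrite opprB addrA subrK.
Qed.

End FourierSeries.

(** The sum of the series is continuous and has the same Fourier coefficients. *)
Lemma fourier_series (R : realType) (h : circle R -> R[i]) (M : int -> R) C l : ccont h ->
  abs_bounded M C -> (forall m, normc (fc h m) <= M m) ->
  chas_sum (fun m => val l ^ m * fc h m) (h l).
Proof.
move=> hc MC hM.
have phic m : ccont (fun l => val l ^ m * fc h m).
  by apply: ccontM; [exact: ccont_expz|exact: ccont_cst].
have phiM m (k : circle R) : normc (val k ^ m * fc h m) <= M m.
  by rewrite normcM circle_normc_expz mul1r.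
pose g (l : circle R) := csum (fun m => val l ^ m * fc h m).
have gc : ccont g := ccont_csum phic phiM MC.
suff -> : h l = g l by exact: abs_chas_sum MC (phiM^~ l).
suff : (fun l => h l + (-1) * g l) =1 (fun=> 0).
  by move=> /(_ l); rewrite mulN1r => /eqP; rewrite subr_eq0 => /eqP.
apply: ccont_fc_eq0.
  by apply: ccontD => //; apply: ccontM => //; exact: ccont_cst.
move=> k; rewrite fcD; [|exact: ccont_csquare|apply: csquareZ; exact: ccont_csquare].
rewrite fcZ; last exact: ccont_csquare.
rewrite /g (fc_csum phic phiM MC).
suff -> : csum (fun m => fc (fun l => val l ^ m * fc h m) k) = fc h k by rewrite mulN1r subrr.
apply: csumE.
have := chas_sum1 k (fc h k); congr (chas_sum _ _); apply/funext => m.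
have -> : (fun l : circle R => val l ^ m * fc h m) = (fun l => fc h m * val l ^ m).
  by apply/funext => x; exact: mulrC.
rewrite fcZ ?fc_expz; last exact/ccont_csquare/ccont_expz.
by rewrite [RHS]mulrC [k == m]eq_sym; case: eqP => [->|_]; rewrite ?mul1r ?mul0r.
Qed.

(** * The analytic factor *)

Section RealMatrix.
Variables (R : realType) (n : nat).
Implicit Types A B : 'M[R[i]]_n.

(** Complex matrices as real ones of twice the size, so that the calculus of words
    over the reals applies to complex letters. *)
Definition realmx A : 'M[R]_(n + n) :=
  let r := \matrix_(i, j) complex.Re (A i j) in let s := \matrix_(i, j) complex.Im (A i j) in
  block_mx r (- s) s r.

Lemma realmxM A B : realmx (A *m B) = realmx A *m realmx B.
Proof.
rewrite /realmx mulmx_block; congr block_mx; apply/matrixP => i j.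
- rewrite !mxE cRe_sum -big_split/=; apply: eq_bigr => k _; rewrite cReM !mxE; ring.
- rewrite !mxE cIm_sum -sumrN -big_split/=; apply: eq_bigr => k _; rewrite cImM !mxE; ring.
- rewrite !mxE cIm_sum -big_split/=; apply: eq_bigr => k _; rewrite cImM !mxE; ring.
- rewrite !mxE cRe_sum -big_split/=; apply: eq_bigr => k _; rewrite cReM !mxE; ring.
Qed.

Lemma realmx1 : realmx 1%:M = 1%:M.
Proof.
rewrite /realmx [RHS]scalar_mx_block; congr block_mx; apply/matrixP => i j; rewrite !mxE;
  case: (i == j) => //=; rewrite oppr0//.
Qed.

Lemma word_realmx (T : Type) (b : T -> 'M[R[i]]_n) w :
  word (fun m => realmx (b m)) w = realmx (word b w).
Proof. by elim: w => [|m w IH]; rewrite ?realmx1// !word_cons IH realmxM. Qed.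

Lemma realmx_le A c i j : (forall i j, normc (A i j) <= c) -> `|realmx A i j| <= c.
Proof.
move=> Ac; rewrite -(fintype.splitK i) -(fintype.splitK j) /realmx.
case: (fintype.split i) => a; case: (fintype.split j) => b /=.
- by rewrite block_mxEul mxE; exact: le_trans (ler_Re_normc _) (Ac _ _).
- by rewrite block_mxEur !mxE normrN; exact: le_trans (ler_Im_normc _) (Ac _ _).
- by rewrite block_mxEdl mxE; exact: le_trans (ler_Im_normc _) (Ac _ _).
- by rewrite block_mxEdr mxE; exact: le_trans (ler_Re_normc _) (Ac _ _).
Qed.

End RealMatrix.

Lemma const_contracting (R : realType) (T : eqType) N (eps : T -> R) (theta : R) :
  (forall m, 0 <= eps m) -> 0 <= theta < 1 ->
  (forall l, uniq l -> N%:R * \sum_(m <- l) eps m <= theta) ->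
  contracting (fun m => const_mx (eps m) : 'M[R]_N) (fun=> 1) theta.
Proof.
move=> e0 th sm; split=> // [m i j|i l ul]; first by rewrite mxE.
rewrite mulr1; apply: le_trans (sm l ul).
rewrite mulr_sumr; apply: ler_sum => m _.
under eq_bigr do rewrite mxE mulr1.
by rewrite sumr_const card_ord mulr_natl.
Qed.

Section AnalyticFactor.
Variables (R : realType) (n : nat).
Implicit Types (l : circle R) (w : seq int) (P : pred (seq int)).

Definition freq w : int := \sum_(m <- w) m.

(** A word in letters [val l ^ m *: A m] is a multiple of [val l] to the power of
    its frequency. Asking every tail to have nonnegative frequency makes the
    class grow letter by letter on the left. *)
Fixpoint analytic_word w : bool :=
  if w is m :: w' then (0 <= freq w) && analytic_word w' else true.

Definition letter (A : int -> 'M[R[i]]_n) l m : 'M[R[i]]_n := val l ^ m *: A m.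

Lemma word_letter A l w : word (letter A l) w = val l ^ freq w *: word A w.
Proof.
elim: w => [|m w IH]; first by rewrite /freq big_nil expr0z scale1r.
rewrite !word_cons IH /letter -scalemxAl -scalemxAr scalerA /freq big_cons.
by rewrite expfzDr ?circle_neq0.
Qed.

Definition letter_sum P A l : 'M[R[i]]_n :=
  \matrix_(i, j) csum (fun w => (P w)%:R * word (letter A l) w i j).

Variables (A : int -> 'M[R[i]]_n) (eps : int -> R) (theta : R).
Hypothesis Aeps : forall m i j, normc (A m i j) <= eps m.
Hypothesis ctr : contracting (fun m => const_mx (eps m) : 'M[R]_n) (fun=> 1) theta.
Local Notation beta := (fun m => const_mx (eps m) : 'M[R]_n).

Lemma letter_normc l m i j : normc (letter A l m i j) = normc (A m i j).
Proof. by rewrite mxE normcM circle_normc_expz mul1r. Qed.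

Lemma letter_word_le l w i j : normc (word (letter A l) w i j) <= word beta w i j.
Proof.
elim: w i => [|m w IH] i; first by rewrite !mxE; case: (i == j); rewrite ?normc1 ?normc0.
rewrite !word_cons !mxE; apply: (le_trans (normc_sum _ _ _)).
apply: ler_sum => k _; rewrite normcM letter_normc mxE.
by apply: ler_pM => //; exact: normc_ge0.
Qed.

Let beta_bounded i j : abs_bounded (fun w => word beta w i j) (1 - theta)^-1.
Proof. by have := word_abs_bounded i j ctr; rewrite mulr1 divr1. Qed.

Let term_le P l i j w : normc ((P w)%:R * word (letter A l) w i j) <= word beta w i j.
Proof.
have [_ _ b0 _] := ctr.
case: (P w); first by rewrite mul1r letter_word_le.
by rewrite mul0r normc0 word_ge0.
Qed.

Lemma letter_sum_has P l i j :
  chas_sum (fun w => (P w)%:R * word (letter A l) w i j) (letter_sum P A l i j).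
Proof. by rewrite mxE; exact: abs_chas_sum (beta_bounded i j) (term_le P l i j). Qed.

Let term_cont P i j w : ccont (fun l => (P w)%:R * word (letter A l) w i j).
Proof.
apply: ccontM; first exact: ccont_cst.
under eq_fun do rewrite word_letter mxE.
by apply: ccontM; [exact: ccont_expz|exact: ccont_cst].
Qed.

Lemma letter_sum_cont P : mcont (letter_sum P A).
Proof.
move=> i j; under eq_fun do rewrite mxE.
exact: ccont_csum (term_cont P i j) (fun s l => term_le P l i j s) (beta_bounded i j).
Qed.

(** The sum may be integrated term by term, and each word has a single frequency. *)
Lemma letter_sum_fc P k i j : (forall w, P w -> freq w != k) ->
  fc (fun l => letter_sum P A l i j) k = 0.
Proof.
move=> Pk; under [X in fc X]eq_fun do rewrite mxE.
rewrite (fc_csum (term_cont P i j) (fun s l => term_le P l i j s) (beta_bounded i j)).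
apply: csumE; rewrite (_ : (fun s => _) = fun=> 0); first exact: chas_sum0.
apply/funext => w.
rewrite (_ : (fun l => _) = fun l => ((P w)%:R * word A w i j) * val l ^ freq w); last first.
  by apply/funext => l; rewrite word_letter mxE; ring.
rewrite fcZ ?fc_expz; last exact/ccont_csquare/ccont_expz.
have [Pw|_] := boolP (P w); last by rewrite !mul0r.
by rewrite eq_sym (negbTE (Pk w Pw)) mulr0.
Qed.

(** A word [m :: w] with analytic tail is analytic unless its frequency is
    negative, so multiplying the analytic sum by the letters reproduces it up to
    the empty word and words of negative frequency. *)
Definition negative_word w : bool :=
  if w is m :: w' then analytic_word w' && (freq w < 0) else false.

Lemma analytic_freq w : analytic_word w -> 0 <= freq w.
Proof. by case: w => [|m w /andP[]//] _; rewrite /freq big_nil. Qed.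

Lemma negative_freq w : negative_word w -> freq w < 0.
Proof. by case: w => [//|m w /andP[]]. Qed.

Lemma letter_sum_factor (B : 'M[R[i]]_n) l :
  (forall i j, chas_sum (fun m => letter A l m i j) (B i j)) ->
  (1%:M - B) *m letter_sum analytic_word A l = 1%:M - letter_sum negative_word A l.
Proof.
move=> hB; pose P' w := if w is m :: w' then analytic_word w' else false.
have BP : B *m letter_sum analytic_word A l = letter_sum P' A l.
  apply/matrixP => i j; rewrite mxE.
  have h1 : chas_sum (fun m => \sum_p letter_sum analytic_word A l p j * letter A l m i p)
     (\sum_p B i p * letter_sum analytic_word A l p j).
    under eq_bigr do rewrite mulrC.
    by apply: chas_sum_big => p; apply: chas_sumZ; exact: hB.
  have h2 : chas_sum (fun m => csum (fun w => (P' (m :: w))%:R * word (letter A l) (m :: w) i j))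
      (letter_sum P' A l i j).
    have := @chas_sum_cons R int (fun w => (P' w)%:R * word (letter A l) w i j) _ _ (beta_bounded i j) (term_le P' l i j).
    rewrite mul0r => /(_ erefl) h; have := h; congr (chas_sum _ _).
    by rewrite mxE.
  apply: chas_sum_unique h1 _; have := h2; congr (chas_sum _ _); apply/funext => m.
  apply: csumE.
  have := chas_sum_big (index_enum 'I_n) (fun p => chas_sumZ (letter A l m i p) (letter_sum_has analytic_word l p j)).
  congr (chas_sum _ _); last by apply: eq_bigr => p _; rewrite mulrC.
  apply/funext => w; rewrite word_cons mxE mulr_sumr.
  by apply: eq_bigr => p _; rewrite mulrCA.
rewrite mulmxBl mul1mx BP; apply/matrixP => i j.
have h1 := chas_sumD (letter_sum_has analytic_word l i j)
  (chas_sumZ (-1) (letter_sum_has P' l i j)).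
have h2 := chas_sumD (chas_sum1 ([::] : seq int) ((1%:M : 'M[R[i]]_n) i j))
  (chas_sumZ (-1) (letter_sum_has negative_word l i j)).
have : letter_sum analytic_word A l i j + -1 * letter_sum P' A l i j =
  (1%:M : 'M[R[i]]_n) i j + -1 * letter_sum negative_word A l i j.
  apply: chas_sum_unique h1 _; have := h2; congr (chas_sum _ _); apply/funext => -[|m w] /=.
    by [].
  (* A nonempty word with analytic tail is either analytic or negative. *)
  rewrite ltNge; case: (analytic_word w); case: (0 <= _) => /=; ring.
by rewrite !mulN1r !mxE.
Qed.

(** Only the nonempty words contribute to the difference; by the geometric series
    they sum to [(1 - theta)^-1 - 1]. *)
Lemma letter_sum_near1 l i j :
  normc (letter_sum analytic_word A l i j - (1%:M : 'M[R[i]]_n) i j) <= theta / (1 - theta).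
Proof.
have [/andP[th0 th1] _ b0 _] := ctr.
have t1 : 1 - theta != 0 by rewrite subr_eq0 eq_sym lt_eqF.
pose f w := (analytic_word w && (w != [::]))%:R * word (letter A l) w i j.
pose M w := (w != [::])%:R * word beta w i j.
have fM w : normc (f w) <= M w.
  rewrite /f /M; case: (w != [::]); rewrite ?andbT ?andbF; last by rewrite !mul0r normc0.
  by rewrite mul1r; exact: (term_le analytic_word).
have MC : abs_bounded M (theta / (1 - theta)).
  move=> ws uws; pose vs := [seq w <- ws | w != [::]].
  have uv : uniq ([::] :: vs) by rewrite /= filter_uniq// mem_filter eqxx.
  have := word_sum_bound i ctr uv; rewrite big_cons mulr1.
  have -> : \sum_(k < n) word beta [::] i k * 1 = 1.
    by rewrite (bigD1 i)//= big1 ?mxE ?eqxx ?mul1r ?addr0// => k ki; rewrite mxE eq_sym (negbTE ki) mul0r.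
  have -> : \sum_(w <- ws) `|M w| = \sum_(w <- vs) word beta w i j.
    rewrite big_filter [RHS]big_mkcond/=; apply: eq_bigr => w _; rewrite /M.
    by case: (w != [::]); rewrite ?mul1r ?mul0r ?normr0// ger0_norm// word_ge0.
  have : \sum_(w <- vs) word beta w i j <= \sum_(w <- vs) \sum_k word beta w i k * 1.
    apply: ler_sum => w _; rewrite (bigD1 j)//= mulr1 lerDl sumr_ge0// => k _.
    by rewrite mulr1 word_ge0.
  have E : (1 - theta)^-1 = 1 + theta / (1 - theta) by field.
  by move=> h1 h2; apply: le_trans h1 _; rewrite -(lerD2l 1) -E.
have -> : letter_sum analytic_word A l i j - (1%:M : 'M[R[i]]_n) i j = csum f.
  symmetry; apply: csumE; rewrite -mulN1r.
  have := chas_sumD (letter_sum_has analytic_word l i j)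
    (chas_sumZ (-1) (chas_sum1 ([::] : seq int) ((1%:M : 'M[R[i]]_n) i j))).
  congr (chas_sum _ _); apply/funext => -[|m w]; rewrite /f ?eqxx/=.
    by ring.
  by rewrite andbT; ring.
exact: normc_csum_le MC fM.
Qed.

Lemma letter_sum_real P l i j :
  complex.Re (letter_sum P A l i j) =
    tsum (fun w => (P w)%:R * word (fun m => realmx (letter A l m)) w (lshift n i) (lshift n j)) /\
  complex.Im (letter_sum P A l i j) =
    tsum (fun w => (P w)%:R * word (fun m => realmx (letter A l m)) w (rshift n i) (lshift n j)).
Proof.
rewrite mxE /csum /=; split; congr tsum; apply/funext => w.
all: rewrite word_realmx /realmx ?block_mxEul ?block_mxEdl mxE.
all: have -> : (P w)%:R = ((P w)%:R : R)%:C%C by case: (P w).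
  by rewrite cReM /=; ring.
by rewrite cImM /=; ring.
Qed.

End AnalyticFactor.

(** * Perturbations of the identity on the Hardy space *)

Section NearIdentity.
Variables (R : realType) (n : nat).
Implicit Types (f g k : vfun R n) (A B H : circle R -> 'M[R[i]]_n).

(** A row vector killed by a matrix close to the identity has an l^1 norm at most
    half of itself. *)
Lemma near1_unitmx (A : 'M[R[i]]_n) (c : R) : n%:R * c <= 1 / 2 ->
  (forall i j, normc (A i j - (1%:M : 'M[R[i]]_n) i j) <= c) -> A \in unitmx.
Proof.
move=> nc Ac; rewrite -row_free_unit -kermx_eq0; apply/negPn/negP => /rowV0Pn[v /sub_kermxP vA].
apply/negP; rewrite negbK; apply/eqP.
have e j : v 0 j = - \sum_i v 0 i * (A i j - (1%:M : 'M[R[i]]_n) i j).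
  have -> : \sum_i v 0 i * (A i j - (1%:M : 'M[R[i]]_n) i j) = (v *m A) 0 j - (v *m 1%:M) 0 j.
    by rewrite !mxE -sumrB; apply: eq_bigr => i _; rewrite mulrBr.
  by rewrite vA mulmx1 mxE sub0r opprK.
have S : \sum_j normc (v 0 j) <= n%:R * c * \sum_j normc (v 0 j).
  apply: (@le_trans _ _ (\sum_(j < n) c * \sum_i normc (v 0 i))).
    apply: ler_sum => j _; rewrite {1}e normcN; apply: (le_trans (normc_sum _ _ _)).
    rewrite mulr_sumr; apply: ler_sum => i _; rewrite normcM mulrC.
    by apply: ler_wpM2r => //; exact: normc_ge0.
  by rewrite sumr_const card_ord -[X in X <= _]mulr_natl mulrA.
have S0 : 0 <= \sum_j normc (v 0 j) by apply: sumr_ge0 => j _; exact: normc_ge0.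
have {}S : \sum_j normc (v 0 j) = 0.
  apply/eqP; rewrite eq_le S0 andbT.
  have := ler_wpM2r S0 nc; lra.
apply/rowP => j; rewrite mxE; apply: normc_eq0; apply/eqP; rewrite eq_le normc_ge0 andbT.
rewrite -S (bigD1 j)//= lerDl; apply: sumr_ge0 => i _; exact: normc_ge0.
Qed.

Lemma ccontV (h : circle R -> R[i]) : (forall l, h l != 0) -> ccont h -> ccont (fun l => (h l)^-1).
Proof.
move=> h0 hc; have [hr hi] := hc; have hJ := ccontJ hc.
pose N l := complex.Re (h l) * complex.Re (h l) + complex.Im (h l) * complex.Im (h l).
have N0 l : N l != 0.
  have := h0 l; apply: contra.
  by rewrite /N -!expr2 -normcE2 sqrf_eq0 => /eqP /normc_eq0 ->.
have cN : ccont (fun l => ((N l)^-1)%:C%C).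
  split=> t /=; last exact: cvg_cst.
  apply: cvgV; first exact: N0.
  by apply: cvgD; apply: cvgM; (exact: hr || exact: hi).
have := ccontM hJ cN; congr ccont; apply/funext => l.
apply: (mulfI (h0 l)); rewrite divff ?h0// mulrA mulJ -rmorphM /=.
by rewrite normcE2 !expr2 divff// N0.
Qed.

Lemma ccont_prod (I : Type) (r : seq I) (P : pred I) (F : I -> circle R -> R[i]) :
  (forall i, ccont (F i)) -> ccont (fun l => \prod_(i <- r | P i) F i l).
Proof.
move=> FI; elim: r => [|i r IH].
  by under eq_fun do rewrite big_nil; exact: ccont_cst.
under eq_fun do rewrite big_cons.
by have [Pi|Pi] := boolP (P i); rewrite ?Pi ?(negbTE Pi)//; exact: ccontM.
Qed.

Lemma ccont_det m (A : circle R -> 'M[R[i]]_m) : (forall i j, ccont (fun l => A l i j)) ->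
  ccont (fun l => \det (A l)).
Proof.
move=> Ac; apply: ccont_sum => s _; apply: ccontM; first exact: ccont_cst.
by apply: ccont_prod => i; exact: Ac.
Qed.

(** Cramer's rule. *)
Lemma mcontV A : (forall l, A l \in unitmx) -> mcont A -> mcont (fun l => invmx (A l)).
Proof.
move=> Au Ac i j.
have s : ccont (fun l => (\det (A l))^-1 * ((-1) ^+ (j + i) * \det (row' j (col' i (A l))))).
  apply: ccontM.
    by apply: ccontV; [move=> l; rewrite -unitfE -unitmxE|exact: ccont_det].
  apply: ccontM; first exact: ccont_cst.
  by apply: ccont_det => a b; under eq_fun do rewrite !mxE; exact: Ac.
have := s; congr ccont; apply/funext => l.
by rewrite /invmx Au !mxE /cofactor.
Qed.

Lemma mcontB A B : mcont A -> mcont B -> mcont (fun l => A l - B l).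
Proof.
move=> Ac Bc i j; under eq_fun do rewrite !mxE.
by apply: ccontD; [exact: Ac|apply: ccontN; exact: Bc].
Qed.

Lemma mcont_cst (C : 'M[R[i]]_n) : mcont (fun=> C).
Proof. by move=> i j; exact: ccont_cst. Qed.

Lemma mcontM A B : mcont A -> mcont B -> mcont (fun l => A l *m B l).
Proof.
move=> Ac Bc i j; under eq_fun do rewrite mxE.
by apply: ccont_sum => k _; apply: ccontM; [exact: Ac|exact: Bc].
Qed.

Lemma mulMA A B f : mulM A (mulM B f) = mulM (fun l => A l *m B l) f.
Proof. by apply/funext => l; rewrite /mulM mulmxA. Qed.

(** The Neumann series keeps the inverse of an analytic perturbation of the
    identity analytic. *)
Lemma near1_hardy H (c : R) : mcont H -> n%:R * c <= 1 / 2 -> 0 <= c ->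
  (forall l i j, normc (H l i j - (1%:M : 'M[R[i]]_n) i j) <= c) ->
  (forall i j m, m < 0 -> fc (fun l => H l i j) m = 0) ->
  mulM H @` @hardy R n = @hardy R n.
Proof.
move=> Hc nc c0 Hb Hneg; have Hu l : H l \in unitmx by exact: near1_unitmx nc (Hb l).
apply/seteqP; split=> [_ [f hf <-]|f hf]; first exact: hardy_mulM.
exists (mulM (fun l => invmx (H l)) f); last first.
  by apply/funext => l; rewrite mulMA /mulM mulmxV ?mul1mx.
pose g := mulM (fun l => invmx (H l)) f; rewrite -/g.
have [f2 _] := hf; have g2 : L2 g by apply: L2_mulM => //; exact: mcontV.
pose K l : 'M[R[i]]_n := 1%:M - H l.
have Kc : mcont K by apply: mcontB => //; exact: mcont_cst.
have Kb l i j : normc (K l i j) <= c by rewrite -normcN; have := Hb l i j; rewrite !mxE opprB.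
have gE l : g l = f l + K l *m g l.
  by rewrite /K mulmxBl mul1mx {3}/g /mulM mulmxA mulmxV ?mul1mx// addrC subrK.
have Kneg i j m : m < 0 -> fc (fun l => K l i j) m = 0.
  move=> m0; rewrite (_ : (fun l => _) = fun l => (1%:M : 'M[R[i]]_n) i j + (-1) * H l i j); last first.
    by apply/funext => l; rewrite !mxE mulN1r.
  rewrite fcD ?fcZ ?fc_cst; [|exact/ccont_csquare/Hc|exact/ccont_csquare/ccont_cst|exact/csquareZ/ccont_csquare/Hc].
  by rewrite Hneg// mulr0 lt_eqF// mul0r addr0.
have [_ h0 hlin hcl] := @hardy_closed R n.
(* The partial sums of the Neumann series, which solves g = f + K g. *)
pose s N := iter N (fun k l => f l + K l *m k l) (fun=> 0).
have sh N : hardy (s N).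
  elim: N => [|N IH]; first exact: h0.
  have := hlin 1 _ _ hf (hardy_mulM Kc Kneg IH).
  by congr hardy; apply/funext => l; rewrite scale1r.
have sn N : l2norm (fun l => g l - s N l) <= (1 / 2) ^+ N * l2norm g.
  elim: N => [|N IH].
    rewrite expr0 mul1r (_ : (fun l => _) = g)//.
    by apply/funext => l; rewrite subr0.
  rewrite (_ : (fun l => _) = mulM K (fun l => g l - s N l)); last first.
    apply/funext => l; rewrite {1}gE /mulM mulmxBr /=.
    by rewrite opprD addrACA subrr add0r.
  have d2 : L2 (fun l => g l - s N l) by apply: L2B => //; have [] := sh N.
  apply: (le_trans (l2norm_mulM Kc Kb c0 d2)).
  rewrite exprS -[leRHS]mulrA; apply: (ler_pM _ _ nc IH).
    by rewrite mulr_ge0.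
  exact: l2norm_ge0.
apply: hcl => // e e0.
have g1 : 0 < l2norm g + 1 by rewrite ltr_wpDl// l2norm_ge0.
have /cvgrPdist_lt/(_ _ (divr_gt0 e0 g1)) : (1 / 2 : R) ^+ N @[N --> \oo] --> 0.
  by apply: cvg_expr; rewrite ger0_norm; lra.
move=> [N _ /(_ N (leqnn N))]; rewrite sub0r normrN ger0_norm ?exprn_ge0 ?divr_ge0// => hN.
exists (s N) => //; apply: le_lt_trans (sn N) _.
move: hN; rewrite ltr_pdivlMr//; apply: le_lt_trans.
by rewrite ler_wpM2l ?exprn_ge0 ?divr_ge0// lerDl.
Qed.

(** Analytic polynomials are dense in the Hardy space and orthogonal to negative
    frequencies. *)
Lemma inner_negative_hardy k g : L2 k -> (forall m i, 0 <= m -> fourier k m i = 0) -> hardy g ->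
  inner k g = 0.
Proof.
move=> k2 kn hg; have [g2 _] := hg.
apply: normc_small => e e0.
have K1 : 0 < l2norm k + 1 by rewrite ltr_wpDl// l2norm_ge0.
have [c [c0 hc]] := hardy_approx hg (divr_gt0 e0 K1).
pose p : vfun R n := fun l => \col_i tp (c i) l.
have p2 : L2 p.
  by apply/L2_csquare => i; under eq_fun do rewrite mxE; exact/ccont_csquare/ccont_tp.
have d2 : L2 (fun l => g l - p l) by exact: L2B.
have kp : inner k p = 0.
  rewrite /inner big1// => i _.
  rewrite (_ : (fun l => _) = fun l => k l i 0 * (tp (c i) l)^*); last first.
    by apply/funext => l; rewrite mxE.
  rewrite mean_mul_tpJ; last exact: k2.
  rewrite big_seq big1// => x xc; rewrite -fourierE kn ?mulr0//; exact: c0 xc.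
have -> : inner k g = inner k (fun l => g l - p l).
  have e1 : g = fun l => p l + (g l - p l) by apply/funext => l; rewrite addrC subrK.
  by rewrite {1}e1 innerDr// kp add0r.
apply: (le_trans (CauchySchwarz k2 d2)).
apply: (@le_trans _ _ ((l2norm k + 1) * (e / (l2norm k + 1)))).
  by apply: ler_pM; rewrite ?l2norm_ge0 ?lerDl ?(ltW hc).
by rewrite mulrC divfK// gt_eqF.
Qed.

(** If [1 - B] maps the Hardy function [g] to purely negative frequencies, then
    [g] and [B g] have the same inner product with [g], and [B] is small. *)
Lemma near1_kernel B g (c : R) : mcont B -> n%:R * c <= 1 / 2 -> 0 <= c ->
  (forall l i j, normc (B l i j) <= c) -> hardy g ->
  (forall m i, 0 <= m -> fourier (mulM (fun l => 1%:M - B l) g) m i = 0) -> l2norm g = 0.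
Proof.
move=> Bc nc c0 Bb hg neg; have [g2 _] := hg.
have pc : mcont (fun l => 1%:M - B l) by apply: mcontB => //; exact: mcont_cst.
have i0 := inner_negative_hardy (L2_mulM pc g2) neg hg.
have Bg2 := L2_mulM Bc g2.
have gg : inner g g = inner (mulM B g) g.
  have {1}-> : g = fun l => mulM (fun l => 1%:M - B l) g l + mulM B g l.
    by apply/funext => l; rewrite /mulM mulmxBl mul1mx subrK.
  by rewrite innerDl// ?i0 ?add0r//; exact: L2_mulM.
have h1 : l2norm g ^+ 2 <= 1 / 2 * l2norm g ^+ 2.
  rewrite {1}l2norm_sq// gg; apply: le_trans (ler_norm _) _.
  apply: (le_trans (ler_Re_normc _)); apply: (le_trans (CauchySchwarz Bg2 g2)).
  rewrite expr2 mulrA ler_wpM2r ?l2norm_ge0//.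
  apply: (le_trans (l2norm_mulM Bc Bb c0 g2)); rewrite ler_wpM2r ?l2norm_ge0//.
have h2 := sqr_ge0 (l2norm g).
apply/eqP; rewrite -sqrf_eq0; apply/eqP; lra.
Qed.

Lemma l2norm_ccont_eq0 f : (forall i, ccont (fun l => f l i 0)) -> l2norm f = 0 -> f =1 (fun=> 0).
Proof.
move=> fcont f0; have f2 : L2 f by move=> i; exact: ccont_csquare (fcont i).
move=> l; apply/colP => i; rewrite mxE.
apply: (ccont_fc_eq0 (fcont i)) => m; rewrite -fourierE.
apply: normc_eq0; apply/eqP; rewrite eq_le normc_ge0 andbT -f0; exact: fourier_bound.
Qed.

End NearIdentity.

(** * Smooth families on a Riemann surface *)

Lemma pair_cont (X U W : topologicalType) (f : X -> U) (g : X -> W) x :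
  {for x, continuous f} -> {for x, continuous g} -> {for x, continuous (fun y => (f y, g y))}.
Proof. by move=> fc gc; exact: (cvg_pair fc gc). Qed.

Lemma csmooth_local (R : realType) (E : normedModType R) (D : set E) (F : E -> R[i]) :
  (forall x, D x -> exists2 U, U x & csmooth U F) -> csmooth D F.
Proof.
move=> h; split; apply: smooth_on_local => k x Dx; have [U Ux [r i]] := h x Dx;
  by exists U.
Qed.

Section ComplexPlane.
Variable R : realType.
Local Notation E := (R * R * R)%type.
Implicit Types (q v : E) (z h : R[i]).

Lemma cnbhsP z (P : set (R[i]^o)) : nbhs (z : R[i]^o) P <->
  exists2 d : R, 0 < d & forall w, normc (w - z) < d -> P w.
Proof.
split=> [/nbhs_ballP[e /= e0 h]|[d d0 h]].
  have [e1' e2'] : complex.Im e = 0 /\ 0 < complex.Re e by move: e0; rewrite ltcE/= => /andP[/eqP -> ->].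
  exists (complex.Re e) => // w wd; apply: h; rewrite /ball/= distrC normcE1 ltcE/= e1' eqxx.
  by rewrite wd.
apply/nbhs_ballP; exists (d%:C%C); first by rewrite /= ltcR.
move=> w; rewrite /ball/= distrC normcE1 ltcR; exact: h.
Qed.

Definition point q : R[i] := Complex q.1.2 q.2.

Lemma near_point q d : 0 < d -> \forall p \near q, normc (point p - point q) < d.
Proof.
move=> d0; have d2 : 0 < d / 2 by rewrite divr_gt0.
have c1 : {for q, continuous (fun p : E => p.1.2)}.
  by apply: (@continuous_comp _ _ _ (fun p : E => p.1) snd); [exact: cvg_fst|exact: cvg_snd].
have c2 : {for q, continuous (fun p : E => p.2)} by exact: cvg_snd.
move/cvgrPdist_lt/(_ _ d2) : c1 => c1; move/cvgrPdist_lt/(_ _ d2) : c2 => c2.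
apply: filterS (filterI c1 c2) => p [h1 h2].
apply: (le_lt_trans (normc_ler_ReIm _)); rewrite cReD cImD cReN cImN /=.
by rewrite [d]splitr; apply: ltrD; rewrite distrC.
Qed.

(** The affine maps that freeze the angle ([a = 0]) or the point of the surface
    ([b = 0]). *)
Definition scale_shift (a b : R) (o : E) q : E := (a * q.1.1 + o.1.1, b * q.1.2 + o.1.2, b * q.2 + o.2).

Lemma scale_shiftE a b o q v (h : R) :
  scale_shift a b o (h *: v + q) = h *: (a * v.1.1, b * v.1.2, b * v.2) + scale_shift a b o q.
Proof.
case: q v => [[q1 q2] q3] [[v1 v2] v3]; rewrite /scale_shift /=.
transitivity (h * (a * v1) + (a * q1 + o.1.1), h * (b * v2) + (b * q2 + o.1.2),
  h * (b * v3) + (b * q3 + o.2)) => //.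
by rewrite /GRing.scale/=; congr (_, _, _); ring.
Qed.

Lemma scale_shift_cont a b o : continuous (scale_shift a b o).
Proof.
have c1 : continuous (fun p : E => p.1.1).
  by move=> q; apply: (@continuous_comp _ _ _ (fun p : E => p.1) fst); exact: cvg_fst.
have c2 : continuous (fun p : E => p.1.2).
  by move=> q; apply: (@continuous_comp _ _ _ (fun p : E => p.1) snd); [exact: cvg_fst|exact: cvg_snd].
have c3 : continuous (fun p : E => p.2) by move=> q; exact: cvg_snd.
move=> q; apply: (@pair_cont _ _ _ (fun q => (a * q.1.1 + o.1.1, b * q.1.2 + o.1.2))).
  apply: (@pair_cont _ _ _ (fun q => a * q.1.1 + o.1.1)).
    by apply: cvgD; [apply: cvgM; [exact: cvg_cst|exact: c1]|exact: cvg_cst].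
  by apply: cvgD; [apply: cvgM; [exact: cvg_cst|exact: c2]|exact: cvg_cst].
by apply: cvgD; [apply: cvgM; [exact: cvg_cst|exact: c3]|exact: cvg_cst].
Qed.

Lemma csmooth_scale_shift (D D' : set E) a b o (F : E -> R[i]) :
  (forall q, D' q -> D (scale_shift a b o q)) -> csmooth D F ->
  csmooth D' (fun q => F (scale_shift a b o q)).
Proof.
have aff x v (h : R) := scale_shiftE a b o x v h.
move=> DD [r i]; split=> k.
- exact: (Ck_on_comp_affine aff (@scale_shift_cont a b o) DD (r k)).
- exact: (Ck_on_comp_affine aff (@scale_shift_cont a b o) DD (i k)).
Qed.

End ComplexPlane.

Section Surfaces.
Variables (R : realType) (M : riemannSurface R).
Local Notation E := (R * R * R)%type.
Local Notation e1 := (e1 R).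
Implicit Types (c : chart R M) (N : set M) (q : E) (F : circle R -> M -> R[i]).

Definition chartset c N : set E := [set q | chart_codom c (point q) /\ N (chart_param c (point q))].

Lemma chartset_shift c N s q : chartset c N q -> chartset c N (s *: e1 + q).
Proof.
move=> [h1 h2]; have e : point (s *: e1 + q) = point q by rewrite /point e1E.
by split; rewrite e.
Qed.

Lemma near_param c N (z : R[i]) : atlas c -> open N -> chart_codom c z -> N (chart_param c z) ->
  exists2 d : R, 0 < d & forall w, normc (w - z) < d -> chart_codom c w /\ N (chart_param c w).
Proof.
move=> ac oN cz Nz; have [_ oc _ _ pc] := atlas_chart ac.
have n1 : nbhs (z : R[i]^o) (chart_codom c) by exact: open_nbhs_nbhs.
have n2 : nbhs (z : R[i]^o) (chart_param c @^-1` N).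
  by apply: (pc z _ N); [rewrite inE|exact: open_nbhs_nbhs].
by have [d d0 h] := (cnbhsP _ _).1 (filterI n1 n2); exists d.
Qed.

Lemma chartset_open c N : atlas c -> open N -> open (chartset c N).
Proof.
move=> ac oN; rewrite openE => q [cq Nq].
have [d d0 h] := near_param ac oN cq Nq.
by apply: filterS (near_point q d0) => p; exact: h.
Qed.

Lemma chartset_coord c N p : atlas c -> chart_dom c p -> N p -> forall t,
  chartset c N (t, complex.Re (chart_coord c p), complex.Im (chart_coord c p)) /\
  chart_param c (point (t, complex.Re (chart_coord c p), complex.Im (chart_coord c p))) = p.
Proof.
move=> ac cp Np t; have [_ _ K _ _] := atlas_chart ac.
have e : point (t, complex.Re (chart_coord c p), complex.Im (chart_coord c p)) = chart_coord c p.
  by rewrite /point /=; case: (chart_coord c p).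
by rewrite /chartset /= e K ?inE//; split => //; split=> //; exists p.
Qed.

Lemma smooth_ccont N F p : smooth_circle N F -> N p -> ccont (F^~ p).
Proof.
move=> sF Np; have [c ac cp] := atlas_cover p.
have C t := chartset_coord ac cp Np t.
have [r i] := sF c ac.
have lc t : {for t, continuous (fun t : R => (t, complex.Re (chart_coord c p), complex.Im (chart_coord c p)) : E)}.
  apply: (@pair_cont _ _ _ (fun t : R => (t, complex.Re (chart_coord c p)))); last exact: cvg_cst.
  by apply: (@pair_cont _ _ _ (fun t : R => t)); [exact: cvg_id|exact: cvg_cst].
split=> t.
- have := comp_cont (lc t) (smooth_on_cont r (C t).1).
  by rewrite /prop_for /continuous_at; under eq_fun do rewrite (C _).2; rewrite (C t).2.
- have := comp_cont (lc t) (smooth_on_cont i (C t).1).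
  by rewrite /prop_for /continuous_at; under eq_fun do rewrite (C _).2; rewrite (C t).2.
Qed.

End Surfaces.

Section UnitaryFrame.
Variables (R : realType) (M : riemannSurface R) (n : nat) (V : M -> set (vfun R n)).
Hypothesis V_closed : forall z : M, closed_subspace (V z).
Hypothesis V_shift : forall z : M, shift_invariant (V z).

(** Two continuous bases of the wandering space differ by a constant matrix, which
    the normalization at [1] cancels. *)
Lemma framepsi_unique (W : set (vfun R n)) (s s' : 'I_n -> vfun R n) :
  closed_subspace W -> shift_invariant W ->
  (forall j i, ccont (fun l => s j l i 0)) -> (forall j i, ccont (fun l => s' j l i 0)) ->
  l2_basis s (wandering W) -> l2_basis s' (wandering W) -> framepsi s =1 framepsi s'.
Proof.
move=> Wc Ws sc sc' sb sb'.
have /choice[c hc] : forall j, exists c : 'I_n -> R[i], forall l, s j l = \sum_k c k *: s' k l.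
  move=> j; have : wandering W (s j).
    have := wandering_comb sc sb (fun k => (k == j)%:R).
    congr wandering; apply/funext => l.
    by rewrite (bigD1 j)//= eqxx scale1r big1 ?addr0// => k /negbTE ->; rewrite scale0r.
  move=> /sb'.1[_ [c hc]]; exists c => l; apply/colP => i.
  have cs : ccont (fun l => (\sum_k c k *: s' k l) i 0).
    under eq_fun do rewrite summxE; apply: ccont_sum => k _; under eq_fun do rewrite mxE.
    by apply: ccontM; [exact: ccont_cst|exact: sc'].
  apply: (ccont_ae_eq (sc j i) cs).
  by apply: arc_aeS hc => t ->.
pose C : 'M[R[i]]_n := \matrix_(k, j) c j k.
have e l : framemx s l = framemx s' l *m C.
  apply/matrixP => i j; rewrite !mxE hc summxE.
  by apply: eq_bigr => k _; rewrite !mxE mulrC.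
have u := framemx_unit Ws sc sb; have u' := framemx_unit Ws sc' sb'.
have uC : C \in unitmx by have := u (circle1 R); rewrite e unitmx_mul => /andP[].
move=> l; rewrite /framepsi e -mulmxA; congr (_ *m _).
rewrite -[C *m _]mul1mx -(mulVmx (u' (circle1 R))) -mulmxA (mulmxA _ C) -e.
by rewrite mulmxV ?mulmx1.
Qed.

(** The matrix [framepsi] of a local basis does not depend on the basis, so the local
    constructions agree and the basis chosen at [z] may be used at [z] itself. *)
Lemma unitary_frame : smooth_wandering_subbundle V n ->
  exists psi : circle R -> M -> 'M[R[i]]_n,
     [/\ forall i j, smooth_circle [set: M] (fun l z => psi l z i j),
         forall l z, psi l z \is unitarymx,
         forall z, psi (circle1 R) z = 1%:M &
         forall z, V z = mulM (psi^~ z) @` @hardy R n].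
Proof.
move=> /choice[N /choice[s hs]].
have sc p z : N p z -> forall j i, ccont (fun l => s p j z l i 0).
  by have [_ _ sm _] := hs p; move=> Nz j i; exact: smooth_ccont (sm j i) Nz.
have Nn z : N z z by have [] := hs z.
have sb p z : N p z -> l2_basis (fun j => s p j z) (wandering (V z)).
  by have [_ _ _ b] := hs p; exact: b.
exists (fun l z => framepsi (fun j => s z j z) l); split.
- move=> i j c ac; apply: csmooth_local => q [cq _].
  pose p := chart_param c (point q); have [oN Np sm _] := hs p.
  have oU : open (chartset c (N p)) by exact: chartset_open.
  exists (chartset c (N p)) => //.
  pose A (q : R * R * R) : 'M[R[i]]_n :=
    framemx (fun j => s p j (chart_param c (point q))) (expi q.1.1).
  have As : mxsmooth (chartset c (N p)) A.
    by move=> a b; apply: (eq_csmooth oU _ (sm b a c ac)) => x _; rewrite mxE.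
  have Bs : mxsmooth (chartset c (N p)) (fun q => A (scale_shift 0 1 (0, 0, 0) q)).
    move=> a b; apply: (csmooth_scale_shift _ (As a b)) => x.
    by rewrite /chartset /point/= !mul1r !addr0.
  have Au x : chartset c (N p) x -> A x \in unitmx.
    by move=> [_ Nx]; have h := framemx_unit (@V_shift _) (sc _ _ Nx) (sb _ _ Nx); exact: h.
  have Bu x : chartset c (N p) x -> A (scale_shift 0 1 (0, 0, 0) x) \in unitmx.
    by move=> Nx; apply: Au; move: Nx; rewrite /chartset /point/= !mul1r !addr0.
  have C := mxsmoothM oU As (mxsmoothV oU Bu Bs).
  apply: (eq_csmooth oU _ (C i j)) => x; rewrite inE => -[_ Nx].
  have -> : A (scale_shift 0 1 (0, 0, 0) x) =
      framemx (fun j => s p j (chart_param c (point x))) (circle1 R).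
    by rewrite /A /point/= !mul1r !addr0 mul0r expi0.
  rewrite -[LHS]/(framepsi (fun j => s p j (chart_param c (point x))) (expi x.1.1) i j).
  by rewrite (framepsi_unique (V_closed _) (@V_shift _) (sc _ _ Nx) (sc _ _ (Nn _)) (sb _ _ Nx) (sb _ _ (Nn _))).
- move=> l z; apply: framepsi_unitary => //; [exact: sc|exact: sb].
- by move=> z; apply: (framepsi1 (@V_shift z)); [exact: sc|exact: sb].
- move=> z; apply: framepsi_hardy => //; [exact: sc|exact: sb].
Qed.

End UnitaryFrame.

(** * Partial derivatives, uniformly on the circle *)

Section UniformTaylor.
Variable R : realType.
Local Notation E := (R * R * R)%type.
Local Notation e1 := (e1 R).
Implicit Types (G : E -> R) (D : set E) (q v : E).

Definition e2 : E := (0, 1, 0).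
Definition e3 : E := (0, 0, 1).

Lemma e23E (a b : R) q : a *: e2 + (b *: e3 + q) = (q.1.1, a + q.1.2, b + q.2).
Proof.
case: q => [[t x] y]; rewrite /=.
transitivity (a * 0 + (b * 0 + t), a * 1 + (b * 0 + x), a * 0 + (b * 1 + y)) => //.
by rewrite !mulr0 !mulr1 !add0r.
Qed.

(** Apply the mean value theorem in [x] and then in [y]; the derivatives oscillate
    little near the compact circle. *)
Lemma uniform_taylor D G q : (forall s p, D p -> D (s *: e1 + p)) -> open D ->
  smooth_on D G -> D q -> forall e : R, 0 < e -> exists2 d : R, 0 < d &
    forall a b : R, `|a| < d -> `|b| < d -> forall s : R, 0 <= s <= 2 * pi ->
    `|G (s *: e1 + (a *: e2 + (b *: e3 + q))) - G (s *: e1 + q)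
       - a * 'D_e2 G (s *: e1 + q) - b * 'D_e3 G (s *: e1 + q)| <= e * (`|a| + `|b|).
Proof.
move=> Dinv oD Gs Dq e e0.
have tube v := circle_tube (fun s => smooth_on_cont (smooth_on_derive v Gs) (Dinv s q Dq)) e0.
have [d /= d0 hd] := (nbhs_ballP _ _).1 (filterI (near_open oD Dq) (filterI (tube e2) (tube e3))).
exists d => // a b ad bd s s01.
have Sp t u : `|t| < d -> `|u| < d -> D (t *: e2 + (u *: e3 + q)) /\
   (`|'D_e2 G (s *: e1 + (t *: e2 + (u *: e3 + q))) - 'D_e2 G (s *: e1 + q)| <= e /\
    `|'D_e3 G (s *: e1 + (t *: e2 + (u *: e3 + q))) - 'D_e3 G (s *: e1 + q)| <= e).
  move=> td ud; have [|Dp [h1 h2]] := hd (t *: e2 + (u *: e3 + q)).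
    rewrite e23E; split; [split|]; rewrite /ball/= ?subrr ?normr0//.
      by rewrite opprD addrCA subrr addr0 normrN.
    by rewrite opprD addrCA subrr addr0 normrN.
  by split=> //; split; [exact: h1|exact: h2].
have Dl t u : `|t| < d -> `|u| < d -> D (t *: e2 + (s *: e1 + (u *: e3 + q))).
  by move=> td ud; rewrite addrCA; apply: Dinv; exact: (Sp t u td ud).1.
have Dl3 u : `|u| < d -> D (u *: e3 + (s *: e1 + q)).
  move=> ud; rewrite addrCA; apply: Dinv.
  by have := (Sp 0 u _ ud).1; rewrite scale0r add0r normr0; apply.
have lin (k t : R) : is_derive t (1 : R) (fun t : R => t * k) k.
  by apply: is_derive_eq; rewrite /GRing.scale/= mulr0 mulr1 add0r.
have s1 : `|(G (a *: e2 + (s *: e1 + (b *: e3 + q))) - a * 'D_e2 G (s *: e1 + q)) -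
    (G (0 *: e2 + (s *: e1 + (b *: e3 + q))) - 0 * 'D_e2 G (s *: e1 + q))| <= e * `|a|.
  apply: (@line_MVT R (fun t => G (t *: e2 + (s *: e1 + (b *: e3 + q))) - t * 'D_e2 G (s *: e1 + q))
    (fun t => 'D_e2 G (t *: e2 + (s *: e1 + (b *: e3 + q))) - 'D_e2 G (s *: e1 + q))) => t th.
  have td := le_lt_trans th ad; split.
    apply: is_deriveB (lin _ _).
    by apply: is_derive_line; exact: smooth_on_derivable Gs (Dl t b td bd).
  by rewrite addrCA; exact: (Sp t b td bd).2.1.
have s2 : `|(G (b *: e3 + (s *: e1 + q)) - b * 'D_e3 G (s *: e1 + q)) -
    (G (0 *: e3 + (s *: e1 + q)) - 0 * 'D_e3 G (s *: e1 + q))| <= e * `|b|.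
  apply: (@line_MVT R (fun t => G (t *: e3 + (s *: e1 + q)) - t * 'D_e3 G (s *: e1 + q))
    (fun t => 'D_e3 G (t *: e3 + (s *: e1 + q)) - 'D_e3 G (s *: e1 + q))) => t th.
  have td := le_lt_trans th bd; split.
    apply: is_deriveB (lin _ _).
    by apply: is_derive_line; exact: smooth_on_derivable Gs (Dl3 t td).
  rewrite addrCA; have := (Sp 0 t _ td).2.2; rewrite scale0r add0r normr0; exact.
move: s1 s2; rewrite !scale0r !add0r !mul0r !subr0 (addrCA (a *: e2)) (addrCA (b *: e3) (s *: e1)).
rewrite -(addrCA (a *: e2)) (addrCA (a *: e2) (s *: e1)) => s1 s2.
rewrite mulrDr; apply: le_trans (lerD s1 s2); apply: le_trans (ler_normD _ _).
rewrite le_eqVlt; apply/orP; left; apply/eqP; congr (`| _ |); ring.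
Qed.

Definition cder v (F : E -> R[i]) q : R[i] :=
  Complex ('D_v (fun q => complex.Re (F q)) q) ('D_v (fun q => complex.Im (F q)) q).

Lemma uniform_ctaylor D (F : E -> R[i]) q : (forall s p, D p -> D (s *: e1 + p)) -> open D ->
  csmooth D F -> D q -> forall e : R, 0 < e -> exists2 d : R, 0 < d &
    forall h : R[i], normc h < d -> forall s : R, 0 <= s <= 2 * pi ->
    normc (F (s *: e1 + (complex.Re h *: e2 + (complex.Im h *: e3 + q))) - F (s *: e1 + q)
       - (complex.Re h)%:C%C * cder e2 F (s *: e1 + q)
       - (complex.Im h)%:C%C * cder e3 F (s *: e1 + q)) <= e * normc h.
Proof.
move=> Dinv oD [Fr Fi] Dq e e0; have e4 : 0 < e / 4 by rewrite divr_gt0.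
have [d1 d10 h1] := uniform_taylor Dinv oD Fr Dq e4.
have [d2 d20 h2] := uniform_taylor Dinv oD Fi Dq e4.
exists (Num.min d1 d2); first by rewrite lt_min d10 d20.
move=> h; rewrite lt_min => /andP[hd1 hd2] s s01.
have a1 := ler_Re_normc h; have a2 := ler_Im_normc h.
have b1 := h1 _ _ (le_lt_trans a1 hd1) (le_lt_trans a2 hd1) s s01.
have b2 := h2 _ _ (le_lt_trans a1 hd2) (le_lt_trans a2 hd2) s s01.
apply: (le_trans (normc_ler_ReIm _)).
have split_parts (a b : R) (A B C Z : R[i]) :
    complex.Re (A - B - a%:C%C * C - b%:C%C * Z) =
      complex.Re A - complex.Re B - a * complex.Re C - b * complex.Re Z /\
    complex.Im (A - B - a%:C%C * C - b%:C%C * Z) =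
      complex.Im A - complex.Im B - a * complex.Im C - b * complex.Im Z.
  by case: A; case: B; case: C; case: Z => * /=; split; ring.
rewrite (split_parts _ _ _ _ _ _).1 (split_parts _ _ _ _ _ _).2.
apply: (le_trans (lerD b1 b2)).
have : e / 4 * (`|complex.Re h| + `|complex.Im h|) <= e / 2 * normc h.
  rewrite (_ : e / 2 * normc h = e / 4 * (normc h + normc h)); last by field.
  by apply: ler_wpM2l; [exact: ltW|exact: lerD].
lra.
Qed.

End UniformTaylor.

Section SurfacePartials.
Variables (R : realType) (M : riemannSurface R).
Local Notation E := (R * R * R)%type.
Local Notation e1 := (e1 R).

(** [Fx] and [Fy] are the coordinate derivatives of [F] at [p], with a remainder
    that is small uniformly along the circle. *)
Definition uniform_partials (c : chart R M) (F : circle R -> M -> R[i]) p (Fx Fy : circle R -> R[i]) :=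
  forall e : R, 0 < e -> exists2 d : R, 0 < d & forall h : R[i], normc h < d -> forall l,
    normc (F l (chart_param c (chart_coord c p + h)) - F l p
      - (complex.Re h)%:C%C * Fx l - (complex.Im h)%:C%C * Fy l) <= e * normc h.

(** The derivatives are computed at some angle of each point of the circle; by
    periodicity the choice is immaterial, which makes them continuous. *)
Lemma smooth_partials (c : chart R M) (N : set M) (F : circle R -> M -> R[i]) p :
  open N -> smooth_circle N F -> atlas c -> chart_dom c p -> N p ->
  exists Fx Fy, [/\ ccont Fx, ccont Fy & uniform_partials c F p Fx Fy].
Proof.
move=> oN sF ac cp Np.
pose q0 : E := (0, complex.Re (chart_coord c p), complex.Im (chart_coord c p)).
pose Ft q := F (expi q.1.1) (chart_param c (point q)).
have Fs : csmooth (chartset c N) Ft := sF c ac.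
have oD := chartset_open ac oN.
have Dinv (s : R) q : chartset c N q -> chartset c N (s *: e1 + q) by exact: chartset_shift.
have [D0 p0] := chartset_coord ac cp Np 0; rewrite -/q0 in D0 p0.
have /choice[T hT] : forall l : circle R, exists t : R, 0 <= t <= 2 * pi /\ l = expi t.
  by move=> l; have [t t01 ->] := expi_surj l; exists t.
pose X v l := cder v Ft (T l *: e1 + q0).
have XE v t : X v (expi t) = cder v Ft (t *: e1 + q0).
  have [_ eT] := hT (expi t).
  have sh q : Ft ((T (expi t) - t) *: e1 + q) = Ft q.
    rewrite /Ft /point !e1E /=; congr (F _ _).
    apply: val_inj; rewrite /= -[Complex _ _]/(val (expi _)) expiDE expiDE -eT -expiDE subrr expi0.
    by rewrite mul1r.
  rewrite /X; have -> : T (expi t) *: e1 + q0 = (T (expi t) - t) *: e1 + (t *: e1 + q0).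
    by rewrite addrA -scalerDl subrK.
  by congr Complex; apply: shift_derive => q; rewrite sh.
have Xc v : ccont (X v).
  have r : (fun t => complex.Re (X v (expi t))) = fun t => 'D_v (fun q => complex.Re (Ft q)) (t *: e1 + q0).
    by apply/funext => t; rewrite XE.
  have i : (fun t => complex.Im (X v (expi t))) = fun t => 'D_v (fun q => complex.Im (Ft q)) (t *: e1 + q0).
    by apply/funext => t; rewrite XE.
  split; rewrite ?r ?i => t.
    by have := comp_cont (@line_cont _ q0 t) (smooth_on_cont (smooth_on_derive v Fs.1) (Dinv t _ D0)).
  by have := comp_cont (@line_cont _ q0 t) (smooth_on_cont (smooth_on_derive v Fs.2) (Dinv t _ D0)).
exists (X (e2 R)), (X (e3 R)); split => // e e0.
have [d d0 hd] := uniform_ctaylor Dinv oD Fs D0 e0.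
exists d => // h hlt l; have [t01 el] := hT l.
have := hd h hlt _ t01; rewrite -/(X _ l) -/(X _ l).
have -> : Ft (T l *: e1 + q0) = F l p.
  by rewrite /Ft /point !e1E /= addr0 -el -[Complex _ _]/(point q0) p0.
have -> // : Ft (T l *: e1 + (complex.Re h *: e2 R + (complex.Im h *: e3 R + q0))) =
  F l (chart_param c (chart_coord c p + h)).
rewrite /Ft /point e23E !e1E /= addr0 -el; congr (F _ (chart_param c _)).
by apply: complexP; rewrite ?cReD ?cImD /= addrC.
Qed.

End SurfacePartials.

(** * The analytic frame near a point *)

Lemma near_forall (X : topologicalType) (I : finType) (P : I -> X -> Prop) (x : X) :
  (forall i, \forall y \near x, P i y) -> \forall y \near x, forall i, P i y.
Proof. exact: filter_forall. Qed.

Lemma cRe_cont (R : realType) : continuous (fun w : R[i]^o => complex.Re w : R).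
Proof.
move=> w A /nbhs_ballP[e /= e0 hA]; apply/cnbhsP; exists e => // v; move=> h; apply: hA.
rewrite /ball/= distrC; apply: le_lt_trans h; rewrite -cReN -cReD; exact: ler_Re_normc.
Qed.

Lemma cIm_cont (R : realType) : continuous (fun w : R[i]^o => complex.Im w : R).
Proof.
move=> w A /nbhs_ballP[e /= e0 hA]; apply/cnbhsP; exists e => // v; move=> h; apply: hA.
rewrite /ball/= distrC; apply: le_lt_trans h; rewrite -cImN -cImD; exact: ler_Im_normc.
Qed.

Lemma coords_cont (R : realType) : continuous (fun w : R[i]^o => (0 : R, complex.Re w, complex.Im w)).
Proof.
move=> w; apply: (@pair_cont _ _ _ (fun w : R[i]^o => (0 : R, complex.Re w))); last exact: cIm_cont.
apply: (@pair_cont _ _ _ (fun w : R[i]^o => (0 : R))); last exact: cRe_cont.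
by move=> A; exact: (@cst_continuous (R[i]^o) R 0 w A).
Qed.

Section AnalyticFrame.
Variables (R : realType) (M : riemannSurface R) (n : nat) (V : M -> set (vfun R n)).
Variable psi : circle R -> M -> 'M[R[i]]_n.
Hypothesis psi_smooth : forall i j, smooth_circle [set: M] (fun l z => psi l z i j).
Hypothesis psi_unitary : forall l z, psi l z \is unitarymx.
Hypothesis psi_hardy : forall z, V z = mulM (psi^~ z) @` @hardy R n.
Variable z0 : M.
Local Notation E := (R * R * R)%type.
Local Notation e1 := (e1 R).

(** The unitary frame at [z] seen from the one at [z0]. *)
Definition quot z l : 'M[R[i]]_n := adjm (psi l z0) *m psi l z.
Definition dev z l : 'M[R[i]]_n := 1%:M - quot z l.
Definition modes z m : 'M[R[i]]_n := \matrix_(i, j) fc (fun l => dev z l i j) m.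

Lemma psi_adj l z : adjm (psi l z) *m psi l z = 1%:M.
Proof. by have /unitarymxP := psi_unitary l z; exact: mulmx1C. Qed.

Lemma psi_cont z : mcont (psi^~ z).
Proof. by move=> i j; exact: smooth_ccont (psi_smooth i j) I. Qed.

Lemma dev_cont z : mcont (dev z).
Proof.
apply: mcontB; first exact: mcont_cst.
by apply: mcontM; [apply: adjm_cont; exact: psi_cont|exact: psi_cont].
Qed.

Lemma dev_base l : dev z0 l = 0.
Proof. by rewrite /dev /quot psi_adj subrr. Qed.

Lemma modes_base m : modes z0 m = 0.
Proof.
have E i j : (fun l => dev z0 l i j) = (fun=> 0).
  by apply/funext => l; rewrite dev_base mxE.
by apply/matrixP => i j; rewrite [LHS]mxE [RHS]mxE E fc0.
Qed.

Lemma dev_smooth c i j : atlas c ->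
  csmooth (chartset c [set: M]) (fun q => dev (chart_param c (point q)) (expi q.1.1) i j).
Proof.
move=> ac; have oD := chartset_open ac openT.
have [c0 ac0 cz0] := atlas_cover z0.
pose o : E := (0, complex.Re (chart_coord c0 z0), complex.Im (chart_coord c0 z0)).
have P0 : mxsmooth (chartset c [set: M]) (fun q => psi (expi q.1.1) z0).
  move=> a b; have C t := chartset_coord ac0 cz0 I t.
  have sE x : scale_shift 1 0 o x = (x.1.1, complex.Re (chart_coord c0 z0), complex.Im (chart_coord c0 z0)).
    by rewrite /scale_shift /o /= mul1r addr0 !mul0r !add0r.
  have DD x : chartset c [set: M] x -> chartset c0 [set: M] (scale_shift 1 0 o x).
    by move=> _; rewrite sE; exact: (C _).1.
  have := csmooth_scale_shift DD (psi_smooth a b ac0); congr csmooth.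
  by apply/funext => x; rewrite -[Complex _ _]/(point (scale_shift 1 0 o x)) sE (C _).2.
have P1 : mxsmooth (chartset c [set: M]) (fun q => psi (expi q.1.1) (chart_param c (point q))).
  by move=> a b; exact: psi_smooth a b c ac.
have PJ : mxsmooth (chartset c [set: M]) (fun q => adjm (psi (expi q.1.1) z0)).
  move=> a b; under eq_fun do rewrite !mxE; exact: csmoothJ (P0 b a).
have PM := mxsmoothM oD PJ P1 i j.
have C1 := @csmooth_cst R _ (chartset c [set: M]) ((1%:M : 'M[R[i]]_n) i j).
have Cm := @csmooth_cst R _ (chartset c [set: M]) (-1).
apply: (eq_csmooth oD _ (csmoothD oD C1 (csmoothM oD Cm PM))) => x _.
by rewrite /dev /quot !mxE mulN1r.
Qed.

Definition devF c i j (q : E) : R[i] := dev (chart_param c (point q)) (expi q.1.1) i j.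

Lemma devF_periodic c i j q : devF c i j ((2 * pi) *: e1 + q) = devF c i j q.
Proof.
by rewrite /devF /point !e1E /= addrC -/(expi _) expiD2pi.
Qed.

Lemma dev_mode c q m i j : atlas c -> chartset c [set: M] q ->
  letter (modes (chart_param c (point q))) (expi q.1.1) m i j = mode m (devF c i j) q.
Proof.
move=> ac Dq; have oD := chartset_open ac openT.
have Dinv (s : R) p : chartset c [set: M] p -> chartset c [set: M] (s *: e1 + p) by exact: chartset_shift.
pose q0 : E := (0, q.1.2, q.2).
have qE : q = q.1.1 *: e1 + q0 by rewrite e1E /= addr0; case: (q) => [[]].
have D0 : chartset c [set: M] q0 by [].
rewrite [in RHS]qE (mode_rotate Dinv oD m _ (dev_smooth i j ac) (devF_periodic c i j) D0).
rewrite (@mode_fc R m _ q0 (fun l => dev (chart_param c (point q)) l i j)).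
- by rewrite !mxE.
- exact: dev_cont.
- by move=> s; rewrite /devF /point e1E /= addr0.
Qed.

(** The Fourier coefficients of [dev] are summable uniformly near [z0], where they
    vanish: finitely many are made small by continuity, the others by the tail
    of the uniform bound. *)
Lemma small_modes (eta : R) : 0 < eta -> exists (N : set M) (eps : int -> R),
  [/\ open N, N z0, forall m, 0 <= eps m, abs_bounded eps eta &
      forall z m i j, N z -> normc (modes z m i j) <= eps m].
Proof.
move=> eta0; have [c ac cz0] := atlas_cover z0.
have oD := chartset_open ac openT.
have Dinv (s : R) p : chartset c [set: M] p -> chartset c [set: M] (s *: e1 + p) by exact: chartset_shift.
pose q0 : E := (0, complex.Re (chart_coord c z0), complex.Im (chart_coord c z0)).
have [D0 p0] := chartset_coord ac cz0 I 0; rewrite -/q0 in D0 p0.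
have S i j := mode_CkS Dinv oD 0 (dev_smooth i j ac) (devF_periodic c i j).
have /choice[M1 /choice[C1 hC1]] : forall x : 'I_n * 'I_n, exists M1 C, abs_bounded (M1 : int -> R) C /\
   \forall p \near q0, forall m, normc (mode m (devF c x.1 x.2) p) <= M1 m.
  move=> [i j]; have [s1 s2] := S i j.
  have [A [CA [hA nA]]] := CkS_bound s1 D0; have [B [CB [hB nB]]] := CkS_bound s2 D0.
  exists (fun m => `|1| * `|A m| + `|B m|), (`|1| * CA + CB); split; first exact: abs_bounded_L.
  apply: filterS (filterI nA nB) => p [h1 h2] m; apply: (le_trans (normc_ler_ReIm _)).
  rewrite normr1 mul1r; apply: lerD; [exact: le_trans (h1 m) (ler_norm _)|exact: le_trans (h2 m) (ler_norm _)].
pose M2 m := \sum_(x : 'I_n * 'I_n) `|M1 x m|.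
have M2b : abs_bounded M2 (\sum_x C1 x).
  move=> l ul; under eq_bigr do rewrite ger0_norm ?sumr_ge0//.
  by rewrite exchange_big/=; apply: ler_sum => x _; exact: (hC1 x).1.
have n1 : \forall p \near q0, forall m i j, normc (mode m (devF c i j) p) <= M2 m.
  have : \forall p \near q0, forall (x : 'I_n * 'I_n) m, normc (mode m (devF c x.1 x.2) p) <= M1 x m.
    apply: (@near_forall _ _ (fun x p => forall m, normc (mode m (devF c x.1 x.2) p) <= M1 x m)) => x.
    exact: (hC1 x).2.
  apply: filterS => p h m i j; apply: (le_trans (h (i, j) m)); apply: (le_trans (ler_norm _)).
  by rewrite /M2 (bigD1 (i, j))//= lerDl sumr_ge0.
have eta2 : 0 < eta / 2 by rewrite divr_gt0.
have [l0 ul0 tail] := abs_bounded_tail M2b eta2.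
pose k := eta / 2 / (size l0).+1%:R.
have k0 : 0 < k by rewrite divr_gt0.
(* The modes in l0 vanish at z0 and are continuous; the others are covered by the
   tail of M2. *)
have n2 : \forall p \near q0, forall m, m \in l0 -> forall i j, normc (mode m (devF c i j) p) <= k.
  have one m : \forall p \near q0, forall (x : 'I_n * 'I_n), normc (mode m (devF c x.1 x.2) p) <= k.
    apply: (@near_forall _ _ (fun x p => normc (mode m (devF c x.1 x.2) p) <= k)) => -[i j]; have [s1 s2] := S i j.
    have m0 : mode m (devF c i j) q0 = 0.
      by rewrite -dev_mode// p0 /letter modes_base scaler0 mxE.
    have k2 : 0 < k / 2 by rewrite divr_gt0.
    have /cvgrPdist_le/(_ _ k2) := @CkS_cont _ _ _ _ _ _ m _ s1 D0; rewrite m0 => c1.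
    have /cvgrPdist_le/(_ _ k2) := @CkS_cont _ _ _ _ _ _ m _ s2 D0; rewrite m0 => c2.
    apply: filterS (filterI c1 c2) => p [h1 h2]; apply: (le_trans (normc_ler_ReIm _)).
    by rewrite [k]splitr; move: h1 h2; rewrite /= !sub0r !normrN => h1 h2; exact: lerD.
  elim: (l0) => [|m l IH]; first by near=> p => m; rewrite in_nil.
  apply: filterS (filterI (one m) IH) => p [h1 h2] m'; rewrite inE => /orP[/eqP ->|]; last exact: h2.
  by move=> i j; exact: (h1 (i, j)).
pose eps m := if m \in l0 then k else M2 m.
have M20 m : 0 <= M2 m by rewrite sumr_ge0.
have eps0 m : 0 <= eps m by rewrite /eps; case: ifP => _; [exact: ltW|].
have epsb : abs_bounded eps eta.
  move=> l ul; under eq_bigr do rewrite ger0_norm//.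
  rewrite (bigID (mem l0))/= [eta]splitr; apply: lerD.
    rewrite -big_filter; pose l1 := [seq x <- l | x \in l0].
    apply: (@le_trans _ _ (\sum_(m <- l0) k)); last exact/sum_share_le/ltW.
    apply: (@le_trans _ _ (\sum_(m <- l1) k)).
      by rewrite !big_seq; apply: ler_sum => m; rewrite mem_filter /eps => /andP[-> _].
    apply: (@sum_subseq R _ l1 l0 (fun=> k)) => [_||m]; [exact: ltW|exact: filter_uniq|].
    by rewrite mem_filter => /andP[].
  rewrite -big_filter; pose l1 := [seq x <- l | x \notin l0].
  have := tail l1 (filter_uniq _ ul).
  have -> : \sum_(x <- l1) `|M2 x| = \sum_(x <- l1) eps x.
    rewrite !big_seq; apply: eq_bigr => m; rewrite mem_filter /eps => /andP[/negbTE -> _].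
    by rewrite ger0_norm.
  by apply=> m; rewrite mem_filter => /andP[].
pose coordE z : E := (0, complex.Re (chart_coord c z), complex.Im (chart_coord c z)).
pose G : set E := [set p | forall m i j, normc (mode m (devF c i j) p) <= eps m].
have nG : nbhs q0 G.
  apply: filterS (filterI n1 n2) => p [h1 h2] m i j; rewrite /eps.
  by case: ifP => [ml|_]; [exact: h2|exact: h1].
have [od oc K cc pc] := atlas_chart ac.
exists (chart_dom c `&` [set z | (G° ) (coordE z)]), eps; split=> //.
- rewrite openE => z [cz Gz]; apply: filterI; first exact: open_nbhs_nbhs.
  have coordc : {for z, continuous coordE}.
    have c1 := cc z (mem_set cz).
    exact: (@continuous_comp _ _ _ (chart_coord c : M -> R[i]^o) _ z c1 (@coords_cont R _)).
  by apply: coordc; apply: open_nbhs_nbhs; split=> //; exact: open_interior.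
- move=> z m i j [cz /interior_subset Gz]; have := Gz m i j.
  have [Dz pz] := chartset_coord ac cz I 0.
  by rewrite -dev_mode// pz /= letter_normc.
Unshelve. all: by end_near. Qed.

End AnalyticFrame.

(** * Holomorphy of the analytic frame *)

Lemma hardy_cst (R : realType) (n : nat) (v : 'cV[R[i]]_n) : hardy (fun=> v).
Proof.
split; first by apply/L2_csquare => i; exact/ccont_csquare/ccont_cst.
by move=> m i m0; rewrite fourierE fc_cst lt_eqF// mul0r.
Qed.

Section Derivatives.
Variables (R : realType) (M : riemannSurface R) (n : nat).
Variables (c : chart R M) (N : set M) (p : M).
Hypothesis oN : open N.
Hypothesis Np : N p.
Hypothesis ac : atlas c.
Hypothesis cp : chart_dom c p.
Local Notation moved h := (chart_param c (chart_coord c p + h)).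

Lemma near_chart : \forall h \near (0 : R[i]^o), N (moved h).
Proof.
have [d0 p0] := chartset_coord ac cp Np 0.
have [_ _ K _ _] := atlas_chart ac.
have cz : chart_codom c (chart_coord c p) by exists p.
have Nz : N (chart_param c (chart_coord c p)) by rewrite K ?inE.
have [d dp hd] := near_param ac oN cz Nz.
apply/cnbhsP; exists d => // w; rewrite subr0 => wd.
by apply: (hd _ _).2; rewrite addrC addKr.
Qed.

Lemma uniform_partials_near F Fx Fy (e : R) : uniform_partials c F p Fx Fy -> 0 < e ->
  \forall h \near (0 : R[i]^o), forall l,
    normc (F l (moved h) - F l p - (complex.Re h)%:C%C * Fx l - (complex.Im h)%:C%C * Fy l) <= e * normc h.
Proof.
move=> H e0; have [d d0 hd] := H e e0.
by apply/cnbhsP; exists d => // w; rewrite subr0; exact: hd.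
Qed.

Lemma col_entry (K : pzRingType) q (A B X Y : 'cV[K]_q) (a b : K) i :
  (A - B - a *: X - b *: Y) i 0 = A i 0 - B i 0 - a * X i 0 - b * Y i 0.
Proof. by rewrite !mxE. Qed.

Lemma partials_column (F : 'I_n -> circle R -> M -> R[i]) (Fx Fy : 'I_n -> circle R -> R[i]) :
  (forall i, smooth_circle N (F i)) ->
  (forall i, ccont (Fx i)) -> (forall i, ccont (Fy i)) ->
  (forall i, uniform_partials c (F i) p (Fx i) (Fy i)) ->
  has_partials c (fun z l => \col_i F i l z : 'cV_n) p (fun l => \col_i Fx i l) (fun l => \col_i Fy i l).
Proof.
move=> Fs xc yc H; split.
- by apply/L2_csquare => i; under eq_fun do rewrite mxE; exact: ccont_csquare.
- by apply/L2_csquare => i; under eq_fun do rewrite mxE; exact: ccont_csquare.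
- move=> e e0; have e1 : 0 < e / n.+1%:R by rewrite divr_gt0.
  have n1 := near_forall (fun i => uniform_partials_near (H i) e1).
  have [d d0 hd] := (cnbhsP _ _).1 (filterI n1 near_chart).
  exists d => // h; rewrite -[h in normc h]subr0 => /hd [h1 h2].
  have K0 : 0 <= e / n.+1%:R * normc h by rewrite mulr_ge0 ?normc_ge0// ltW.
  apply: (@le_trans _ _ (n%:R * (e / n.+1%:R * normc h))).
    pose G l k := F k l (moved h) - F k l p - (complex.Re h)%:C%C * Fx k l - (complex.Im h)%:C%C * Fy k l.
    rewrite (_ : (fun l => _) = fun l => \col_k G l k); last first.
      apply/funext => l; apply/colP => k /=.
      by rewrite col_entry ![(\col__ _) _ _]mxE.
    apply: l2norm_le => [i||l i]; [|exact: K0|by rewrite mxE; exact: h1].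
    under eq_fun do rewrite mxE.
    apply: ccontD; first apply: ccontD; first apply: ccontD.
    - exact: smooth_ccont (Fs i) h2.
    - by apply: ccontN; exact: smooth_ccont (Fs i) Np.
    - by apply: ccontN; apply: ccontM => //; exact: ccont_cst.
    - by apply: ccontN; apply: ccontM => //; exact: ccont_cst.
  rewrite subr0 mulrA ler_wpM2r ?normc_ge0// mulrCA ler_piMr ?(ltW e0)//.
  by rewrite ler_pdivrMr// mul1r ler_nat.
Qed.

(** A Fourier coefficient of [mulM A f] is a continuous linear function of [f], so its
    partial derivatives are those coefficients of the partial derivatives. *)
Lemma partials_fourier0 (f : M -> vfun R n) fx fy A m i K : mcont A -> has_partials c f p fx fy ->
  (forall z, N z -> L2 (f z)) -> (forall z, N z -> fourier (mulM A (f z)) m i = K) ->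
  fourier (mulM A fx) m i = 0 /\ fourier (mulM A fy) m i = 0.
Proof.
move=> Ac [x2 y2 H] f2 fK; have [C C0 AC] := mcont_bounded Ac.
set X := fourier (mulM A fx) m i; set Y := fourier (mulM A fy) m i.
have key (e : R) : 0 < e -> exists2 d : R, 0 < d & forall h : R[i], normc h < d ->
    normc ((complex.Re h)%:C%C * X + (complex.Im h)%:C%C * Y) <= e * normc h.
  move=> e0; have nC : 0 < n.+1%:R * C by rewrite mulr_gt0.
  have [d d0 hd] := H _ (divr_gt0 e0 nC).
  have [d' d'0 hd'] := (cnbhsP _ _).1 near_chart.
  exists (Num.min d d'); first by rewrite lt_min d0 d'0.
  move=> h; rewrite lt_min => /andP[/hd h1]; rewrite -[h in normc h]subr0 => /hd' h2.
  set r := fun l => _ in h1.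
  have xs : L2 (fun l => (complex.Re h)%:C%C *: fx l) by exact: L2Z.
  have ys : L2 (fun l => (complex.Im h)%:C%C *: fy l) by exact: L2Z.
  have r0 : L2 (fun l => f (moved h) l - f p l) by apply: L2B; exact: f2.
  have r1 : L2 (fun l => f (moved h) l - f p l - (complex.Re h)%:C%C *: fx l) by exact: L2B.
  have r2 : L2 r by exact: L2B.
  have fZ a (g : vfun R n) : L2 g -> fourier (mulM A (fun l => a *: g l)) m i = a * fourier (mulM A g) m i.
    move=> g2; rewrite !fourierE.
    have -> : (fun l => mulM A (fun l => a *: g l) l i 0) = fun l => a * mulM A g l i 0.
      by apply/funext => l; rewrite /mulM -scalemxAr mxE.
    exact: fcZ (L2_mulM Ac g2 _).
  have fB (g k : vfun R n) : L2 g -> L2 k ->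
      fourier (mulM A (fun l => g l - k l)) m i = fourier (mulM A g) m i - fourier (mulM A k) m i.
    by move=> g2 k2; rewrite mulMB fourierB//; exact: L2_mulM.
  have e1 : fourier (mulM A r) m i = - ((complex.Re h)%:C%C * X + (complex.Im h)%:C%C * Y).
    rewrite (fB _ _ r1 ys) (fB _ _ r0 xs) (fB _ _ (f2 _ h2) (f2 _ Np)) !fZ// !fK//.
    by rewrite subrr sub0r opprD.
  rewrite -normcN -e1; apply: (le_trans (fourier_bound _ _ (L2_mulM Ac r2))).
  apply: (le_trans (l2norm_mulM Ac AC (ltW C0) r2)).
  apply: (@le_trans _ _ (n.+1%:R * C * (e / (n.+1%:R * C) * normc h))).
    apply: ler_pM => //; [by rewrite mulr_ge0// ltW|exact: l2norm_ge0|].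
    by rewrite ler_wpM2r ?(ltW C0)// ler_nat.
  by rewrite subr0 mulrA [_ * C * _]mulrC divfK ?gt_eqF.
split; apply: normc_small => e e0; have [d d0 hd] := key e e0.
all: have d2 : 0 < d / 2 by rewrite divr_gt0.
all: have dd : d / 2 < d by rewrite ltr_pdivrMr// ltr_pMr// ltr1n.
- have := hd ((d / 2)%:C%C); rewrite normcR (gtr0_norm d2) => /(_ dd).
  rewrite (_ : (complex.Im ((d / 2)%:C%C))%:C%C = 0)// mul0r addr0 (_ : complex.Re _ = d / 2)//.
  by rewrite normcM normcR gtr0_norm// mulrC ler_pM2r.
- have nE : normc (Complex 0 (d / 2)) = d / 2.
    by rewrite /= expr0n/= add0r sqrtr_sqr gtr0_norm.
  have := hd (Complex 0 (d / 2)); rewrite nE => /(_ dd).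
  rewrite (_ : (complex.Re (Complex 0 (d / 2)))%:C%C = 0)// mul0r add0r (_ : complex.Im _ = d / 2)//.
  by rewrite normcM normcR gtr0_norm// mulrC ler_pM2r.
Qed.

(** The Cauchy-Riemann equations turn the real differential into multiplication by
    a complex derivative. *)
Definition uniform_cderiv (F : circle R -> M -> R[i]) (F' : circle R -> R[i]) :=
  forall e : R, 0 < e -> \forall h \near (0 : R[i]^o), forall l,
    normc (F l (moved h) - F l p - h * F' l) <= e * normc h.

Lemma cauchy_riemann F Fx Fy : uniform_partials c F p Fx Fy ->
  (forall l, Fx l + Complex 0 1 * Fy l = 0) -> uniform_cderiv F Fx.
Proof.
move=> H cr e e0; apply: filterS (uniform_partials_near H e0) => h hh l.
have -> : h * Fx l = (complex.Re h)%:C%C * Fx l + (complex.Im h)%:C%C * Fy l.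
  have -> : Fx l = - (Complex 0 1 * Fy l) by apply/eqP; rewrite -addr_eq0 cr.
  case: h {hh} => a b; case: (Fy l) => x y.
  by apply: complexP; rewrite !(cReM, cImM, cReD, cImD, cReN, cImN) /=; ring.
by rewrite opprD addrA; exact: hh.
Qed.

Lemma uniform_cderiv_holomorphic F F' l : chart_param c (chart_coord c p) = p ->
  uniform_cderiv F F' ->
  holomorphic_at (fun w => F l (chart_param c w)) (chart_coord c p).
Proof.
move=> pE H; rewrite /holomorphic_at /derivable; apply/cvg_ex; exists (F' l).
apply/cvgrPdist_le => e e0.
have [e1' e2'] : complex.Im e = 0 /\ 0 < complex.Re e by move: e0; rewrite ltcE/= => /andP[/eqP -> ->].
have nz : \forall h \near (0 : R[i]^o)^', h != 0 by exact: nbhs_dnbhs_neq.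
have nH : \forall h \near (0 : R[i]^o)^', forall l,
    normc (F l (moved h) - F l p - h * F' l) <= complex.Re e * normc h.
  by apply: (nbhs_dnbhs (H _ e2')).
apply: filterS (filterI nz nH) => h [h0 /(_ l) hh].
have -> : e = (complex.Re e)%:C%C by apply: complexP => //=.
rewrite normcE1 lecR pE.
have -> : F' l - h^-1 *: (F l (chart_param c (h *: (1 : R[i]^o) + chart_coord c p)) - F l p) =
   - (h^-1 * (F l (moved h) - F l p - h * F' l)).
  rewrite [h *: _]mulr1 [h + _]addrC mulrBr mulKf// opprB.
  by congr (_ - _).
have nh : 0 < normc h.
  rewrite lt_neqAle normc_ge0 andbT eq_sym; apply/eqP => /normc_eq0 h00.
  by rewrite h00 eqxx in h0.
rewrite normcN normcM -(ler_pM2l nh) mulrA -normcM divff// normc1 mul1r [leRHS]mulrC.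
exact: hh.
Qed.

End Derivatives.

Lemma mulM_operator (R : realType) (n : nat) (A : circle R -> 'M[R[i]]_n) : mcont A -> l2_operator (mulM A).
Proof.
move=> Ac; split.
- by move=> f f2; exact: L2_mulM.
- move=> a f g _ _; rewrite (_ : mulM A _ = fun l => a *: mulM A f l + mulM A g l); first exact: aeq_refl.
  by apply/funext => l; rewrite /mulM mulmxDr scalemxAr.
- have [C C0 AC] := mcont_bounded Ac; exists (n%:R * C) => f f2.
  exact: l2norm_mulM Ac AC (ltW C0) f2.
Qed.

Section HolomorphicFrame.
Variables (R : realType) (M : riemannSurface R) (n : nat) (V : M -> set (vfun R n)).
Variable psi : circle R -> M -> 'M[R[i]]_n.
Hypothesis psi_smooth : forall i j, smooth_circle [set: M] (fun l z => psi l z i j).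
Hypothesis psi_unitary : forall l z, psi l z \is unitarymx.
Hypothesis psi_hardy : forall z, V z = mulM (psi^~ z) @` @hardy R n.
Variables (z0 : M) (N : set M) (eps : int -> R) (theta eta : R).
Local Notation E := (R * R * R)%type.
Local Notation e1 := (e1 R).
Local Notation dev := (dev psi z0).
Local Notation modes := (modes psi z0).
Hypothesis oN : open N.
Hypothesis eps0 : forall m, 0 <= eps m.
Hypothesis epsb : abs_bounded eps eta.
Hypothesis modes_le : forall z m i j, N z -> normc (modes z m i j) <= eps m.

(* [eta] bounds the sum of the letters, and [theta] the factor by which the real
   [2n]-dimensional letters contract; both leave room for the crude factor [n]
   in the norm of a multiplication operator. *)
Hypothesis theta0 : 0 < theta.
Hypothesis theta_small : n.+1%:R * theta <= 1 / 4.
Hypothesis eta_small : (n + n).+1%:R * eta <= theta.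

Let ntheta : 0 <= n%:R * theta /\ n%:R * theta + theta <= 1 / 4.
Proof.
split; first by rewrite mulr_ge0// ltW.
by move: theta_small; rewrite mulrSr mulrDl mul1r.
Qed.
Let theta4 : theta <= 1 / 4. Proof. by move: ntheta => []; lra. Qed.
Let eta_ge0 : 0 <= eta. Proof. exact: abs_bounded_ge0 epsb. Qed.
Let neta : n%:R * eta <= 1 / 2.
Proof.
have : n%:R * eta <= (n + n).+1%:R * eta by rewrite ler_wpM2r// ler_nat -addnS leq_addr.
by move: eta_small theta4; lra.
Qed.
Let nnear : n%:R * (theta / (1 - theta)) <= 1 / 2.
Proof.
have t1 : 0 < 1 - theta by move: theta4; lra.
rewrite mulrA ler_pdivrMr//; have [_ b] := ntheta.
have half (x t : R) : x + t <= 1 / 4 -> 0 < t -> x <= 1 / 2 * (1 - t) by lra.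
exact: half b theta0.
Qed.

Let ctr k : (k <= n + n)%N -> contracting (fun m => const_mx (eps m) : 'M[R]_k) (fun=> 1) theta.
Proof.
move=> kn; apply: const_contracting => //.
  by rewrite (ltW theta0)/=; move: theta4; lra.
move=> l ul; have := epsb ul; under eq_bigr do rewrite ger0_norm//.
move=> h; apply: le_trans eta_small; apply: ler_pM => //; first by rewrite sumr_ge0.
by rewrite ler_nat (leq_trans kn).
Qed.

Let ctr1 : contracting (fun m => const_mx (eps m) : 'M[R]_n) (fun=> 1) theta.
Proof. by apply: ctr; exact: leq_addr. Qed.

Definition factor z l : 'M[R[i]]_n := letter_sum analytic_word (modes z) l.
Definition frame l z : 'M[R[i]]_n := psi l z *m factor z l.

Let dcont z : mcont (dev z). Proof. exact: dev_cont psi_smooth _ _. Qed.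

Lemma dev_series z l i j : N z -> chas_sum (fun m => letter (modes z) l m i j) (dev z l i j).
Proof.
move=> Nz.
have b m : normc (fc (fun l => dev z l i j) m) <= eps m.
  by have := modes_le m i j Nz; rewrite mxE.
have := fourier_series l (dcont z i j) epsb b; congr (chas_sum _ _).
by apply/funext => m; rewrite !mxE.
Qed.

Lemma dev_le z l i j : N z -> normc (dev z l i j) <= eta.
Proof.
move=> Nz; rewrite -(csumE (dev_series l i j Nz)); apply: (normc_csum_le epsb) => m.
by rewrite letter_normc; exact: modes_le.
Qed.

(** This replaces the solution of a dbar-equation: [factor] is analytic in the
    circle variable, and the product has no positive frequency. *)
Lemma quot_factor z l : N z ->
  quot psi z0 z l *m factor z l = 1%:M - letter_sum negative_word (modes z) l.
Proof.
move=> Nz; rewrite -(letter_sum_factor (fun m i j => modes_le m i j Nz) ctr1 (fun i j => dev_series l i j Nz)).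
by congr (_ *m _); rewrite /dev opprB addrC subrK.
Qed.

Lemma factor_near1 z l i j : N z ->
  normc (factor z l i j - (1%:M : 'M[R[i]]_n) i j) <= theta / (1 - theta).
Proof. by move=> Nz; exact: (letter_sum_near1 (fun m i j => modes_le m i j Nz) ctr1). Qed.

Lemma factor_unit z l : N z -> factor z l \in unitmx.
Proof. by move=> Nz; apply: (near1_unitmx nnear) => i j; exact: factor_near1. Qed.

Lemma factor_cont z : N z -> mcont (factor z).
Proof. by move=> Nz; exact: (letter_sum_cont (fun m i j => modes_le m i j Nz) ctr1). Qed.

Lemma frame_unit l z : N z -> frame l z \in unitmx.
Proof.
move=> Nz; rewrite unitmx_mul factor_unit// andbT.
by have := mulmx1_unit (psi_adj psi_unitary l z) => -[].
Qed.

Lemma frame_cont z : N z -> mcont (frame^~ z).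
Proof. by move=> Nz; apply: mcontM; [exact: psi_cont psi_smooth z|exact: factor_cont]. Qed.

Lemma factor_hardy z : N z -> mulM (factor z) @` @hardy R n = @hardy R n.
Proof.
move=> Nz; apply: (near1_hardy (factor_cont Nz) nnear).
- by rewrite divr_ge0 ?(ltW theta0)//; move: theta4; lra.
- by move=> l i j; exact: factor_near1.
- move=> i j m m0; apply: (letter_sum_fc (fun m i j => modes_le m i j Nz) ctr1).
  move=> w /analytic_freq w0; apply: contraTneq m0 => <-; by rewrite -leNgt.
Qed.

Lemma frame_hardy z : N z -> V z = mulM (frame^~ z) @` @hardy R n.
Proof.
move=> Nz; rewrite psi_hardy -{1}(factor_hardy Nz); apply/seteqP; split.
- by move=> _ [_ [f hf <-] <-]; exists f => //; rewrite mulMA.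
- by move=> _ [f hf <-]; exists (mulM (factor z) f); [exists f|rewrite mulMA].
Qed.

Lemma frame_smooth i j : smooth_circle N (fun l z => frame l z i j).
Proof.
move=> c ac; have oD := chartset_open ac oN; have oT := chartset_open ac (@openT M).
have Dinv (s : R) p : chartset c [set: M] p -> chartset c [set: M] (s *: e1 + p) by exact: chartset_shift.
have sub : chartset c N `<=` chartset c [set: M] by move=> q [].
have P1 : mxsmooth (chartset c N) (fun q => psi (expi q.1.1) (chart_param c (point q))).
  move=> a b; have [r s] := psi_smooth a b ac.
  by split=> k; apply: Ck_on_sub; [exact: sub|exact: r|exact: sub|exact: s].
have H1 : mxsmooth (chartset c N) (fun q => factor (chart_param c (point q)) (expi q.1.1)).
  move=> a b.
  pose L (m : int) (q : E) := realmx (letter (modes (chart_param c (point q))) (expi q.1.1) m).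
  have Lb m x p q : chartset c N x -> `|L m x p q| <= (const_mx (eps m) : 'M[R]_(n + n)) p q.
    move=> [_ Nx]; rewrite [leRHS]mxE; apply: realmx_le => i' j'; rewrite letter_normc; exact: modes_le.
  have LC k p q : CkS (chartset c N) k (fun m x => L m x p q).
    have S i' j' := mode_CkS Dinv oT k (dev_smooth psi_smooth z0 i' j' ac) (devF_periodic psi z0 c i' j').
    have SR i' j' : CkS (chartset c N) k (fun m x =>
        complex.Re (letter (modes (chart_param c (point x))) (expi x.1.1) m i' j')).
      apply: (eq_CkS oD _ (CkS_sub sub (S i' j').1)) => m x Dx; congr complex.Re; symmetry.
      exact: (dev_mode psi_smooth z0 m i' j' ac (sub _ Dx)).
    have SI i' j' : CkS (chartset c N) k (fun m x =>
        complex.Im (letter (modes (chart_param c (point x))) (expi x.1.1) m i' j')).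
      apply: (eq_CkS oD _ (CkS_sub sub (S i' j').2)) => m x Dx; congr complex.Im; symmetry.
      exact: (dev_mode psi_smooth z0 m i' j' ac (sub _ Dx)).
    rewrite -(fintype.splitK p) -(fintype.splitK q) /L /realmx.
    case: (fintype.split p) => p'; case: (fintype.split q) => q' /=.
    - by apply: (eq_CkS oD _ (SR p' q')) => m x _; rewrite block_mxEul mxE.
    - apply: (eq_CkS oD _ (CkSL (-1) oD (SI p' q') (@CkS0 R E int _ k))) => m x _.
      by rewrite block_mxEur !mxE addr0 mulN1r.
    - by apply: (eq_CkS oD _ (SI p' q')) => m x _; rewrite block_mxEdl mxE.
    - by apply: (eq_CkS oD _ (SR p' q')) => m x _; rewrite block_mxEdr mxE.
  have W k p q := wsum_Ck oD (ctr (leqnn _)) Lb (LC k) analytic_word p q.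
  split=> k.
  - apply: (eq_Ck_on oD _ (W k (lshift n a) (lshift n b))) => x _.
    by rewrite /factor (letter_sum_real _ _ _ _ _).1.
  - apply: (eq_Ck_on oD _ (W k (rshift n a) (lshift n b))) => x _.
    by rewrite /factor (letter_sum_real _ _ _ _ _).2.
exact: (mxsmoothM oD P1 H1).
Qed.

(** By [quot_factor], only negative frequencies of [adjm (psi l z0) *m frame l z]
    depend on [z]. *)
Lemma frame_fourier z j m i : N z -> 0 <= m ->
  fourier (mulM (fun l => adjm (psi l z0)) (fun l => col j (frame l z))) m i =
  (m == 0)%:R * (i == j)%:R.
Proof.
move=> Nz m0; rewrite fourierE.
have e l : mulM (fun l => adjm (psi l z0)) (fun l => col j (frame l z)) l i 0 =
    (i == j)%:R + (-1) * letter_sum negative_word (modes z) l i j.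
  rewrite /mulM /frame colE !mulmxA; have := quot_factor l Nz; rewrite /quot => ->.
  rewrite -colE.
  by rewrite !mxE mulN1r.
under [X in fc X]eq_fun do rewrite e.
have nc := letter_sum_cont (fun m i j => modes_le m i j Nz) ctr1 negative_word i j.
rewrite fcD; [|exact/ccont_csquare/ccont_cst|exact/csquareZ/ccont_csquare].
rewrite fcZ ?fc_cst; last exact: ccont_csquare.
rewrite (letter_sum_fc (fun m i j => modes_le m i j Nz) ctr1) ?mulr0 ?addr0//.
by move=> w /negative_freq w0; apply: contraTneq m0 => <-; rewrite -ltNge.
Qed.

Lemma frame_column z j : N z -> V z (fun l => \col_i frame l z i j).
Proof.
move=> Nz; rewrite (frame_hardy Nz); exists (fun=> delta_mx j 0); first exact: hardy_cst.
by apply/funext => l; rewrite /mulM -colE; apply/colP => i; rewrite !mxE.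
Qed.

(** The dbar-derivative [w] of a column of [frame] is in [V p], hence of the form
    [mulM psi g] with [g] in the Hardy space. By [frame_fourier], the
    nonnegative Fourier coefficients of [mulM (adjm (psi l z0)) w], which is
    [mulM (1 - dev) g], vanish; so [g] is zero by [near1_kernel]. *)
Lemma frame_dbar c p (Fx Fy : 'I_n -> 'I_n -> circle R -> R[i]) : dbar_closed V ->
  (forall z, closed_subspace (V z)) -> atlas c -> chart_dom c p -> N p ->
  (forall i j, ccont (Fx i j)) -> (forall i j, ccont (Fy i j)) ->
  (forall i j, uniform_partials c (fun l z => frame l z i j) p (Fx i j) (Fy i j)) ->
  forall i j l, Fx i j l + Complex 0 1 * Fy i j l = 0.
Proof.
move=> dbar Vc ac cp Np xc yc H i j l.
pose f z : vfun R n := fun l => \col_i frame l z i j.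
pose fx : vfun R n := fun l => \col_i Fx i j l; pose fy : vfun R n := fun l => \col_i Fy i j l.
have hp : has_partials c f p fx fy.
  by apply: (partials_column oN) => // k; exact: frame_smooth.
have hw : V p (fun l => 2^-1 *: (fx l + Complex 0 1 *: fy l)).
  apply: (dbar N f oN _ _ p c fx fy) => // [z Nz|z d Nz ad dz]; first exact: frame_column.
  have /choice[X /choice[Y hXY]] : forall k, exists X Y, [/\ ccont X, ccont Y &
      uniform_partials d (fun l z => frame l z k j) z X Y].
    by move=> k; exact: (smooth_partials oN (frame_smooth k j) ad dz Nz).
  exists (fun l => \col_i X i l), (fun l => \col_i Y i l).
  apply: (partials_column oN) => // k; have [? ? ?] := hXY k => //; exact: frame_smooth.
set w := fun l => _ in hw.
have Ac : mcont (fun l => adjm (psi l z0)) by apply: adjm_cont; exact: psi_cont psi_smooth z0.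
have fE z : f z = fun l => col j (frame l z).
  by apply/funext => k; apply/colP => a; rewrite !mxE.
have [x2 y2 _] := hp.
have z0F m a : 0 <= m -> fourier (mulM (fun l => adjm (psi l z0)) fx) m a = 0 /\
    fourier (mulM (fun l => adjm (psi l z0)) fy) m a = 0.
  move=> m0; apply: (partials_fourier0 oN Np ac cp Ac hp (K := (m == 0)%:R * (a == j)%:R)) => z Nz.
    by have [VL2 _ _ _] := Vc z; apply: VL2; exact: frame_column.
  by rewrite fE; exact: frame_fourier.
have wF m a : 0 <= m -> fourier (mulM (fun l => adjm (psi l z0)) w) m a = 0.
  move=> m0; have [X0 Y0] := z0F m a m0.
  have fx2 := L2_mulM Ac x2 a; have fy2 := L2_mulM Ac y2 a.
  rewrite fourierE (_ : (fun l => _) = fun l =>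
    2^-1 * (mulM (fun l => adjm (psi l z0)) fx l a 0 + Complex 0 1 * mulM (fun l => adjm (psi l z0)) fy l a 0)).
    rewrite fcZ; last by apply: csquareD => //; exact: csquareZ.
    rewrite fcD//; last exact: csquareZ.
    by rewrite fcZ// -!fourierE X0 Y0 mulr0 addr0 mulr0.
  by apply/funext => k; rewrite /w /mulM -scalemxAr mulmxDr -scalemxAr !mxE.
move: hw; rewrite psi_hardy => -[g hg gw].
have g0 : l2norm g = 0.
  apply: (near1_kernel (dcont p) neta eta_ge0 (fun l i j => dev_le l i j Np) hg) => m a m0.
  rewrite -(wF m a m0) -gw; congr (fourier _ m a); rewrite mulMA.
  by congr mulM; apply/funext => k; rewrite /dev /quot opprB addrC subrK.
have w0 : l2norm w = 0.
  have pc := psi_cont psi_smooth p; have [C C0 pC] := mcont_bounded pc.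
  apply/eqP; rewrite eq_le l2norm_ge0 andbT -gw.
  have [g2 _] := hg.
  by have := l2norm_mulM pc pC (ltW C0) g2; rewrite g0 mulr0.
have wc a : ccont (fun l => w l a 0).
  rewrite (_ : (fun l => _) = fun l => 2^-1 * (Fx a j l + Complex 0 1 * Fy a j l)).
    apply: ccontM; first exact: ccont_cst.
    by apply: ccontD => //; apply: ccontM => //; exact: ccont_cst.
  by apply/funext => k; rewrite /w !mxE.
have := congr1 (fun v : 'cV[R[i]]_n => v i 0) (l2norm_ccont_eq0 wc w0 l).
rewrite /w !mxE => /eqP; rewrite mulf_eq0 invr_eq0.
by rewrite (negbTE (_ : 2 != 0 :> R[i])) ?pnatr_eq0//= => /eqP.
Qed.

Lemma frame_cderiv c p : dbar_closed V -> (forall z, closed_subspace (V z)) ->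
  atlas c -> chart_dom c p -> N p -> exists2 D : circle R -> 'M[R[i]]_n, mcont D &
  forall i j, uniform_cderiv c p (fun l z => frame l z i j) (fun l => D l i j).
Proof.
move=> dbar Vc ac cp Np.
have /choice[X /choice[Y hXY]] : forall x : 'I_n * 'I_n, exists X Y, [/\ ccont X, ccont Y &
    uniform_partials c (fun l z => frame l z x.1 x.2) p X Y].
  move=> x; exact: (smooth_partials oN (frame_smooth x.1 x.2) ac cp Np).
exists (fun l => \matrix_(i, j) X (i, j) l).
  by move=> i j; under eq_fun do rewrite mxE; have [] := hXY (i, j).
move=> i j; under [X in uniform_cderiv _ _ _ X]eq_fun do rewrite mxE.
have [_ _ H] := hXY (i, j); apply: (cauchy_riemann H) => l.
apply: (@frame_dbar c p (fun i j => X (i, j)) (fun i j => Y (i, j)) dbar Vc ac cp Np).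
- by move=> a b; have [] := hXY (a, b).
- by move=> a b; have [] := hXY (a, b).
- by move=> a b; have [] := hXY (a, b).
Qed.

Lemma frame_holomorphic l i j : dbar_closed V -> (forall z, closed_subspace (V z)) ->
  holomorphic_on N (fun z => frame l z i j).
Proof.
move=> dbar Vc c ac p Np cp; have [D _ /(_ i j) hD] := frame_cderiv dbar Vc ac cp Np.
have [_ _ K _ _] := atlas_chart ac.
exact: (@uniform_cderiv_holomorphic R M c p (fun l z => frame l z i j) _ l (K _ (mem_set cp)) hD).
Qed.

(** The remainder of the first-order expansion of [frame] is small uniformly on the
    circle, and a uniform bound for a matrix function bounds the multiplication
    operator. *)
Lemma frame_operator_holomorphic : dbar_closed V -> (forall z, closed_subspace (V z)) ->
  operator_holomorphic_on N (fun z => mulM (frame^~ z)).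
Proof.
move=> dbar Vc c ac p Np cp; have [D Dc hD] := frame_cderiv dbar Vc ac cp Np.
exists (mulM D); first exact: mulM_operator.
move=> e e0; have e1 : 0 < e / n.+1%:R by rewrite divr_gt0.
have n1 := near_forall (fun x : 'I_n * 'I_n => hD x.1 x.2 _ e1).
have [d d0 hd] := (cnbhsP _ _).1 (filterI n1 (near_chart oN Np ac cp)).
exists d => // h; rewrite -[h in normc h]subr0 => /hd [h1 h2] f f2.
have -> : (fun l => mulM (frame^~ (chart_param c (chart_coord c p + h))) f l
    - mulM (frame^~ p) f l - h *: mulM D f l) =
    mulM (fun l => frame l (chart_param c (chart_coord c p + h)) - frame l p - h *: D l) f.
  by apply/funext => l; rewrite /mulM !mulmxBl scalemxAl.
have c3 : mcont (fun l => frame l (chart_param c (chart_coord c p + h)) - frame l p - h *: D l).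
  apply: mcontB; first by apply: mcontB; exact: frame_cont.
  by move=> i j; under eq_fun do rewrite mxE; apply: ccontM; [exact: ccont_cst|exact: Dc].
have K0 : 0 <= e / n.+1%:R * normc h by rewrite mulr_ge0 ?normc_ge0// ltW.
apply: (le_trans (l2norm_mulM c3 _ K0 f2)).
  have entry (A B C : 'M[R[i]]_n) i j : (A - B - h *: C) i j = A i j - B i j - h * C i j.
    by rewrite !mxE.
  by move=> l i j; rewrite entry; exact: (h1 (i, j)).
rewrite subr0 ler_wpM2r ?l2norm_ge0// mulrA ler_wpM2r ?normc_ge0// mulrCA ler_piMr ?(ltW e0)//.
by rewrite ler_pdivrMr// mul1r ler_nat.
Qed.

Lemma frame_invertible z : N z -> l2_invertible (mulM (frame^~ z)).
Proof.
move=> Nz; split; first exact: mulM_operator (frame_cont Nz).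
have ic : mcont (fun l => invmx (frame l z)).
  by apply: mcontV (frame_cont Nz) => l; exact: frame_unit.
exists (mulM (fun l => invmx (frame l z))); first exact: mulM_operator.
move=> f f2; rewrite !mulMA; split.
- rewrite (_ : mulM _ f = f); first exact: aeq_refl.
  by apply/funext => l; rewrite /mulM mulmxV ?mul1mx ?frame_unit.
- rewrite (_ : mulM _ f = f); first exact: aeq_refl.
  by apply/funext => l; rewrite /mulM mulVmx ?mul1mx ?frame_unit.
Qed.

Lemma frame_trivialization : dbar_closed V -> (forall z, closed_subspace (V z)) ->
  [/\ forall l z, N z -> frame l z \in unitmx,
      forall i j, smooth_circle N (fun l z => frame l z i j),
      forall l i j, holomorphic_on N (fun z => frame l z i j) &
      forall z, N z -> V z = mulM (frame^~ z) @` @hardy R n].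
Proof.
move=> dbar Vc; split; [exact: frame_unit|exact: frame_smooth| |exact: frame_hardy].
by move=> l i j; exact: frame_holomorphic.
Qed.

Lemma frame_subbundle : dbar_closed V -> (forall z, closed_subspace (V z)) ->
  [/\ forall z, N z -> l2_invertible (mulM (frame^~ z)),
      operator_holomorphic_on N (fun z => mulM (frame^~ z)) &
      forall z, N z -> forall g, V z g <->
        L2 g /\ exists2 f, @hardy R n f & aeq g (mulM (frame^~ z) f)].
Proof.
move=> dbar Vc; split; [exact: frame_invertible|exact: frame_operator_holomorphic|].
move=> z Nz g; rewrite (frame_hardy Nz); split.
  move=> [f hf <-]; split; last by exists f => //; exact: aeq_refl.
  by apply: L2_mulM; [exact: frame_cont|case: hf].
move=> [g2 [f hf gf]]; rewrite -(frame_hardy Nz); apply: (closed_aeq (Vc z) _ g2 gf).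
by rewrite (frame_hardy Nz); exists f.
Qed.

End HolomorphicFrame.
Theorem theorem3p3 (R : realType) (M : riemannSurface R) (n : nat)
    (V : M -> set (vfun R n))
    (V_closed : forall z : M, closed_subspace (V z))
    (V_shift : forall z : M, shift_invariant (V z))
    (V_pure : forall z : M, pure_shift (V z))
    (V_smooth : smooth_wandering_subbundle V n) :
  (exists psi : circle R -> M -> 'M[R[i]]_n,
     [/\ forall i j, smooth_circle [set: M] (fun l z => psi l z i j),
         forall l z, psi l z \is unitarymx,
         forall z, psi (circle1 R) z = 1%:M &
         forall z, V z = mulM (psi^~ z) @` @hardy R n]) /\
  (dbar_closed V ->
     (forall z0 : M, exists (N : set M) (u : circle R -> M -> 'M[R[i]]_n),
        [/\ open N /\ N z0,
            forall l z, N z -> u l z \in unitmx,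
            forall i j, smooth_circle N (fun l z => u l z i j),
            forall l i j, holomorphic_on N (fun z => u l z i j) &
            forall z, N z -> V z = mulM (u^~ z) @` @hardy R n]) /\
     holomorphic_subbundle V).
Proof.
have [psi [ps pu p1 pV]] := unitary_frame V_closed V_shift V_smooth.
split; first by exists psi.
move=> dbar.
pose theta : R := (4 * n.+1%:R)^-1; pose eta : R := theta / (n + n).+1%:R.
have theta0 : 0 < theta by rewrite invr_gt0 mulr_gt0.
have eta0 : 0 < eta by rewrite divr_gt0.
have theta_small : n.+1%:R * theta <= 1 / 4.
  by rewrite /theta invfM mulrCA mulfV ?pnatr_eq0// mulr1 div1r.
have eta_small : (n + n).+1%:R * eta <= theta by rewrite /eta mulrC divfK ?pnatr_eq0.
have local z0 := small_modes ps pu z0 eta0.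
split=> z0; have [N [eps [oN Nz0 eps0 epsb le]]] := local z0.
- have [] := frame_trivialization ps pu pV oN eps0 epsb le theta0 theta_small eta_small dbar V_closed.
  by exists N, (frame psi z0).
- have [] := frame_subbundle ps pu pV oN eps0 epsb le theta0 theta_small eta_small dbar V_closed.
  exists N, (fun z => mulM (frame psi z0 ^~ z)), (@hardy R n); split=> //.
  exact: hardy_closed.
Qed.
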